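(* Let $p:\mathbb{R}^n\to[1,\infty)$ be a measurable function with $1<p_-\le p_+<\infty$. (i) Suppose there exists a family $l=\{l_{\mathcal{Q}}\}_{\mathcal{Q}\in\mathcal{Y}^n}$ of Banach sequential spaces for which $L^{p(\cdot)}(\mathbb{R}^n)$ satisfies a uniformly lower and a uniformly upper $l$-estimate. Then $M$ is bounded on $L^{p(\cdot)}(\mathbb{R}^n)$ if and only if $dx\in A_{p(\cdot)}$. (ii) Suppose there exists a family $l=\{l_{\mathcal{Q}}\}_{\mathcal{Q}\in\mathcal{Y}^n_{loc}}$ of Banach sequential spaces for which $L^{p(\cdot)}(\mathbb{R}^n)$ satisfies a uniformly lower and a uniformly upper $l_{loc}$-estimate. Then $M^{loc}$ is bounded on $L^{p(\cdot)}(\mathbb{R}^n)$ if and only if $dx\in A^{loc}_{p(\cdot)}$.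
   Context: For a measurable exponent $p(\cdot)$ on $\mathbb{R}^n$, put $p_-=\inf_{x}p(x)$, $p_+=\sup_{x}p(x)$, and define $p'(\cdot)$ by $\frac1{p(x)}+\frac1{p'(x)}=1$. $L^{p(\cdot)}(\mathbb{R}^n)$ is the space of measurable functions $f$ with $\int_{\mathbb{R}^n}|f(x)/\lambda|^{p(x)}dx<\infty$ for some $\lambda>0$, with $\|f\|_{p(\cdot)}=\inf\{\lambda>0:\int_{\mathbb{R}^n}|f(x)/\lambda|^{p(x)}dx\le1\}$. All cubes have sides parallel to the coordinate axes. $Mf(x)=\sup_{Q\ni x}\frac1{|Q|}\int_Q|f(y)|dy$, the supremum over all cubes $Q$ containing $x$; $M^{loc}f(x)=\sup_{Q\ni x,\,|Q|\le1}\frac1{|Q|}\int_Q|f(y)|dy$. $\mathcal{Y}^n$ is the set of all families $\mathcal{Q}=\{Q_i\}$ of pairwise disjoint open cubes in $\mathbb{R}^n$ whose union is $\mathbb{R}^n$ up to a set of measure zero; $\mathcal{Y}^n_{loc}$ is the set of such families in which every cube has measure less than $1$. For each family $\mathcal{Q}$, $l_{\mathcal{Q}}$ denotes a Banach sequential space (BSS) of sequences indexed by $\mathcal{Q}$, i.e. a Banach function space over the set $\mathcal{Q}$ with counting measure: a Banach space with a lattice norm ($|t_Q|\le|s_Q|$ for all $Q$ implies $\|t\|_{l_{\mathcal{Q}}}\le\|s\|_{l_{\mathcal{Q}}}$), having the Fatou property, and containing all finitely supported sequences; the norm of a sequence not in $l_{\mathcal{Q}}$ is $\infty$. $\{e_Q\}_{Q\in\mathcal{Q}}$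 are the standard unit vectors. Given $l=\{l_{\mathcal{Q}}\}_{\mathcal{Q}\in\mathcal{Y}^n}$ (resp. $l=\{l_{\mathcal{Q}}\}_{\mathcal{Q}\in\mathcal{Y}^n_{loc}}$), $L^{p(\cdot)}(\mathbb{R}^n)$ satisfies a uniformly upper $l$-estimate (resp. $l_{loc}$-estimate) if there is $C>0$ such that for every $f\in L^{p(\cdot)}(\mathbb{R}^n)$ and every $\mathcal{Q}\in\mathcal{Y}^n$ (resp. $\mathcal{Q}\in\mathcal{Y}^n_{loc}$) $$\|f\|_{p(\cdot)}\le C\Big\|\sum_{Q\in\mathcal{Q}}\|f\chi_Q\|_{p(\cdot)}\,e_Q\Big\|_{l_{\mathcal{Q}}},$$ and a uniformly lower $l$-estimate (resp. $l_{loc}$-estimate) if there is $C>0$ such that for all such $f$ and $\mathcal{Q}$ $$\Big\|\sum_{Q\in\mathcal{Q}}\|f\chi_Q\|_{p(\cdot)}\,e_Q\Big\|_{l_{\mathcal{Q}}}\le C\|f\|_{p(\cdot)}.$$ $dx\in A_{p(\cdot)}$ (resp. $dx\in A^{loc}_{p(\cdot)}$) means that there is $C>0$ such that $\frac1{|Q|}\|\chi_Q\|_{p(\cdot)}\|\chi_Q\|_{p'(\cdot)}\le C$ for every cube $Q$ (resp. for every cube $Q$ with $|Q|\le1$). *)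

(* Defs.v *)
From HB Require Import structures.
From mathcomp Require Import all_boot all_order all_algebra.
From mathcomp Require Import all_classical all_reals all_analysis.

Set Implicit Arguments.
Unset Strict Implicit.
Unset Printing Implicit Defensive.

Import Order.TTheory GRing.Theory Num.Theory.
Import numFieldNormedType.Exports.

Local Open Scope classical_set_scope.
Local Open Scope ring_scope.

Section LebesgueMeasureRn.
Variable R : realType.
Notation RR := (measurableTypeR R).

Definition tuple_cons (n : nat) (z : n.-tuple RR * RR) : n.+1.-tuple RR :=
  [tuple of z.2 :: z.1].

Lemma measurable_tuple_cons (n : nat) :
  measurable_fun [set: n.-tuple RR * RR] (@tuple_cons n).
Proof. exact: measurable_cons. Qed.

Definition cons_measure (n : nat) (m : {measure set (n.-tuple RR) -> \bar R}) :
    set (n.+1.-tuple RR) -> \bar R :=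
  pushforward (m \x @lebesgue_measure R)%E (@tuple_cons n).

HB.instance Definition _ (n : nat) m :=
  Measure.copy (@cons_measure n m)
    (measure_function_pushforward__canonical__measure_function_Measure
       (m \x @lebesgue_measure R)%E (@measurable_tuple_cons n)).

Fixpoint borel_lebesgue (n : nat) : {measure set (n.-tuple RR) -> \bar R} :=
  match n with
  | 0 => \d_ ([tuple] : 0.-tuple RR)
  | m.+1 => cons_measure (borel_lebesgue m)
  end.

(* The carrier is n.-tuple R; the sigma-algebra is the one of all
   Lebesgue-measurable sets, i.e. the Caratheodory-measurable sets of the outer
   measure induced by [borel_lebesgue n]. *)
Definition Rn (n : nat) := caratheodory_type (mu_ext (borel_lebesgue n)).

HB.instance Definition _ (n : nat) :=
  Measurable.copy (Rn n) (caratheodory_type (mu_ext (borel_lebesgue n))).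

Definition lebesgue_Rn (n : nat) : {measure set (Rn n) -> \bar R} :=
  @completed_measure_extension _ _ R (borel_lebesgue n).

End LebesgueMeasureRn.

Section VariableLebesgue.
Variables (R : realType) (n : nat).
Local Open Scope ereal_scope.
Notation mu := (@lebesgue_Rn R n).
Implicit Types (p : Rn R n -> R) (f : Rn R n -> R) (g : Rn R n -> \bar R).

Definition p_minus p : \bar R := ereal_inf (range (EFin \o p)).
Definition p_plus p : \bar R := ereal_sup (range (EFin \o p)).

Definition conj_exponent p : Rn R n -> R := fun x => ((1 - (p x)^-1)^-1)%R.

(* Stated for extended-real functions because maximal functions may be
   infinite on a null set. *)
Definition modular p g (lambda : R) : \bar R :=
  \int[mu]_x ((`|g x| / lambda%:E) `^ p x).

Definition vnorm p g : \bar R :=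
  ereal_inf
    [set lambda%:E | lambda in
       [set lambda : R | (0 < lambda)%R /\ modular p g lambda <= 1]].

Definition in_Lp p f : Prop :=
  measurable_fun setT f /\
  exists lambda : R, (0 < lambda)%R /\ modular p (EFin \o f) lambda < +oo.

End VariableLebesgue.

Section Cubes.
Variables (R : realType) (n : nat).
Notation mu := (@lebesgue_Rn R n).

Definition open_cube (a : n.-tuple R) (s : R) : set (Rn R n) :=
  [set x | forall i, tnth a i < tnth x i < tnth a i + s].

Definition closed_cube (a : n.-tuple R) (s : R) : set (Rn R n) :=
  [set x | forall i, tnth a i <= tnth x i <= tnth a i + s].

Definition open_cubes : set (set (Rn R n)) :=
  [set Q | exists a s, 0 < s /\ Q = open_cube a s].

Definition cubes : set (set (Rn R n)) :=
  [set Q | exists a s, 0 < s /\ (Q = open_cube a s \/ Q = closed_cube a s)].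

Definition local_cubes : set (set (Rn R n)) :=
  [set Q | cubes Q /\ (mu Q <= 1)%E].

Definition cube_partitions : set (set (set (Rn R n))) :=
  [set Qs | [/\ Qs `<=` open_cubes, trivIset Qs id &
                (mu (~` \bigcup_(Q in Qs) Q) = 0)%E]].

Definition local_cube_partitions : set (set (set (Rn R n))) :=
  [set Qs | cube_partitions Qs /\ forall Q, Qs Q -> (mu Q < 1)%E].

End Cubes.

Arguments cubes : clear implicits.
Arguments local_cubes : clear implicits.
Arguments cube_partitions : clear implicits.
Arguments local_cube_partitions : clear implicits.

(* The norm is defined on all sequences; the space is the set of sequences
   where it is finite. *)
Record sequential_space (R : realType) (I : Type) := SequentialSpace {
  bss_norm : (I -> R) -> \bar R;
  bss_norm_ge0 : forall t, (0 <= bss_norm t)%E;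
  bss_norm_eq0 : forall t, bss_norm t = 0%E -> forall i, t i = 0;
  bss_normZ : forall a t,
    bss_norm (fun i => a * t i) = (`|a|%:E * bss_norm t)%E;
  bss_normD : forall s t,
    (bss_norm (fun i => s i + t i)%R <= bss_norm s + bss_norm t)%E;
  bss_complete : forall u : nat -> I -> R,
    (forall k, bss_norm (u k) < +oo)%E ->
    (forall e : R, 0 < e -> exists N, forall j k, (N <= j)%N -> (N <= k)%N ->
       (bss_norm (fun i => u j i - u k i)%R < e%:E)%E) ->
    exists2 t, (bss_norm t < +oo)%E &
      bss_norm (fun i => u k i - t i) @[k --> \oo] --> 0%E;
  bss_lattice : forall s t, (forall i, `|t i| <= `|s i|) ->
    (bss_norm t <= bss_norm s)%E;
  bss_fatou : forall (u : nat -> I -> R) (t : I -> R),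
    (forall k i, 0 <= u k i <= u k.+1 i) ->
    (forall i, u k i @[k --> \oo] --> t i) ->
    bss_norm (u k) @[k --> \oo] --> bss_norm t;
  bss_finsupp : forall t, finite_set [set i | t i != 0] ->
    (bss_norm t < +oo)%E }.

Section Conditions.
Variables (R : realType) (n : nat).
Local Open Scope ereal_scope.
Notation mu := (@lebesgue_Rn R n).
Implicit Types (p : Rn R n -> R) (B : set (set (Rn R n))).

(* The sequence sum_Q ||f chi_Q|| e_Q. *)
Definition local_norms p (f : Rn R n -> R) (Qs : set (set (Rn R n))) :
    Qs -> R :=
  fun Q => fine (vnorm p (fun x => (f x * \1_(val Q) x)%:E)).

(* In the next two definitions Y is the class of partitions over which
   uniformity is required. *)
Definition upper_estimate p (Y : set (set (set (Rn R n))))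
    (l : forall Qs : Y, sequential_space R (val Qs)) : Prop :=
  exists C : R, (0 < C)%R /\
    forall f, in_Lp p f -> forall Qs : Y,
      vnorm p (EFin \o f) <= C%:E * bss_norm (l Qs) (@local_norms p f (val Qs)).

Definition lower_estimate p (Y : set (set (set (Rn R n))))
    (l : forall Qs : Y, sequential_space R (val Qs)) : Prop :=
  exists C : R, (0 < C)%R /\
    forall f, in_Lp p f -> forall Qs : Y,
      bss_norm (l Qs) (@local_norms p f (val Qs)) <= C%:E * vnorm p (EFin \o f).

(* B is the class of admissible cubes: [cubes] gives M and A_p(.),
   [local_cubes] gives their local versions. *)
Definition maximal B (f : Rn R n -> R) (x : Rn R n) : \bar R :=
  ereal_sup [set (\int[mu]_(y in Q) `|f y|%:E) / mu Q | Q in [set Q | B Q /\ Q x]].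

Definition maximal_bounded B p : Prop :=
  exists C : R, (0 < C)%R /\
    forall f, in_Lp p f ->
      vnorm p (maximal B f) <= C%:E * vnorm p (EFin \o f).

Definition muckenhoupt B p : Prop :=
  exists C : R, (0 < C)%R /\
    forall Q, B Q ->
      vnorm p (EFin \o \1_Q) * vnorm (conj_exponent p) (EFin \o \1_Q) / mu Q
        <= C%:E.

End Conditions.

(* Main.v *)
(** The hard implication is from the A_p condition to the boundedness of the
    maximal operator.  It is proved with modulars, the integrals of (f / c)^p,
    rather than with norms.  The two l-estimates are used only through their
    consequence that ||u chi_Q|| <= ||v chi_Q|| for all Q in a partition implies
    ||u|| <= C ||v||, applied to partitions into dyadic cubes of variable size
    given by a stopping rule.

    Together with A_p this makes averaging over stopped cubes bounded.  Hence a
    set filling half of each cube of a disjoint family carries a fixed part of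
    the modular of any constant on the union, for p and, by duality, for p'.
    Iterating over chains of nested sets yields a reverse Hoelder inequality for
    t^p and s^p', where t and s are the inverse norms of chi_Q.

    On the cubes where the average of f lies in ]l, 2 l] let
    g = f^(1 - e) l^e chi_(f > l / 2).  On a good cube the modular of l is at most
    a multiple of that of g; since g uses only the values of f above l / 2, the
    sum over l = 2^j is bounded.  On a bad cube l is much smaller than t and the
    p-th power of l / t oscillates strongly, so transplanting bumps from the set
    where this power is small to the set where it is large, and applying the
    consequence of the l-estimates once more, bounds the modular of l on all bad
    cubes by a multiple of a positive power of l, which is summable for l < 1.

    Every cube is contained in a comparable cell of one of 2^n shifted dyadic
    grids.  For the local operator, cubes of side between 1/6 and 1 are reached by
    iterating averages at one fixed scale.  The converse implication follows by
    applying the maximal operator to s^(p' - 1) chi_Q. *)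

Require Import Defs.
From mathcomp Require Import all_boot all_order all_algebra.
From mathcomp Require Import all_classical all_reals all_analysis.
From mathcomp Require Import measurable_realfun ring lra zify.
Set Implicit Arguments.
Unset Strict Implicit.
Unset Printing Implicit Defensive.
Import Order.TTheory GRing.Theory Num.Theory.
Import numFieldNormedType.Exports.
Local Open Scope classical_set_scope.
Local Open Scope ring_scope.

(** * Real powers and integrals *)

Section RealPowers.
Context {R : realType}.
Implicit Types (a b c p r : R).

(** The obstacle: without regularity of p the modular is far from homogeneous. A_p says that t has
    modular at most one on a cell, and nothing in it compares the modulars of l and of f where l is
    far from t. Write l = t^th. The gain eta in the reverse Hölder inequality handles every th in
    [0, 1 + eta], so such cells are good. On a bad cell th lies outside this range, and since the
    normalisation of f gives l < t, this forces l < 1 and l / t <= l^kappa: failure of the local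
    estimate is itself a smallness statement. The function g comes from writing f = g (f / l)^e
    where f > l / 2. Young's inequality pairs the two factors; the p'-modular of the second is
    controlled by the reverse Hölder inequality for s^p' and by the average of f itself. The factor
    l^e in g turns the sum over the levels l = 2^j into a geometric series at each point. On the bad
    cells let X be the modulars of l. Bumps of height tied to (l / t)^(1/2) rather than l / t bound
    the sum of the X^(1/2); as X <= l^kappa, the other half of the power is left over as decay in
    l. *)

Definition cexp p : R := (1 - p^-1)^-1.

Lemma cexp_gt1 p : 1 < p -> 1 < cexp p.
Proof.
move=> p1; have p0 : 0 < p by lra.
have h : 0 < p^-1 by rewrite invr_gt0.
have h1 : p^-1 < 1 by rewrite invf_lt1.
by rewrite /cexp invf_gt1; lra.
Qed.

Lemma cexp_sub1 p : 1 < p -> (cexp p - 1) * p = cexp p.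
Proof.
move=> p1; rewrite /cexp.
have p0 : p != 0 by apply/eqP; lra.
have h1 : p - 1 != 0 by apply/eqP; lra.
have -> : 1 - p^-1 = (p - 1) / p by field.
by field; rewrite p0.
Qed.

Lemma cexp_le p r : 1 < r -> r <= p -> cexp p <= cexp r.
Proof.
move=> r1 rp; have p0 : 0 < p by lra.
have r0 : 0 < r by lra.
have h : p^-1 <= r^-1 by rewrite lef_pV2.
have h1 : r^-1 < 1 by rewrite invf_lt1.
have h2 : p^-1 < 1 by rewrite invf_lt1; lra.
by rewrite /cexp lef_pV2 ?posrE; lra.
Qed.

Lemma young_le a b p : 0 <= a -> 0 <= b -> 1 < p ->
  a * b <= a `^ p + b `^ (cexp p).
Proof.
move=> a0 b0 p1.
have q1 := cexp_gt1 p1.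
have e : p^-1 + (cexp p)^-1 = 1 by rewrite /cexp invrK; lra.
have := @conjugate_powR _ a b p (cexp p) a0 b0 _ _ e.
have p0 : 0 < p by lra.
have q0 : 0 < cexp p by lra.
move=> /(_ p0 q0); move/le_trans; apply.
by apply: lerD; rewrite ler_pdivrMr// ler_peMr ?powR_ge0//; lra.
Qed.

(** Young's inequality for the conjugate exponents 1 + r and (1 + r) / r. A small r costs little on
    the first factor, which the reverse Hölder inequality will have to absorb. *)
Lemma mul_le_powR_add a b r : 0 <= a -> 0 <= b -> 0 < r ->
  a * b <= a `^ (1 + r) + b `^ ((1 + r) / r).
Proof.
move=> a0 b0 r0; have r1 : 1 < 1 + r by lra.
have -> : (1 + r) / r = cexp (1 + r).
  rewrite /cexp; have -> : 1 - (1 + r)^-1 = r / (1 + r).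
    by field; apply/eqP; lra.
  by rewrite invf_div.
exact: young_le.
Qed.

Lemma powR_le_1D a r s : 0 <= a -> 0 <= r -> r <= s -> a `^ r <= 1 + a `^ s.
Proof.
move=> a0 r0 rs; have [a1|a1] := leP 1 a.
  by rewrite (le_trans (ler_powR a1 rs))// lerDr.
rewrite (@le_trans _ _ 1)//; last by rewrite lerDl powR_ge0.
by have := @ge0_ler_powR _ r r0 a 1; rewrite !nnegrE powR1; apply => //; exact: ltW.
Qed.

Lemma powR_ge1 a r : 1 <= a -> 0 <= r -> 1 <= a `^ r.
Proof. by move=> a1 r0; rewrite -[leLHS](powRr0 a); exact: ler_powR. Qed.

Lemma powR_le1 a r : 0 <= a <= 1 -> 0 <= r -> a `^ r <= 1.
Proof.
move=> /andP[a0 a1] r0.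
by have := @ge0_ler_powR _ r r0 a 1; rewrite !nnegrE powR1; apply.
Qed.

Lemma powR_le_self a r : 0 <= a <= 1 -> 1 <= r -> a `^ r <= a.
Proof.
move=> /andP[]; rewrite le_eqVlt => /predU1P[<- _ r1|a0 a1 r1].
  by rewrite powR0//; apply/eqP; lra.
by apply: ge1r_powR => //; rewrite a0.
Qed.

Lemma self_le_powR a r : 1 <= a -> 1 <= r -> a <= a `^ r.
Proof. exact: le1r_powR. Qed.

Lemma powRV a r : 0 <= a -> a^-1 `^ r = (a `^ r)^-1.
Proof.
move=> a0; rewrite -powR_inv1// -powRrM mulN1r powRN //.
Qed.

End RealPowers.

Section Integrals.
Context {R : realType} {d} {T : measurableType d} {mu : {measure set T -> \bar R}}.
Implicit Types (A B : set T) (F G : T -> R).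
Local Notation I A F := (\int[mu]_(x in A) (F x)%:E)%E.

Lemma measurable_powR2 F G : measurable_fun setT F -> measurable_fun setT G ->
  measurable_fun setT (fun x => F x `^ G x).
Proof.
move=> mF mG; rewrite /powR.
apply: measurable_fun_ifT.
- by apply: measurable_fun_eqr => //; exact: measurable_cst.
- have -> : (fun x => (G x == 0)%:R) = (fun x => if G x == 0 then 1 else 0 : R).
    by apply/funext => x; case: eqP.
  apply: measurable_fun_ifT => //.
  by apply: measurable_fun_eqr => //; exact: measurable_cst.
- apply: measurableT_comp => //; apply: measurable_funM => //.
  exact: measurableT_comp.
Qed.

Lemma I_ge0 A F : (forall x, A x -> 0 <= F x) -> (0 <= I A F)%E.
Proof. by move=> F0; apply: integral_ge0 => x Ax; rewrite lee_fin F0. Qed.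

Lemma I_le A F G : measurable A -> measurable_fun setT F ->
  measurable_fun setT G -> (forall x, A x -> 0 <= F x <= G x) ->
  (I A F <= I A G)%E.
Proof.
move=> mA mF mG FG; apply: ge0_le_integral => //.
- by move=> x /FG /andP[]; rewrite lee_fin.
- by apply/measurable_EFinP; exact: measurable_funTS.
- by apply/measurable_EFinP; exact: measurable_funTS.
- by move=> x /FG /andP[]; rewrite lee_fin.
Qed.

Lemma I_eq A F G : (forall x, A x -> F x = G x) -> I A F = I A G.
Proof. by move=> FG; apply: eq_integral => x /set_mem /FG ->. Qed.

Lemma I_subset A B F : measurable A -> measurable B -> measurable_fun setT F ->
  (forall x, B x -> 0 <= F x) -> A `<=` B -> (I A F <= I B F)%E.
Proof.
move=> mA mB mF F0 AB; apply: ge0_subset_integral => //.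
by apply/measurable_EFinP; exact: measurable_funTS.
Qed.

Lemma I_add A F G : measurable A -> measurable_fun setT F ->
  measurable_fun setT G -> (forall x, A x -> 0 <= F x) ->
  (forall x, A x -> 0 <= G x) ->
  I A (fun x => F x + G x) = (I A F + I A G)%E.
Proof.
move=> mA mF mG F0 G0.
rewrite -ge0_integralD//; try by apply/measurable_EFinP; exact: measurable_funTS.
Qed.

Lemma I_scale A c F : measurable A -> measurable_fun setT F -> 0 <= c ->
  (forall x, A x -> 0 <= F x) ->
  I A (fun x => c * F x) = (c%:E * I A F)%E.
Proof.
move=> mA mF c0 F0; rewrite -ge0_integralZl_EFin//.
by apply/measurable_EFinP; exact: measurable_funTS.
Qed.

Lemma I_cst A c : measurable A -> I A (fun=> c) = (c%:E * mu A)%E.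
Proof. by move=> mA; rewrite (integral_cst _ mA). Qed.

Lemma I_sum (J : Type) (s : seq J) (F : J -> T -> R) A : measurable A ->
  (forall j, measurable_fun setT (F j)) -> (forall j x, A x -> 0 <= F j x) ->
  I A (fun x => \sum_(j <- s) F j x) = (\sum_(j <- s) I A (F j))%E.
Proof.
move=> mA mF F0; rewrite -ge0_integral_sum//.
- by apply: eq_integral => x _; rewrite sumEFin.
- by move=> j; apply/measurable_EFinP; exact: measurable_funTS.
Qed.

Lemma I_indic A B F : I A (fun x => F x * \1_B x) = I (A `&` B) F.
Proof.
rewrite [LHS]integral_mkcond [RHS]integral_mkcond; apply: eq_integral => x _.
rewrite /patch in_setI indicE; case: (x \in A) => //=.
by case: (x \in B); rewrite ?mulr1 ?mulr0.
Qed.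

Lemma I_setU A B F : measurable A -> measurable B -> measurable_fun setT F ->
  (forall x, (A `|` B) x -> 0 <= F x) -> [disjoint A & B] ->
  I (A `|` B) F = (I A F + I B F)%E.
Proof.
move=> mA mB mF F0 dAB; rewrite ge0_integral_setU//.
by apply/measurable_EFinP; exact: measurable_funTS.
Qed.

Lemma I_bigcup (S : nat -> set T) F : (forall i, measurable (S i)) ->
  trivIset setT S -> measurable_fun setT F -> (forall x, 0 <= F x) ->
  I (\bigcup_i S i) F = (\sum_(i <oo) I (S i) F)%E.
Proof.
move=> mS tS mF F0; rewrite ge0_integral_bigcup//.
- by apply/measurable_EFinP; exact: measurable_funTS.
- by move=> x _; rewrite lee_fin.
Qed.

Lemma I_bigcup_le (S : nat -> set T) F G : (forall i, measurable (S i)) ->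
  trivIset setT S -> measurable_fun setT F -> measurable_fun setT G ->
  (forall x, 0 <= F x) -> (forall x, 0 <= G x) ->
  (forall i, I (S i) F <= I (S i) G)%E ->
  (I (\bigcup_i S i) F <= I (\bigcup_i S i) G)%E.
Proof.
move=> mS tS mF mG F0 G0 FG; rewrite !I_bigcup//.
by apply: lee_nneseries => [i _ _|i _]; [exact: I_ge0|exact: FG].
Qed.

Lemma I_nondecreasing_le (S : nat -> set T) F c : (forall i, measurable (S i)) ->
  {homo S : m n / (m <= n)%N >-> m `<=` n} -> measurable_fun setT F ->
  (forall x, 0 <= F x) -> (forall i, I (S i) F <= c)%E ->
  (I (\bigcup_i S i) F <= c)%E.
Proof.
move=> mS hS mF F0 Fc.
have h : (I (S i) F @[i --> \oo] --> I (\bigcup_i S i) F)%E.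
  apply: (@ge0_nondecreasing_set_cvg_integral _ _ R S (EFin \o F) mu) => //.
  - by move=> m n mn; apply/subsetPset; exact: hS.
  - by move=> i; apply/measurable_EFinP; exact: measurable_funTS.
  - by move=> i x _; rewrite lee_fin.
rewrite -(cvg_lim _ h)//; apply: lime_le; last exact: nearW.
by apply/cvg_ex; eexists; exact: h.
Qed.

Lemma I_null A B F : measurable A -> measurable B -> measurable_fun setT F ->
  (forall x, 0 <= F x) -> mu B = 0%E -> I (A `|` B) F = I A F.
Proof.
move=> mA mB mF F0 B0; apply/eqP; rewrite eq_le; apply/andP; split; last first.
  by apply: I_subset => //; exact: measurableU.
have -> : A `|` B = A `|` (B `\` A).
  by apply/seteqP; split=> x /=; have [] := pselect (A x); tauto.
have mD : measurable (B `\` A) by exact: measurableD.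
rewrite I_setU//; last by apply/disj_setPS => x [? []].
rewrite [X in (_ + X)%E](_ : _ = 0%E) ?adde0//.
apply: null_set_integral => //.
  by apply/measurable_EFinP; exact: measurable_funTS.
by apply/eqP; rewrite -measure_le0 -B0 le_measure ?inE//; exact: subDsetl.
Qed.

End Integrals.

(** * Nested partitions and stopping *)

Section Filtrations.
Context {R : realType} {d} {T : measurableType d}.
Variables (mu : {measure set T -> \bar R}) (cn : R).
Implicit Types (A B : set T) (F G : T -> R).
Local Notation I A F := (\int[mu]_(x in A) (F x)%:E)%E.

(* [filtration_density] takes the place of the Lebesgue density theorem. *)
Record filtration := Filtration {
  idx : nat -> T -> nat;
  cell_size : nat -> R;
  idx_nested : forall k x y, idx k.+1 x = idx k.+1 y -> idx k x = idx k y;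
  measurable_idx : forall k i, measurable [set y | idx k y = i];
  cell_size_gt0 : forall k, 0 < cell_size k;
  mu_idx : forall k x, mu [set y | idx k y = idx k x] = (cell_size k)%:E;
  cell_size_doubling : forall k, cell_size k <= cn * cell_size k.+1;
  filtration_density : forall k x N, measurable N ->
    N `<=` [set y | idx k y = idx k x] ->
    (forall j y, (k <= j)%N -> idx k y = idx k x ->
       mu (N `&` [set z | idx j z = idx j y]) <= (2^-1 * cell_size j)%:E)%E ->
    mu N = 0%E }.

Definition cell (f : filtration) k x := [set y | idx f k y = idx f k x].

Definition cell_invariant (f : filtration) (P : nat -> set T) :=
  forall k x y, cell f k x y -> P k x -> P k y.

(** [find] returns [K] when no generation before [K] satisfies [P]. Every point thus has a stopped
    cell and these cells partition the whole space; [reached] separates the points stopped by [P],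
    generation [K] included, from those that ran out of generations. *)
Definition stop K (P : nat -> set T) (x : T) : nat :=
  find (fun k => `[< P k x >]) (iota 0 K).

Definition reached K (P : nat -> set T) : set T :=
  [set x | exists2 k, (k <= K)%N & P k x].

Variable f : filtration.
Local Notation cl := (cell f).
Local Notation m := (cell_size f).

Lemma cell_eq k x y : cl k x y -> cl k y = cl k x.
Proof. by rewrite /cell /= => ->. Qed.

Lemma cell_sym k x y : cl k x y -> cl k y x.
Proof. by rewrite /cell /= => ->. Qed.

Lemma idx_le j k x y : (j <= k)%N -> idx f k x = idx f k y -> idx f j x = idx f j y.
Proof.
elim: k => [|k IH]; first by rewrite leqn0 => /eqP ->.
rewrite leq_eqVlt => /predU1P[->//|jk /idx_nested]; exact: IH.
Qed.

Lemma cell_subset j k x : (j <= k)%N -> cl k x `<=` cl j x.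
Proof. by move=> jk y; exact: idx_le. Qed.

Lemma measurable_cell k x : measurable (cl k x).
Proof. exact: measurable_idx. Qed.

Lemma mu_cell k x : mu (cl k x) = (m k)%:E.
Proof. exact: mu_idx. Qed.

Lemma cell_size_S k : (exists x : T, True) -> m k.+1 <= m k.
Proof.
move=> [x _]; rewrite -lee_fin -!(mu_cell _ x) le_measure ?inE//;
  [exact: measurable_cell|exact: measurable_cell|exact: cell_subset].
Qed.

Lemma measurable_cell_union k A : (forall x y, cl k x y -> A x -> A y) ->
  measurable A.
Proof.
move=> hA.
have -> : A = \bigcup_i (A `&` [set y | idx f k y = i]).
  apply/seteqP; split => [x Ax|x [i _ []//]].
  by exists (idx f k x).
apply: bigcup_measurable => i _.
have [[x [Ax xi]]|h] := pselect (exists x, A x /\ idx f k x = i).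
  rewrite (_ : _ `&` _ = cl k x); first exact: measurable_cell.
  apply/seteqP; split => y /=; first by move=> [_ yi]; rewrite /cell /= yi xi.
  by move=> xy; split; [exact: hA xy Ax|rewrite -xi].
rewrite (_ : _ `&` _ = set0) //.
by apply/seteqP; split => y //= -[Ay yi]; apply: h; exists y.
Qed.

Lemma measurable_cell_fun k F : (forall x y, cl k x y -> F x = F y) ->
  measurable_fun setT F.
Proof.
move=> hF _ Y mY; rewrite setTI; apply: (@measurable_cell_union k) => x y xy /=.
by rewrite (hF _ _ xy).
Qed.

Section Stopping.
Variables (K : nat) (P : nat -> set T) (Pinv : cell_invariant f P).
Local Notation sg := (stop K P).
Local Notation Om := (reached K P).

Lemma stop_le x : (sg x <= K)%N.
Proof. by rewrite /stop (leq_trans (find_size _ _))// size_iota. Qed.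

Lemma before_stop k x : (k < sg x)%N -> ~ P k x.
Proof.
move=> kx; have kK : (k < K)%N := leq_trans kx (stop_le x).
have := before_find 0%N kx; rewrite nth_iota// add0n => /negP h Pk.
by apply: h; apply/asboolP.
Qed.

Lemma stop_reached x : Om x -> P (sg x) x.
Proof.
move=> [k kK Pk].
have [h|h] := boolP (has (fun k => `[< P k x >]) (iota 0 K)).
  have := nth_find 0%N h; rewrite nth_iota; first by move/asboolP; rewrite add0n.
  by move: h; rewrite has_find size_iota.
have sK : sg x = K by rewrite /stop hasNfind// size_iota.
rewrite sK; suff <- : k = K by [].
apply/eqP; rewrite eqn_leq kK leqNgt /=; apply/negP => lt.
move/hasPn : h => /(_ k); rewrite mem_iota leq0n/= add0n => /(_ lt)/negP; apply.
by apply/asboolP.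
Qed.

(** Up to generation [sg x], invariance makes [P] agree at [x] and [y], so both searches take the
    same course. This is what makes two stopped cells equal or disjoint. *)
Lemma stop_eq x y : cl (sg x) x y -> sg y = sg x.
Proof.
move=> xy.
have h k : (k <= sg x)%N -> P k y <-> P k x.
  move=> kx; have c := cell_subset kx xy.
  by split; apply: Pinv => //; exact: cell_sym.
apply/eqP; rewrite eqn_leq; apply/andP; split; rewrite leqNgt; apply/negP => lt.
- have lt' : (sg x < K)%N := leq_trans lt (stop_le y).
  apply: (before_stop lt); apply/h => //; apply: stop_reached.
  have hs : has (fun k => `[< P k x >]) (iota 0 K) by rewrite has_find size_iota.
  have := nth_find 0%N hs; rewrite nth_iota// => /asboolP; rewrite add0n => Px.
  by exists (sg x) => //; exact: ltnW.
- apply: (before_stop lt); apply/h; first exact: ltnW.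
  have lt' : (sg y < K)%N := leq_trans lt (stop_le x).
  have hs : has (fun k => `[< P k y >]) (iota 0 K) by rewrite has_find size_iota.
  by have := nth_find 0%N hs; rewrite nth_iota// => /asboolP; rewrite add0n.
Qed.

Lemma reached_cell x y : Om x -> cl (sg x) x y -> Om y.
Proof.
move=> Ox xy; exists (sg x); first exact: stop_le.
by apply: Pinv xy _; exact: stop_reached.
Qed.

Lemma notreached_cell x y : ~ Om x -> cl (sg x) x y -> ~ Om y.
Proof.
move=> nx xy Oy; apply: nx; apply: (reached_cell Oy).
by rewrite (stop_eq xy) (cell_eq xy).
Qed.

Lemma measurable_reached : measurable Om.
Proof.
apply: (@measurable_cell_union K) => x y xy [k kK Pk].
by exists k => //; apply: Pinv Pk; exact: cell_subset xy.
Qed.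

Definition stop_code x : nat := pickle (sg x, idx f (sg x) x).

Definition stop_piece i : set T := Om `&` [set x | stop_code x = i].

Lemma stop_piece_cell x : Om x -> stop_piece (stop_code x) = cl (sg x) x.
Proof.
move=> Ox; apply/seteqP; split => y.
  move=> [Oy /= /(pcan_inj pickleK)[e1 e2]].
  by rewrite /cell /= -e2 e1.
move=> xy; split; first exact: reached_cell xy.
by rewrite /= /stop_code (stop_eq xy); rewrite /cell /= in xy; rewrite xy.
Qed.

Lemma stop_piece_0cell i : stop_piece i = set0 \/
  exists x, [/\ Om x, i = stop_code x & stop_piece i = cl (sg x) x].
Proof.
have [[x [Ox xi]]|h] := pselect (stop_piece i !=set0).
  right; exists x; split => //; rewrite -xi; exact: stop_piece_cell.
by left; apply/seteqP; split=> // y hy; apply: h; exists y.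
Qed.

Lemma measurable_stop_piece i : measurable (stop_piece i).
Proof.
by have [->//|[x [_ _ ->]]] := stop_piece_0cell i; exact: measurable_cell.
Qed.

Lemma bigcup_stop_piece : \bigcup_i stop_piece i = Om.
Proof.
apply/seteqP; split => [x [i _ []//]|x Ox]; exists (stop_code x) => //.
Qed.

Lemma trivIset_stop_piece : trivIset setT stop_piece.
Proof. by move=> i j _ _ [x [[_ <-] [_ <-]]]. Qed.

Lemma reached_integral_le F G : measurable_fun setT F -> measurable_fun setT G ->
  (forall x, 0 <= F x) -> (forall x, 0 <= G x) ->
  (forall x, Om x -> I (cl (sg x) x) F <= I (cl (sg x) x) G)%E ->
  (I Om F <= I Om G)%E.
Proof.
move=> mF mG F0 G0 h; rewrite -bigcup_stop_piece.
apply: I_bigcup_le => //; [exact: measurable_stop_piece|exact: trivIset_stop_piece|].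
move=> i; have [->|[x [Ox _ ->]]] := stop_piece_0cell i; last exact: h.
by rewrite !integral_set0.
Qed.

End Stopping.

End Filtrations.

(** * Averages over stopped cells *)

Section Averages.
Context {R : realType} {d} {T : measurableType d}.
Variables (mu : {measure set T -> \bar R}) (cn : R).
Implicit Types (A B : set T) (F G : T -> R).
Local Notation I A F := (\int[mu]_(x in A) (F x)%:E)%E.

Lemma measurable_cst_powR (c : R) (r : T -> R) : measurable_fun setT r ->
  measurable_fun setT (fun x => c `^ r x).
Proof. by move=> mr; apply: (@measurable_powR2 _ _ _ (cst c)). Qed.

Lemma measurable_powRc F (r : R) : measurable_fun setT F ->
  measurable_fun setT (fun x => F x `^ r).
Proof. by move=> mF; apply: (measurable_powR2 mF); exact: measurable_cst. Qed.

Variables (p : T -> R) (pm pP : R).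
Hypothesis mp : measurable_fun setT p.
Hypothesis pm1 : 1 < pm.
Hypothesis ppP : forall x, pm <= p x <= pP.
Local Notation q x := (cexp (p x)).

Lemma exponent_gt1 x : 1 < p x.
Proof. by have /andP[h _] := ppP x; exact: lt_le_trans h. Qed.

Lemma measurable_cexp : measurable_fun setT (fun x => q x).
Proof.
rewrite /cexp.
have mV : measurable_fun setT (fun x => (p x)^-1).
  have -> : (fun x => (p x)^-1) = (fun x => p x `^ (-1)).
    apply/funext => x; rewrite powR_inv1//.
    by have := exponent_gt1 x; lra.
  exact: measurable_powRc.
have -> : (fun x => (1 - (p x)^-1)^-1) = (fun x => (1 - (p x)^-1) `^ (-1)).
  apply/funext => x; rewrite powR_inv1// subr_ge0 invf_le1//.
    by have := exponent_gt1 x; lra.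
  by have := exponent_gt1 x; lra.
by apply: measurable_powRc; apply: measurable_funB.
Qed.

Lemma cexp_bounds x : 1 <= q x <= cexp pm.
Proof.
rewrite (ltW (cexp_gt1 (exponent_gt1 x))) cexp_le//.
by have /andP[] := ppP x.
Qed.

Lemma young_int D F G : measurable D -> measurable_fun setT F ->
  measurable_fun setT G -> (forall x, 0 <= F x) -> (forall x, 0 <= G x) ->
  (I D (fun x => (F x * G x)%R) <= I D (fun x => F x `^ p x) + I D (fun x => G x `^ q x))%E.
Proof.
move=> mD mF mG F0 G0; rewrite -I_add//; first last.
- by move=> x _; exact: powR_ge0.
- by move=> x _; exact: powR_ge0.
- by apply: measurable_powR2 => //; exact: measurable_cexp.
- exact: measurable_powR2.
apply: I_le => //.
- exact: measurable_funM.
- apply: measurable_funD; first exact: measurable_powR2.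
  by apply: measurable_powR2 => //; exact: measurable_cexp.
- move=> x _; rewrite mulr_ge0//=; apply: young_le => //; exact: exponent_gt1.
Qed.

(* The A_p condition on the cells; [t] and [s] stand for the inverse norms of the
   indicator of a cell in L^p and in L^p'. *)
Definition Ap_cells (ca : R) (f : filtration mu cn) := forall k x, exists t s,
  [/\ 0 < t, 0 < s, (I (cell f k x) (fun y => t `^ p y) <= 1)%E,
   (I (cell f k x) (fun y => s `^ q y) <= 1)%E & 1 <= ca * t * s * cell_size f k].

(* What the lower and upper l-estimates give together for the partition into
   stopped cells: a comparison of norms on each cell implies one of full norms. *)
Definition stopped_estimate (C0 : R) (f : filtration mu cn) :=
  forall K P, cell_invariant f P -> forall u v : T -> R,
  measurable_fun setT u -> measurable_fun setT v ->
  (forall x, 0 <= u x) -> (forall x, 0 <= v x) ->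
  (I setT (fun x => u x `^ p x) < +oo)%E -> (I setT (fun x => v x `^ p x) < +oo)%E ->
  (forall x a, 0 < a ->
     (I (cell f (stop K P x) x) (fun y => ((a * v y) `^ p y)%R) <= 1)%E ->
     (I (cell f (stop K P x) x) (fun y => ((a * u y) `^ p y)%R) <= 1)%E) ->
  (I setT (fun x => v x `^ p x) <= 1)%E ->
  (I setT (fun x => (u x / C0) `^ p x) <= 1)%E.

Variables (ca C0 : R) (f : filtration mu cn).
Hypothesis ca1 : 1 <= ca.
Hypothesis C01 : 1 <= C0.
Hypothesis HA : Ap_cells ca f.
Hypothesis Hst : stopped_estimate C0 f.
Ltac slra := have := ca1; have := C01; lra.
Local Notation cl := (cell f).
Local Notation m := (cell_size f).

Definition average F k x : R := fine (I (cl k x) F) / m k.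

Lemma average_ge0 F k x : (forall x, 0 <= F x) -> 0 <= average F k x.
Proof.
move=> F0; rewrite /average divr_ge0 ?(ltW (cell_size_gt0 f k))//.
by apply: fine_ge0; exact: I_ge0.
Qed.

Lemma average_cell F k x y : cl k x y -> average F k y = average F k x.
Proof. by move=> xy; rewrite /average (cell_eq xy). Qed.

Lemma self_le_1powR a x : 0 <= a -> a <= 1 + a `^ p x.
Proof.
move=> a0; have := @powR_le_1D _ a 1 (p x) a0; rewrite powRr1//; apply => //.
by have := exponent_gt1 x; lra.
Qed.

(** Since F <= 1 + F^p, a modular at most one makes [F] integrable on cells; averages, defined
    through [fine], are then genuine. *)
Lemma I_cell_le F k x : measurable_fun setT F -> (forall x, 0 <= F x) ->
  (I setT (fun x => F x `^ p x) <= 1 -> I (cl k x) F <= (1 + m k)%:E)%E.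
Proof.
move=> mF F0 h.
have mD := measurable_cell f k x.
have mFp : measurable_fun setT (fun x => F x `^ p x) by exact: measurable_powR2.
apply: (@le_trans _ _ (I (cl k x) (fun x => 1 + F x `^ p x)))%R.
  apply: I_le => //; first by apply: measurable_funD.
  by move=> y _; rewrite F0 self_le_1powR.
rewrite I_add//; last by move=> y _; exact: powR_ge0.
rewrite I_cst// mul1e mu_cell addrC EFinD; apply: leeD => //.
apply: le_trans h; apply: I_subset => //.
by move=> y _; exact: powR_ge0.
Qed.

Lemma I_cell_fin F k x : measurable_fun setT F -> (forall x, 0 <= F x) ->
  (I setT (fun x => F x `^ p x) <= 1)%E -> I (cl k x) F \is a fin_num.
Proof.
move=> mF F0 h; rewrite ge0_fin_numE; last by exact: I_ge0.
exact: le_lt_trans (I_cell_le k x mF F0 h) (ltry _).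
Qed.

Lemma I_average F k x : measurable_fun setT F -> (forall x, 0 <= F x) ->
  (I setT (fun x => F x `^ p x) <= 1)%E ->
  I (cl k x) F = (average F k x * m k)%:E.
Proof.
move=> mF F0 h; rewrite /average divfK; last by rewrite gt_eqF// cell_size_gt0.
by rewrite fineK//; exact: I_cell_fin.
Qed.

(** Young's inequality for [a * F] against the constant [s] bounds the integral of their product by
    2; A_p then replaces 1 / (s m) by [ca * t]. *)
Lemma average_le_Ap F k x a t s : measurable_fun setT F -> (forall x, 0 <= F x) ->
  (I setT (fun x => F x `^ p x) <= 1)%E -> 0 < a ->
  (I (cl k x) (fun y => ((a * F y) `^ p y)%R) <= 1)%E ->
  0 < t -> 0 < s -> (I (cl k x) (fun y => s `^ q y) <= 1)%E ->
  1 <= ca * t * s * m k -> a * average F k x <= 2 * ca * t.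
Proof.
move=> mF F0 h a0 h1 t0 s0 hs hts.
have mD := measurable_cell f k x.
have m0 := cell_size_gt0 f k.
have hI : (I (cl k x) (fun y => (a * F y * s)%R) <= 2%:E)%E.
  apply: le_trans (young_int mD _ _ _ _) _.
  - by apply: measurable_funM.
  - exact: measurable_cst.
  - by move=> y; rewrite mulr_ge0// ltW.
  - by move=> _; exact: ltW.
  - rewrite (_ : 2%:E = 1%:E + 1%:E)%E; last by rewrite -EFinD; congr EFin; lra.
    exact: (leeD h1 hs).
have e : I (cl k x) (fun y => (a * F y * s)%R) = (s * a * (average F k x * m k))%:E.
  rewrite EFinM -(I_average k x mF F0 h).
  rewrite -I_scale; [|exact: mD|exact: mF|by rewrite mulr_ge0// ltW|by move=> y _].
  by apply: I_eq => y _; ring.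
rewrite e lee_fin in hI.
have sm0 : 0 < s * m k by exact: mulr_gt0.
rewrite -(ler_pM2r sm0).
apply: (@le_trans _ _ 2); first by move: hI; congr (_ <= _); ring.
have -> : 2 * ca * t * (s * m k) = 2 * (ca * t * s * m k) by ring.
lra.
Qed.

Section StoppedAverage.
Variables (K : nat) (P : nat -> set T) (Pinv : cell_invariant f P).
Local Notation sg := (stop K P).
Local Notation Om := (reached K P).
Variables (k0 : nat) (x0 : T).
Hypothesis Om_sub : Om `<=` cl k0 x0.

Definition stopped_average F x : R := average F (sg x) x * \1_Om x.

Lemma stopped_average_cell F x y : cl (sg x) x y ->
  stopped_average F y = stopped_average F x.
Proof.
move=> xy; rewrite /stopped_average (stop_eq Pinv xy) (average_cell F xy).
congr (_ * _); rewrite !indicE; congr (_%:R); congr nat_of_bool.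
apply/idP/idP => /set_mem h; apply/mem_set.
- apply: contrapT => nx; exact: (notreached_cell Pinv nx xy).
- exact: reached_cell xy.
Qed.

Lemma measurable_stopped_average F : measurable_fun setT (stopped_average F).
Proof.
apply: (@measurable_cell_fun _ _ _ _ _ f K) => x y xy; apply/esym.
by apply: stopped_average_cell; apply: cell_subset xy; exact: stop_le.
Qed.

Lemma stopped_average_ge0 F x : (forall x, 0 <= F x) -> 0 <= stopped_average F x.
Proof. by move=> F0; rewrite mulr_ge0// ?average_ge0// indicE. Qed.

(** On each stopped cell the average is a constant whose norm, after division by [2 * ca], is at
    most that of [F], by [average_le_Ap]; [stopped_estimate] passes from the cells to the whole
    space. *)
Lemma stopped_average_le F : measurable_fun setT F -> (forall x, 0 <= F x) ->
  (I setT (fun x => F x `^ p x) <= 1)%E ->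
  (I setT (fun x => (stopped_average F x / (2 * ca * C0)) `^ p x) <= 1)%E.
Proof.
move=> mF F0 h.
have mu_ := measurable_stopped_average F.
pose u x := stopped_average F x / (2 * ca).
have ca0 : 0 < 2 * ca by slra.
have mU : measurable_fun setT u by apply: measurable_funM.
have u0 x : 0 <= u x by rewrite divr_ge0 ?stopped_average_ge0// ltW.
have Omm := measurable_reached K Pinv : measurable Om.
have uOm x : ~ Om x -> u x = 0.
  by move=> nO; rewrite /u /stopped_average indicE memNset// mulr0 mul0r.
have decm j k : (j <= k)%N -> m k <= m j.
  elim: k => [|k IH]; first by rewrite leqn0 => /eqP ->.
  rewrite leq_eqVlt => /predU1P[->//|/IH]; apply: le_trans.
  by apply: cell_size_S; exists x0.
(* A crude bound that makes the modular of [u] finite, as [stopped_estimate] demands: cells up to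
   generation [K] have size at least [m K]. *)
have ub x : u x <= 1 + 1 / m K.
  have [Ox|/uOm ->] := pselect (Om x); last first.
    by have := cell_size_gt0 f K => mK; rewrite addr_ge0// divr_ge0// ltW.
  apply: (@le_trans _ _ (average F (sg x) x)).
    rewrite /u /stopped_average indicE mem_set// mulr1 ler_pdivrMr// ler_peMr//.
      exact: average_ge0.
    slra.
  have := I_cell_le (sg x) x mF F0 h; rewrite I_average// lee_fin => {}h.
  have ms := cell_size_gt0 f (sg x).
  have mK := cell_size_gt0 f K.
  have := decm _ _ (stop_le K P x) => mKs.
  rewrite -(ler_pM2r ms) (le_trans h)// mulrDl !mul1r [leRHS]addrC.
  by rewrite lerD2r ler_pdivlMl ?mulr1.
rewrite (@I_eq _ _ _ _ _ _ (fun x => (u x / C0) `^ p x)); last first.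
  by move=> x _; rewrite /u [in LHS]invfM mulrA.
apply: (Hst (K := K) (P := P) Pinv (u := u) (v := F));
  [exact: mU|exact: mF|exact: u0|exact: F0| | | |exact: h].
- pose b := 1 + 1 / m K.
  have b1 : 1 <= b.
    by rewrite /b lerDl divr_ge0// ltW// cell_size_gt0.
  rewrite (@I_eq _ _ _ _ _ _ (fun x => u x `^ p x * \1_Om x)); last first.
    move=> x _; have [Ox|nO] := pselect (Om x).
      by rewrite indicE mem_set// mulr1.
    rewrite indicE memNset// mulr0 uOm// powR0//.
    by have := exponent_gt1 x => ?; apply/eqP; slra.
  rewrite I_indic setTI.
  apply: (@le_lt_trans _ _ (I Om (fun=> b `^ pP))).
    apply: I_le => //; first exact: measurable_powR2.
    move=> x Ox; rewrite powR_ge0/=.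
    have /andP[p1 p2] := ppP x.
    apply: (@le_trans _ _ (b `^ p x)); last exact: ler_powR.
    have := exponent_gt1 x => p3.
    apply: ge0_ler_powR; rewrite ?nnegrE//; try slra; exact: ub.
  rewrite I_cst// lte_mul_pinfty ?lee_fin ?powR_ge0//.
  apply: (@le_lt_trans _ _ (mu (cl k0 x0))); last by rewrite mu_cell ltry.
  by rewrite le_measure ?inE//; exact: measurable_cell.
- exact: le_lt_trans h (ltry _).
- move=> x a a0 ha.
  have mD := measurable_cell f (sg x) x.
  have [Ox|nO] := pselect (Om x); last first.
    rewrite (@I_eq _ _ _ _ _ _ (fun=> 0)); last first.
      move=> y xy; rewrite uOm; last exact: notreached_cell xy.
      by rewrite mulr0 powR0//; have := exponent_gt1 y => ?; apply/eqP; slra.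
    by rewrite I_cst// mul0e.
  have [t [s [t0 s0 ht hs hts]]] := HA (sg x) x.
  have hav := average_le_Ap mF F0 h a0 ha t0 s0 hs hts.
  apply: le_trans ht; apply: I_le => //.
  + by apply: measurable_powR2 => //; apply: measurable_funM.
  + exact: measurable_cst_powR.
  + move=> y xy; rewrite powR_ge0/=.
    have p3 := exponent_gt1 y.
    apply: ge0_ler_powR; rewrite ?nnegrE; try slra; first by rewrite mulr_ge0// ltW.
    rewrite /u (stopped_average_cell F xy) /stopped_average indicE mem_set// mulr1.
    rewrite mulrA ler_pdivrMr// (le_trans hav)//.
    by rewrite mulrC.
Qed.

(** A factor 2 for [E] filling only half of a cell, a factor 2 for Young's inequality in the dual
    estimate, and [2 * ca * C0] for averaging. *)
Local Notation K1 := (8 * ca * C0).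

Variables (E : set T) (t : R).
Hypothesis mE : measurable E.
Hypothesis t0 : 0 < t.
Hypothesis E_half : forall x, Om x ->
  ((2^-1 * m (sg x))%:E <= mu (E `&` cl (sg x) x))%E.

(** The average of t chi_E over a stopped cell is at least [t / 2], and averaging is bounded. *)
Lemma reached_le_p : (I E (fun x => t `^ p x) <= 1)%E ->
  (I Om (fun x => (t / K1) `^ p x) <= 1)%E.
Proof.
move=> hE.
pose F x := t * \1_E x : R.
have mF : measurable_fun setT F.
  by apply: measurable_funM => //; exact: measurable_indic.
have F0 x : 0 <= F x by rewrite mulr_ge0 ?(ltW t0)// indicE.
have hF : (I setT (fun x => F x `^ p x) <= 1)%E.
  rewrite (@I_eq _ _ _ _ _ _ (fun x => t `^ p x * \1_E x)) ?I_indic ?setTI//.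
  move=> x _; rewrite /F indicE; case: (x \in E); rewrite ?mulr1// !mulr0 powR0//.
  by have := exponent_gt1 x => ?; apply/eqP; slra.
apply: le_trans (stopped_average_le mF F0 hF).
have Omm := measurable_reached K Pinv : measurable Om.
apply: (@le_trans _ _ (I Om (fun x => (stopped_average F x / (2 * ca * C0)) `^ p x))).
  apply: I_le => //; first exact: measurable_cst_powR.
    apply: measurable_powR2 => //; apply: measurable_funM => //.
    exact: measurable_stopped_average.
  move=> x Ox; rewrite powR_ge0/=.
  have p3 := exponent_gt1 x.
  have C00 : 0 < 2 * ca * C0 by rewrite !mulr_gt0//; slra.
  have K10 : 0 < K1 by rewrite !mulr_gt0//; slra.
  apply: ge0_ler_powR; rewrite ?nnegrE; try slra.
  - by rewrite divr_ge0// ltW.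
  - by rewrite divr_ge0 ?stopped_average_ge0// ltW.
  have -> : t / K1 = (t / 4) / (2 * ca * C0).
    by field; apply/andP; split; apply/eqP; slra.
  rewrite ler_pM2r ?invr_gt0//.
  rewrite /stopped_average indicE mem_set// mulr1.
  have ms := cell_size_gt0 f (sg x).
  rewrite -(ler_pM2r ms) -lee_fin -I_average//.
  have mD := measurable_cell f (sg x) x.
  have -> : I (cl (sg x) x) F = (t%:E * I (cl (sg x) x) \1_E)%E.
    by apply: I_scale => //; exact: ltW.
  have -> : I (cl (sg x) x) \1_E = mu (E `&` cl (sg x) x).
    by rewrite integral_indic.
  apply: (@le_trans _ _ (t%:E * (2^-1 * m (sg x))%:E)%E); last first.
    by apply: lee_wpmul2l; [rewrite lee_fin ltW|exact: E_half].
  rewrite -EFinM lee_fin.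
  have := mulr_gt0 t0 ms; nra.
apply: I_subset => //; last by move=> x _; exact: powR_ge0.
apply: measurable_powR2 => //; apply: measurable_funM => //.
exact: measurable_stopped_average.
Qed.

(* The averaging operator is self-adjoint; it is tested against [b `^ (q - 1)]
   on the reached set, whose p-modular is the q-modular of [b]. *)
Lemma reached_le_q : (I E (fun x => (t `^ q x)%R) <= 1)%E ->
  (I Om (fun x => ((t / K1) `^ q x)%R) <= 1)%E.
Proof.
move=> hE.
have Omm := measurable_reached K Pinv : measurable Om.
have K10 : 0 < K1 by rewrite !mulr_gt0//; slra.
pose b := t / K1.
have b0 : 0 < b by rewrite divr_gt0.
rewrite -/b.
have mbq : measurable_fun setT (fun x => b `^ q x).
  exact: measurable_cst_powR measurable_cexp.
have q1 x : 1 < q x by exact: cexp_gt1 (exponent_gt1 x).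
have qP x : q x <= cexp pm by have /andP[] := cexp_bounds x.
have Xfin : I Om (fun x => b `^ q x) \is a fin_num.
  rewrite ge0_fin_numE; last by apply: I_ge0 => x _; exact: powR_ge0.
  apply: (@le_lt_trans _ _ (I Om (fun=> 1 + b `^ cexp pm))).
    apply: I_le => // x _; rewrite powR_ge0/= powR_le_1D//; first exact: ltW.
    by have := q1 x; lra.
  rewrite I_cst// lte_mul_pinfty ?lee_fin ?addr_ge0 ?powR_ge0//.
  apply: (@le_lt_trans _ _ (mu (cl k0 x0))); last by rewrite mu_cell ltry.
  by rewrite le_measure ?inE//; exact: measurable_cell.
set X := I Om (fun x => b `^ q x) in Xfin *.
rewrite leNgt; apply/negP => X1.
have {}X1 : 1 < fine X by rewrite -lte_fin fineK.
have X0 : 0 < fine X by slra.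
(* If X > 1, division by X^(1/pm) brings the p-modular of [F] below one because p >= pm. The
   argument ends with X <= Z = X^(1/pm), which is impossible for X > 1. *)
pose Z := fine X `^ pm^-1.
have pm0 : 0 < pm by have := pm1; slra.
have Z1 : 1 <= Z by apply: powR_ge1; [exact: ltW|rewrite invr_ge0 ltW].
have Z0 : 0 < Z by slra.
pose F x := b `^ (q x - 1) / Z * \1_Om x.
have mF : measurable_fun setT F.
  apply: measurable_funM; last exact: measurable_indic.
  apply: measurable_funM => //; apply: measurable_cst_powR.
  by apply: measurable_funB => //; exact: measurable_cexp.
have F0 x : 0 <= F x.
  by rewrite mulr_ge0 ?divr_ge0 ?powR_ge0// ?indicE// ltW.
have hF : (I setT (fun x => F x `^ p x) <= 1)%E.
  have hle : (I Om (fun x => F x `^ p x) <= I Om (fun x => (fine X)^-1 * b `^ q x))%E.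
    apply: I_le => //; [exact: measurable_powR2|exact: measurable_funM|].
    move=> x Ox; rewrite powR_ge0/= /F indicE mem_set// mulr1.
    have p3 := exponent_gt1 x.
    rewrite powRM ?powR_ge0 ?invr_ge0 ?(ltW Z0)// -powRrM cexp_sub1// mulrC.
    rewrite ler_wpM2r ?powR_ge0// powRV ?(ltW Z0)// lef_pV2 ?posrE ?powR_gt0//.
    rewrite /Z -powRrM -[leLHS]powRr1 ?(ltW X0)//.
    apply: ler_powR; first exact: ltW.
    by rewrite mulrC ler_pdivlMr// mul1r; have /andP[] := ppP x.
  rewrite (@I_eq _ _ _ _ _ _ (fun x => F x `^ p x * \1_Om x)); last first.
    move=> x _; rewrite indicE; have [Ox|nO] := boolP (x \in Om); first by rewrite mulr1.
    rewrite mulr0 /F indicE (negbTE nO) mulr0 powR0//.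
    by have := exponent_gt1 x => ?; apply/eqP; slra.
  rewrite I_indic setTI (le_trans hle)// I_scale//; last 2 first.
  - by rewrite invr_ge0 ltW.
  - by move=> x _; exact: powR_ge0.
  by rewrite -/X -(fineK Xfin) -EFinM lee_fin mulVf// gt_eqF.
have hSA := stopped_average_le mF F0 hF.
have mSA := measurable_stopped_average F.
have SA0 x : 0 <= stopped_average F x by exact: stopped_average_ge0.
have mSE : measurable_fun setT (fun x => stopped_average F x * \1_E x).
  by apply: measurable_funM => //; exact: measurable_indic.
have SE0 x : 0 <= stopped_average F x * \1_E x.
  by rewrite mulr_ge0// indicE.
(* Self-adjointness: on a stopped cell, the average of [F] integrated over the half filled by [E]
   recovers at least half of the integral of [F]. *)
have dual : (I Om F <= I Om (fun x => 2 * (stopped_average F x * \1_E x))%R)%E.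
  apply: (reached_integral_le Pinv) => //.
  - exact: measurable_funM.
  - by move=> x; rewrite mulr_ge0.
  move=> x Ox; have mD := measurable_cell f (sg x) x.
  rewrite I_average// (@I_eq _ _ _ _ _ _ (fun y => 2 * average F (sg x) x * \1_E y)).
    rewrite I_indic I_cst; last exact: measurableI.
    rewrite setIC; apply: (@le_trans _ _ ((2 * average F (sg x) x)%:E *
      (2^-1 * m (sg x))%:E)%E); last first.
      apply: lee_wpmul2l; last exact: E_half.
      by rewrite lee_fin mulr_ge0// average_ge0.
    by rewrite -EFinM lee_fin; rewrite le_eqVlt; apply/orP; left; apply/eqP; field.
  move=> y xy; rewrite (stopped_average_cell F xy) /stopped_average indicE mem_set//.
  by rewrite mulr1 mulrA.
pose c := 2 * ca * C0.
have c0 : 0 < c by rewrite !mulr_gt0//; slra.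
have hY : (I Om (fun x => (stopped_average F x / c * (t * \1_E x))%R) <= 2%:E)%E.
  apply: le_trans (young_int Omm _ _ _ _) _.
  - exact: measurable_funM.
  - by apply: measurable_funM => //; exact: measurable_indic.
  - by move=> x; rewrite divr_ge0// ltW.
  - by move=> x; rewrite mulr_ge0 ?(ltW t0)// indicE.
  rewrite (_ : 2%:E = 1%:E + 1%:E)%E; last by rewrite -EFinD; congr EFin; lra.
  apply: leeD.
    apply: le_trans hSA; apply: I_subset => //.
      by apply: measurable_powR2 => //; exact: measurable_funM.
    by move=> x _; exact: powR_ge0.
  rewrite (@I_eq _ _ _ _ _ _ (fun x => t `^ q x * \1_E x)).
    rewrite I_indic; apply: le_trans hE; apply: I_subset => //.
    - exact: measurableI.
    - exact: measurable_cst_powR measurable_cexp.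
    - by move=> x _; exact: powR_ge0.
  move=> x _; rewrite indicE; case: (x \in E); rewrite ?mulr1// !mulr0 powR0//.
  by have := q1 x => ?; apply/eqP; slra.
have hXZ : (X <= (b * Z)%:E * I Om F)%E.
  rewrite -I_scale//; last by rewrite mulr_ge0// ltW.
  rewrite le_eqVlt; apply/orP; left; apply/eqP; apply: I_eq => x Ox.
  rewrite /F indicE mem_set// mulr1.
  have -> : b * Z * (b `^ (q x - 1) / Z) = b * b `^ (q x - 1).
    by field; rewrite gt_eqF.
  by rewrite mulr_powRB1//; [exact: ltW|have := q1 x; lra].
have hOF : (I Om F <= (b^-1)%:E)%E.
  apply: le_trans dual _.
  rewrite (@I_eq _ _ _ _ _ _ (fun x => 2 * c / t * (stopped_average F x / c * (t * \1_E x)))).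
    rewrite I_scale//.
    - apply: le_trans (lee_wpmul2l _ hY) _.
        by rewrite lee_fin; apply: divr_ge0; [apply: mulr_ge0 => //|]; exact: ltW.
      rewrite -EFinM lee_fin /b invf_div /c le_eqVlt; apply/orP; left; apply/eqP.
      by field; rewrite gt_eqF.
    - apply: measurable_funM; first exact: measurable_funM.
      by apply: measurable_funM => //; exact: measurable_indic.
    - by apply: divr_ge0; [apply: mulr_ge0 => //|]; exact: ltW.
    - move=> x _; apply: mulr_ge0; first by apply: divr_ge0 => //; exact: ltW.
      by rewrite indicE; apply: mulr_ge0 => //; exact: ltW.
  by move=> x _; field; rewrite !gt_eqF.
have : (X <= Z%:E)%E.
  apply: le_trans hXZ (le_trans (lee_wpmul2l _ hOF) _).
    by rewrite lee_fin mulr_ge0// ltW.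
  by rewrite -EFinM lee_fin mulrAC mulfV ?mul1r// gt_eqF.
rewrite -(fineK Xfin) lee_fin leNgt => /negP; apply.
have e : fine X = Z * fine X `^ (1 - pm^-1).
  rewrite /Z -powRD; last by rewrite (gt_eqF X0) implybT.
  by rewrite addrC subrK powRr1// ltW.
rewrite [ltRHS]e ltr_pMr//.
have r0 : 0 < 1 - pm^-1 by rewrite subr_gt0 invf_lt1 ?pm1.
have := @gt0_ltr_powR _ _ r0 1 (fine X).
by rewrite !nnegrE powR1; apply => //; exact: ltW.
Qed.

End StoppedAverage.

End Averages.

(** * Reverse Hoelder inequality *)

Section ReverseHolder.
Context {R : realType} {d} {T : measurableType d}.
Variables (mu : {measure set T -> \bar R}) (cn : R).
Implicit Types (A B G : set T) (F : T -> R).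
Local Notation I A F := (\int[mu]_(x in A) (F x)%:E)%E.
Variables (r : T -> R) (rP K1 : R) (L : nat) (f : filtration mu cn).
Hypothesis mr : measurable_fun setT r.
Hypothesis r1P : forall x, 1 <= r x <= rP.
Hypothesis K11 : 1 <= K1.
Hypothesis cn1 : 1 <= cn.
Hypothesis LK : (2 * K1) `^ rP <= L%:R.
Local Notation cl := (cell f).
Local Notation m := (cell_size f).

Definition reached_bound := forall K P, cell_invariant f P ->
  forall k0 x0, reached K P `<=` cl k0 x0 -> forall (E : set T) t,
  measurable E -> 0 < t ->
  (forall x, reached K P x ->
     (2^-1 * m (stop K P x))%:E <= mu (E `&` cl (stop K P x) x))%E ->
  (I E (fun x => t `^ r x) <= 1)%E ->
  (I (reached K P) (fun x => (t / K1) `^ r x) <= 1)%E.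

Hypothesis HW : reached_bound.

Variables (k0 : nat) (x0 : T).
Local Notation Q := (cl k0 x0).
Local Notation c0 := ((2 * cn)^-1).

Let c0_gt0 : 0 < c0. Proof. by rewrite invr_gt0; have := cn1; lra. Qed.

Let c0_le : c0 <= 2^-1.
Proof. by rewrite lef_pV2 ?posrE; have := cn1; lra. Qed.

Let mc t : measurable_fun setT (fun x => t `^ r x).
Proof. exact: measurable_cst_powR. Qed.

(** Generations strictly after [k0] only, so that the parent of a stopped cell still lies in [Q].
    The parent is not dense, by stopping or because [G] is small in [Q]; with the threshold 1 / (2
    cn), doubling then leaves at least half of the stopped cell outside [G]. *)
Definition dense_cell G k : set T :=
  [set x | [/\ (k0 < k)%N, Q x & ((c0 * m k)%:E < mu (G `&` cl k x))%E]].

Definition blow G : set T := G `|` \bigcup_K reached K (dense_cell G).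

Lemma dense_cell_inv G : cell_invariant f (dense_cell G).
Proof.
move=> k x y xy [k0k Qx h]; split => //.
  by rewrite /cell /= (cell_subset (ltnW k0k) xy).
by rewrite (cell_eq xy).
Qed.

Lemma reached_dense_sub G K : reached K (dense_cell G) `<=` Q.
Proof. by move=> x [k _ []]. Qed.

Section OneStep.
Variable G : set T.
Hypotheses (mG : measurable G) (GQ : G `<=` Q) (Gsmall : (mu G <= (c0 * m k0)%:E)%E).
Local Notation W := (\bigcup_K reached K (dense_cell G)).

Let mre K : measurable (reached K (dense_cell G)).
Proof. exact/measurable_reached/dense_cell_inv. Qed.

Let reached_homo :
  {homo (fun K => reached K (dense_cell G)) : a b / (a <= b)%N >-> a `<=` b}.
Proof. by move=> a b ab x [k ka Pk]; exists k => //; exact: leq_trans ab. Qed.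

Let mW : measurable W.
Proof. by apply: bigcup_measurable => K _; exact: mre. Qed.

Lemma measurable_blow : measurable (blow G).
Proof. exact: measurableU. Qed.

Lemma blow_sub : blow G `<=` Q.
Proof. by move=> x [/GQ//|[K _ /reached_dense_sub]]. Qed.

Lemma sub_blow : G `<=` blow G. Proof. by move=> x; left. Qed.

(** A cell of [Q] meeting [G] off [W] cannot be dense, so what is left of [G] has density at most
    [c0], hence at most 1/2, in every cell of [Q], and the density property of the filtration
    applies. *)
Lemma dense_null : mu (G `\` W) = 0%E.
Proof.
apply: (@filtration_density _ _ _ _ _ f k0 x0); first exact: measurableD.
  by move=> x [/GQ].
move=> j y kj yQ; rewrite leNgt; apply/negP => h.
have mj := cell_size_gt0 f j.
have {}h : ((c0 * m j)%:E < mu ((G `\` W) `&` cl j y))%E.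
  by apply: le_lt_trans h; rewrite lee_fin ler_pM2r.
have h2 : ((c0 * m j)%:E < mu (G `&` cl j y))%E.
  apply: (lt_le_trans h); rewrite le_measure ?inE//.
  - by apply: measurableI; [exact: measurableD|exact: measurable_cell].
  - by apply: measurableI => //; exact: measurable_cell.
  - by apply: setSI; exact: subDsetl.
have [jk|jk] := leqP j k0.
  have {jk}jk : j = k0 by apply/eqP; rewrite eqn_leq jk.
  rewrite jk in h2; have := lt_le_trans h2 _; move/(_ (mu G)).
  have -> : (mu (G `&` cl k0 y) <= mu G)%E.
    by rewrite le_measure ?inE//; apply: measurableI => //; exact: measurable_cell.
  by move=> /(_ isT); rewrite ltNge Gsmall.
have : (G `\` W) `&` cl j y = set0.
  apply/seteqP; split => // z [[Gz nW] yz]; apply: nW; exists j => //; exists j => //.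
  apply: dense_cell_inv yz _; split => //.
move=> e; rewrite e measure0 in h.
have : 0 < c0 * m j by exact: mulr_gt0.
by move: h; rewrite lte_fin; lra.
Qed.

Lemma I_blow F : measurable_fun setT F -> (forall x, 0 <= F x) ->
  I (blow G) F = I W F.
Proof.
move=> mF F0.
have -> : blow G = W `|` (G `\` W).
  by apply/seteqP; split=> x; rewrite /blow /setD /setU /=; have [] := pselect (W x); tauto.
by apply: I_null => //; [exact: measurableD|exact: dense_null].
Qed.

(** Each stopped cell has more than the fraction [c0] of its measure in [G], so the total grows at
    most by the factor 1 / c0. *)
Lemma mu_blow : (mu (blow G) <= (2 * cn)%:E * mu G)%E.
Proof.
have e A : measurable A -> mu A = I A (fun=> 1).
  by move=> mA; rewrite I_cst// mul1e.
rewrite e; last exact: measurable_blow.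
rewrite I_blow//; apply: I_nondecreasing_le;
  [exact: mre|exact: reached_homo|by []|by []|] => K.
rewrite -e//.
have h : (I (reached K (dense_cell G)) (fun=> c0)
          <= I (reached K (dense_cell G)) \1_G)%E.
  apply: (@reached_integral_le _ _ _ mu _ f K _ (@dense_cell_inv G) (fun=> c0) \1_G) => //.
    by move=> _; exact: ltW.
  move=> x /(stop_reached) [_ _ h].
  rewrite I_cst ?mu_cell; last exact: measurable_cell.
  by rewrite integral_indic//; [rewrite -EFinM ltW|exact: measurable_cell].
rewrite I_cst// integral_indic// in h.
have hc : 2 * cn * c0 = 1 by rewrite mulfV//; apply/eqP; have := cn1; lra.
have -> : mu (reached K (dense_cell G))
    = ((2 * cn)%:E * (c0%:E * mu (reached K (dense_cell G))))%E.
  by rewrite muleA -EFinM hc mul1e.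
apply: lee_wpmul2l; first by rewrite lee_fin; have := cn1; lra.
apply: le_trans h _; rewrite le_measure ?inE//; exact: measurableI.
Qed.

(** The newly added part [blow G] minus [G] fills at least half of every stopped cell, hence
    qualifies as the set [E] of [reached_bound]. *)
Lemma blow_step t : 0 < t -> (I (blow G `\` G) (fun x => t `^ r x) <= 1)%E ->
  (I (blow G) (fun x => (t / K1) `^ r x) <= 1)%E.
Proof.
move=> t0 h; rewrite I_blow; [|exact: mc|by move=> x; exact: powR_ge0].
apply: I_nondecreasing_le; [exact: mre|exact: reached_homo|exact: mc|
  by move=> x; exact: powR_ge0|] => K.
have inv := @dense_cell_inv G.
apply: (HW inv (@reached_dense_sub G K) (E := blow G `\` G)) => //.
  by apply: measurableD => //; exact: measurable_blow.
move=> x Ox; set s := stop _ _ _.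
have [k0s Qx _] := stop_reached Ox.
rewrite -/s in k0s.
have mD := measurable_cell f s x.
have -> : (blow G `\` G) `&` cl s x = cl s x `\` G.
  apply/seteqP; split => y [] //; first by move=> [].
  move=> xy nG; do !split => //; right; exists K => //.
  exact: reached_cell xy.
have hGD : (mu (G `&` cl s x) <= (2^-1 * m s)%:E)%E.
  have s1 : s = s.-1.+1 by rewrite prednK// (leq_ltn_trans _ k0s).
  apply: (@le_trans _ _ (mu (G `&` cl s.-1 x))).
    rewrite le_measure ?inE//.
    - exact: measurableI.
    - by apply: measurableI => //; exact: measurable_cell.
    - by apply: setIS; apply: cell_subset; rewrite leq_pred.
  apply: (@le_trans _ _ (c0 * m s.-1)%:E).
    have [ks|ks] := ltnP k0 s.-1.
      rewrite leNgt; apply/negP => hh.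
      apply: (@before_stop _ _ K (dense_cell G) s.-1 x); last by split.
      by rewrite -/s [in X in (_ < X)%N]s1.
    have -> : s.-1 = k0 by apply/eqP; rewrite eqn_leq ks -ltnS -s1.
    apply: le_trans Gsmall; rewrite le_measure ?inE//.
    by apply: measurableI => //; exact: measurable_cell.
  rewrite lee_fin.
  have := cell_size_doubling f s.-1; rewrite -s1 => hd.
  apply: (@le_trans _ _ (c0 * (cn * m s))); first by rewrite ler_pM2l.
  rewrite le_eqVlt; apply/orP; left; apply/eqP; field.
  by apply/eqP; have := cn1; lra.
have e : mu (cl s x) = (mu (cl s x `\` G) + mu (G `&` cl s x))%E.
  by rewrite setIC -measureDI.
rewrite mu_cell in e.
have : ((m s)%:E <= mu (cl s x `\` G) + (2^-1 * m s)%:E)%E by rewrite e leeD2l.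
rewrite -leeBlDr// -EFinB; apply: le_trans.
by rewrite lee_fin; lra.
Qed.

End OneStep.

Local Notation c1 := (c0 ^+ L).

Let L_ge1 : 1 <= L%:R :> R.
Proof.
apply: le_trans LK; apply: powR_ge1; first by have := K11; lra.
by have /andP[h1 h2] := r1P x0; lra.
Qed.

Let L_gt0 : (0 < L)%N. Proof. by have := L_ge1; rewrite ler1n. Qed.

Let mQ_gt0 : 0 < m k0. Proof. exact: cell_size_gt0. Qed.

Lemma iter_blow G l : measurable G -> G `<=` Q -> (mu G <= (c0 ^+ l * m k0)%:E)%E ->
  [/\ measurable (iter l blow G), iter l blow G `<=` Q &
      (mu (iter l blow G) <= ((2 * cn) ^+ l)%:E * mu G)%E].
Proof.
move=> mG GQ; elim: l => [|l IH] hG.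
  by rewrite expr0 mul1e; split.
have c0l : c0 ^+ l.+1 <= c0 ^+ l.
  rewrite exprS ler_piMl ?exprn_ge0 ?(ltW c0_gt0)//.
  by have := c0_le; lra.
have [|mB BQ hB] := IH.
  by apply: le_trans hG _; rewrite lee_fin ler_pM2r.
have hB0 : (mu (iter l blow G) <= (c0 * m k0)%:E)%E.
  apply: le_trans hB _.
  apply: le_trans (lee_wpmul2l _ hG) _.
    by rewrite lee_fin exprn_ge0//; have := cn1; lra.
  rewrite -EFinM lee_fin exprSr !mulrA ler_pM2r// -exprMn mulfV ?expr1n ?mul1r//.
  by apply/eqP; have := cn1; lra.
rewrite iterS; split.
- exact: measurable_blow.
- exact: blow_sub.
- apply: le_trans (mu_blow mB BQ hB0) _.
  rewrite exprS [X in (_ <= X * _)%E]EFinM -muleA; apply: lee_wpmul2l => //.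
  by rewrite lee_fin; have := cn1; lra.
Qed.

Let cnc0 k : (2 * cn) ^+ k * c0 ^+ k = 1.
Proof.
rewrite -exprMn mulfV ?expr1n//; apply/eqP; have := cn1; lra.
Qed.

Let ge1_exp k : 0 <= (2 * cn) ^+ k.
Proof. by rewrite exprn_ge0//; have := cn1; lra. Qed.

Let small_iter G l : (l < L)%N -> measurable G -> G `<=` Q ->
  (mu G <= (c1 * m k0)%:E)%E ->
  [/\ measurable (iter l blow G), iter l blow G `<=` Q &
      (mu (iter l blow G) <= (c0 * m k0)%:E)%E].
Proof.
move=> lL mG GQ hG.
have hGl : (mu G <= (c0 ^+ l.+1 * m k0)%:E)%E.
  apply: le_trans hG _; rewrite lee_fin ler_pM2r//.
  apply: ler_wiXn2l => //; first exact: ltW.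
  by have := c0_le; lra.
have [|mB BQ hB] := @iter_blow G l mG GQ.
  apply: le_trans hGl _; rewrite lee_fin ler_pM2r//.
  apply: ler_wiXn2l => //; first exact: ltW.
  by have := c0_le; lra.
split => //; apply: le_trans hB _.
apply: le_trans (lee_wpmul2l _ hGl) _; first by rewrite lee_fin ge1_exp.
by rewrite -EFinM lee_fin exprSr !mulrA cnc0 mul1r.
Qed.

(* [L] disjoint shells share the modular of the last set of the chain, so one
   of them carries at most the fraction 1/L. *)
Lemma blow_block G t : measurable G -> G `<=` Q -> (mu G <= (c1 * m k0)%:E)%E ->
  0 < t -> (I (iter L blow G) (fun x => t `^ r x) <= 1)%E ->
  (I G (fun x => (2 * t) `^ r x) <= 1)%E.
Proof.
move=> mG GQ hG t0 h.
pose sh l := iter l.+1 blow G `\` iter l blow G.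
have msh l : (l < L)%N -> measurable (sh l).
  move=> lL; have [mB BQ hB] := small_iter lL mG GQ hG.
  by apply: measurableD => //; rewrite iterS; exact: measurable_blow.
have [l lL hl] : exists2 l, (l < L)%N & (I (sh l) (fun x => t `^ r x) <= (L%:R^-1)%:E)%E.
  apply: contrapT => hn.
  have {}hn l : (l < L)%N -> ((L%:R^-1)%:E < I (sh l) (fun x => t `^ r x))%E.
    by move=> lL; rewrite ltNge; apply/negP => hl; apply: hn; exists l.
  have hsum l : (l <= L)%N -> ((l%:R / L%:R)%:E <= I (iter l blow G) (fun x => t `^ r x))%E
      /\ ((0 < l)%N -> ((l%:R / L%:R)%:E < I (iter l blow G) (fun x => t `^ r x))%E).
    elim: l => [_|l IH lL].
      by rewrite mul0r; split=> //; apply: I_ge0 => x _; exact: powR_ge0.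
    have [IHl _] := IH (ltnW lL).
    have [mB BQ hB] := small_iter lL mG GQ hG.
    have e : iter l.+1 blow G = iter l blow G `|` sh l.
      rewrite /sh iterS; apply/seteqP; split => x /=.
        by have [] := pselect (iter l blow G x); tauto.
      by move=> [xG|[]//]; exact: sub_blow.
    suff hlt : ((l.+1%:R / L%:R)%:E < I (iter l.+1 blow G) (fun x => t `^ r x))%E.
      by split=> // ; exact: ltW.
    rewrite e I_setU//; [|exact: msh|by move=> x _; exact: powR_ge0|]; last first.
      by apply/disj_setPS => x [xG [_ nG]].
    rewrite -natr1 mulrDl mul1r EFinD.
    by apply: lee_ltD => //; exact: hn.
  have [_ /(_ L_gt0)] := hsum L (leqnn _).
  rewrite mulfV ?pnatr_eq0 -?lt0n// => /lt_le_trans => /(_ _ h).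
  by rewrite ltxx.
have [mB BQ hB] := small_iter lL mG GQ hG.
(* Passing from [t] to [2 * K1 * t] multiplies the modular by at most [L], which is what the chosen
   shell can afford. [blow_step] gives back the factor [K1], and a net doubling remains. *)
pose t' := 2 * K1 * t.
have K10 : 0 < 2 * K1 by have := K11; lra.
have t'0 : 0 < t' by rewrite mulr_gt0.
have r0 x : 0 <= r x by have /andP[? ?] := r1P x; lra.
have hsh : (I (sh l) (fun x => t' `^ r x) <= 1)%E.
  apply: (@le_trans _ _ (I (sh l) (fun x => L%:R * t `^ r x))).
    apply: I_le => //; first exact: msh.
    - by apply: measurable_funM => //; exact: measurable_cst.
    - move=> x _; rewrite powR_ge0/= /t' powRM ?(ltW t0) ?(ltW K10)//.
      rewrite ler_wpM2r ?powR_ge0//; apply: le_trans LK.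
      by apply: ler_powR; [have := K11; lra|have /andP[] := r1P x].
  rewrite I_scale//; [|exact: msh|by move=> x _; exact: powR_ge0].
  apply: le_trans (lee_wpmul2l _ hl) _; first by rewrite lee_fin.
  by rewrite -EFinM lee_fin mulfV// pnatr_eq0 -lt0n.
have := blow_step mB BQ hB t'0 hsh.
apply: le_trans.
have e : t' / K1 = 2 * t.
  by rewrite /t'; field; apply/eqP; have := K11; lra.
rewrite e; apply: I_subset => //; first exact: measurable_blow.
  by move=> x _; exact: powR_ge0.
move=> x xG; apply: sub_blow.
by elim: (l) => //= l' IH; exact: sub_blow.
Qed.

Let c1_le : c1 <= 2^-1.
Proof.
apply: le_trans c0_le; rewrite -[leRHS]expr1.
apply: ler_wiXn2l => //; first exact: ltW.
by have := c0_le; lra.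
Qed.

Let c1_gt0 : 0 < c1. Proof. exact: exprn_gt0. Qed.

(** After [L] enlargements, a set of relative measure c1^(j+1) still has relative measure at most
    c1^j. The induction hypothesis applies to the enlarged set, and [blow_block] adds one doubling
    on the original one. *)
Lemma small_set_power j : forall G t, measurable G -> G `<=` Q ->
  (mu G <= (c1 ^+ j * m k0)%:E)%E ->
  0 < t -> (I Q (fun x => t `^ r x) <= 1)%E ->
  (I G (fun x => (2 ^+ j * t) `^ r x) <= 1)%E.
Proof.
elim: j => [|j IH] G t mG GQ hG t0 hQ.
  rewrite expr0 mul1r; apply: le_trans hQ; apply: I_subset => //.
    exact: measurable_cell.
  by move=> x _; exact: powR_ge0.
have hG1 : (mu G <= (c1 * m k0)%:E)%E.
  apply: le_trans hG _; rewrite lee_fin ler_pM2r// exprS ler_piMr ?(ltW c1_gt0)//.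
  by rewrite exprn_ile1 ?(ltW c1_gt0)//; have := c1_le; lra.
have [mB BQ hB] := @iter_blow G L mG GQ hG1.
rewrite exprS -mulrA; apply: (blow_block mG GQ hG1).
  by rewrite mulr_gt0// exprn_gt0.
apply: (IH _ _ mB BQ _ t0 hQ).
apply: le_trans hB _; apply: le_trans (lee_wpmul2l _ hG) _; first by rewrite lee_fin ge1_exp.
by rewrite -EFinM lee_fin exprS !mulrA cnc0 mul1r.
Qed.

(** As r >= 1, the factor 2^j on [t] is worth at least 2^j on the modular. *)
Lemma small_set_decay j G t : measurable G -> G `<=` Q ->
  (mu G <= (c1 ^+ j * m k0)%:E)%E ->
  0 < t -> (I Q (fun x => t `^ r x) <= 1)%E ->
  (I G (fun x => (t `^ r x)%R) <= ((2 ^+ j)^-1)%:E)%E.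
Proof.
move=> mG GQ hG t0 hQ.
have j0 : 0 < 2 ^+ j :> R by rewrite exprn_gt0.
apply: (@le_trans _ _ (I G (fun x => (2 ^+ j)^-1 * (2 ^+ j * t) `^ r x))).
  apply: I_le => //; first by apply: measurable_funM => //; exact: measurable_cst.
  move=> x _; rewrite powR_ge0/= powRM ?(ltW t0) ?(ltW j0)// mulrA ler_peMl ?powR_ge0//.
  rewrite ler_pdivlMl// mulr1.
  have /andP[r1 _] := r1P x.
  by apply: self_le_powR => //; rewrite exprn_ege1// ler1n.
rewrite I_scale//; last by move=> x _; exact: powR_ge0.
apply: le_trans (lee_wpmul2l _ (small_set_power mG GQ hG t0 hQ)) _.
  by rewrite lee_fin invr_ge0 ltW.
by rewrite mule1.
Qed.

(* The exponent for which [c1 ^- eta = 3/2 < 2]. *)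
Definition rh_gain : R := ln (3 / 2) / ln c1^-1.

Let ln_c1 : 0 < ln c1^-1.
Proof.
apply: ln_gt0; rewrite invf_gt1 //.
by have := c1_le; lra.
Qed.

Lemma rh_gain_gt0 : 0 < rh_gain.
Proof. by apply: (divr_gt0 _ ln_c1); apply: ln_gt0; lra. Qed.

Lemma rh_gainE j : (c1^-1 ^+ j) `^ rh_gain = (3 / 2) ^+ j.
Proof.
have e : c1^-1 `^ rh_gain = 3 / 2.
  rewrite /powR; case: eqP => [/eqP|_].
    by rewrite invr_eq0 gt_eqF.
  by rewrite /rh_gain divfK ?gt_eqF// lnK// posrE; lra.
have b0 : 0 <= c1^-1 by rewrite invr_ge0 ltW.
move: (c1^-1) b0 e => b b0 e.
by rewrite -powR_mulrn// -powRrM mulrC powRrM e powR_mulrn//; lra.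
Qed.

(** [W] is the density of the modular relative to normalised measure. By Chebyshev, W > c1^-j holds
    on a set of relative measure at most c1^j, which carries at most 2^-j of the modular. Weighting
    the layers by (3/2)^(j+1) gives the series of the 3/2 (3/4)^j, with sum 6; one more unit covers
    the points where W <= 1. *)
Lemma reverse_holder t : 0 < t -> (I Q (fun x => t `^ r x) <= 1)%E ->
  (I Q (fun x => ((m k0 * t `^ r x) `^ (1 + rh_gain))%R) <= (7 * m k0)%:E)%E.
Proof.
move=> t0 hQ.
pose W x := m k0 * t `^ r x.
have W0 x : 0 < W x by rewrite mulr_gt0// powR_gt0.
have mW : measurable_fun setT W by apply: measurable_funM => //; exact: measurable_cst.
pose Gs j := Q `&` [set x | c1^-1 ^+ j < W x].
have mlt j : measurable [set x | c1^-1 ^+ j < W x].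
  have := @measurable_fun_ltr _ _ R setT (cst (c1^-1 ^+ j)) W.
  move=> /(_ (measurable_cst _) mW measurableT [set true] Logic.I).
  by rewrite setTI; congr measurable; apply/seteqP; split => x /=.
have mQ : measurable Q by exact: measurable_cell.
have mGs j : measurable (Gs j) by exact: measurableI.
have hIQ : (I Q W <= (m k0)%:E)%E.
  rewrite I_scale//; [|exact: ltW|by move=> x _; exact: powR_ge0].
  by apply: le_trans (lee_wpmul2l _ hQ) _; rewrite ?mule1// lee_fin ltW.
have cj0 j : 0 < c1^-1 ^+ j by rewrite exprn_gt0// invr_gt0.
have hGs j : (mu (Gs j) <= (c1 ^+ j * m k0)%:E)%E.
  have h : ((c1^-1 ^+ j)%:E * mu (Gs j) <= (m k0)%:E)%E.
    rewrite -I_cst//; apply: le_trans hIQ.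
    apply: (@le_trans _ _ (I (Gs j) W)).
      by apply: I_le => // x [_ /ltW h]; rewrite h ltW.
    by apply: I_subset => //; [move=> x _; exact: ltW|exact: subIsetl].
  have -> : mu (Gs j) = ((c1 ^+ j)%:E * ((c1^-1 ^+ j)%:E * mu (Gs j)))%E.
    by rewrite muleA -EFinM -exprMn mulfV ?expr1n ?mul1e// gt_eqF.
  apply: le_trans (lee_wpmul2l _ h) _; last by rewrite EFinM.
  by rewrite lee_fin exprn_ge0// ltW.
have hGt j : (I (Gs j) W <= (m k0 / 2 ^+ j)%:E)%E.
  rewrite I_scale//; [|exact: ltW|by move=> x _; exact: powR_ge0].
  rewrite EFinM; apply: lee_wpmul2l; first by rewrite lee_fin ltW.
  by apply: small_set_decay => //; exact: subIsetl.
(* [W] is bounded because [r] is, so finitely many layers suffice. *)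
have [J hJ] : exists J : nat, forall x, W x <= c1^-1 ^+ J.
  have [J hJ] : exists J : nat, m k0 * (1 + t `^ rP) <= 2 ^+ J.
    have [J hJ] : exists J : nat, m k0 * (1 + t `^ rP) <= J%:R.
      exists (Num.Def.archi_bound (m k0 * (1 + t `^ rP))); apply: ltW.
      by apply: archi_boundP; rewrite mulr_ge0 ?addr_ge0 ?powR_ge0// ltW.
    exists J; apply: le_trans hJ _; rewrite -natrX ler_nat ltnW//.
    exact: ltn_expl.
  exists J => x; apply: (@le_trans _ _ (2 ^+ J)).
    apply: le_trans hJ; rewrite ler_pM2l//.
    have /andP[r1 rp] := r1P x.
    by apply: powR_le_1D => //; [exact: ltW|lra].
  apply: lerXn2r; rewrite ?nnegrE ?invr_ge0 ?(ltW c1_gt0)//.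
  rewrite -[leLHS]invrK lef_pV2 ?posrE//.
have hpt x : Q x -> forall J, W x <= c1^-1 ^+ J ->
    W x `^ rh_gain <= 1 + \sum_(j < J) (3 / 2) ^+ j.+1 * \1_(Gs j) x.
  move=> Qx; elim=> [|J' IH] hW.
    rewrite big_ord0 addr0; apply: powR_le1; last exact/ltW/rh_gain_gt0.
    by rewrite (ltW (W0 x)).
  rewrite big_ord_recr/= addrA.
  have h32 k : 0 <= (3 / 2) ^+ k :> R by rewrite exprn_ge0// divr_ge0.
  have [le1|lt1] := leP (W x) (c1^-1 ^+ J').
    by apply: le_trans (IH le1) _; rewrite lerDl mulr_ge0// indicE.
  rewrite indicE mem_set// mulr1.
  apply: (@le_trans _ _ ((3 / 2) ^+ J'.+1)).
    rewrite -rh_gainE; apply: ge0_ler_powR; rewrite ?nnegrE//.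
    - exact/ltW/rh_gain_gt0.
    - exact: ltW.
    - exact: ltW.
  rewrite lerDr; apply: addr_ge0 => //; apply: sumr_ge0 => j _.
  by apply: mulr_ge0; [exact: h32|rewrite indicE].
have mone j : measurable_fun setT (fun x => W x * ((3 / 2) ^+ j.+1 * \1_(Gs j) x)).
  by apply: measurable_funM => //; apply: measurable_funM => //; exact: measurable_indic.
have h32 k : 0 <= (3 / 2) ^+ k :> R by rewrite exprn_ge0// divr_ge0.
have wone j x : 0 <= W x * ((3 / 2) ^+ j.+1 * \1_(Gs j) x).
  by rewrite mulr_ge0 ?(ltW (W0 x))// mulr_ge0// indicE.
apply: (@le_trans _ _ (I Q (fun x => W x + \sum_(j <- index_enum 'I_J) W x * ((3 / 2) ^+ j.+1 * \1_(Gs j) x)))).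
  apply: I_le => //.
  - exact: measurable_powRc.
  - by apply: measurable_funD => //; apply: measurable_sum.
  - move=> x Qx; rewrite powR_ge0/= -/(W x).
    rewrite powRD; last by rewrite (gt_eqF (W0 x)) implybT.
    rewrite powRr1 ?(ltW (W0 x))// -mulr_sumr.
    have := hpt x Qx J (hJ x); set S := \sum_(_ < _) _ => hS.
    have -> : W x + W x * S = W x * (1 + S) by ring.
    by rewrite ler_pM2l.
rewrite I_add//; [|exact: measurable_sum|by move=> x _; exact: ltW|]; last first.
  by move=> x _; apply: sumr_ge0 => j _; exact: wone.
rewrite I_sum; [|exact: mQ|by move=> j; exact: mone|by move=> j x _; exact: wone].
have -> : 7 * m k0 = m k0 + 6 * m k0 by ring.
rewrite EFinD; apply: leeD => //.
have hterm j : (I Q (fun x => W x * ((3 / 2) ^+ j.+1 * \1_(Gs j) x)) <=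
    (3 / 2 * m k0 * (3 / 4) ^+ j)%:E)%E.
  rewrite (@I_eq _ _ _ _ _ _ (fun x => (3 / 2) ^+ j.+1 * W x * \1_(Gs j) x)); last first.
    by move=> x _; ring.
  rewrite I_indic.
  have -> : Q `&` Gs j = Gs j by rewrite setIA setIid.
  rewrite I_scale//; last by move=> x _; exact: ltW.
  apply: le_trans (lee_wpmul2l _ (hGt j)) _; first by rewrite lee_fin.
  rewrite -EFinM lee_fin le_eqVlt; apply/orP; left; apply/eqP.
  have -> : (3 / 4 : R) = (3 / 2) / 2 by field.
  by rewrite exprS [in RHS]expr_div_n; ring.
apply: (@le_trans _ _ (\sum_(j < J) (3 / 2 * m k0 * (3 / 4) ^+ j)%:E)%E).
  by apply: lee_sum => j _; exact: hterm.
rewrite sumEFin lee_fin -mulr_sumr.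
have -> : \sum_(j < J) (3 / 4) ^+ j = 4 * (1 - (3 / 4) ^+ J) :> R.
  elim: (J) => [|J' IH]; first by rewrite big_ord0 expr0; ring.
  by rewrite big_ord_recr/= IH exprS; field.
have h34 : 0 <= (3 / 4) ^+ J :> R by rewrite exprn_ge0// divr_ge0.
move: mQ_gt0 h34; set a := m k0; set b := (3 / 4) ^+ J => a0 b0.
have := mulr_ge0 (ltW a0) b0; lra.
Qed.

End ReverseHolder.

(** * Estimates on one cell *)

Section CellEstimates.
Context {R : realType} {d} {T : measurableType d}.
Variables (mu : {measure set T -> \bar R}) (cn : R).
Implicit Types (A B : set T) (F : T -> R).
Local Notation I A F := (\int[mu]_(x in A) (F x)%:E)%E.
Variables (p : T -> R) (pm pP : R).
Hypothesis mp : measurable_fun setT p.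
Hypothesis pm1 : 1 < pm.
Hypothesis ppP : forall x, pm <= p x <= pP.
Local Notation q x := (cexp (p x)).
Variables (ca C0 : R).
Hypothesis ca1 : 1 <= ca.
Hypothesis C01 : 1 <= C0.
Hypothesis cn1 : 1 <= cn.

(** The sum makes one length serve both [p] and the conjugate exponent, which is bounded by
    [cexp pm]. *)
Definition chain_length : nat :=
  Num.Def.archi_bound ((2 * (8 * ca * C0)) `^ pP + (2 * (8 * ca * C0)) `^ cexp pm).

Definition rh_exp : R := rh_gain cn chain_length.

(** Chosen so that (1 + eta)^2 <= 1 + 3 eta <= 1 + rh_exp: one factor 1 + eta is the range allowed
    to [th], the other is the exponent in Young's inequality. *)
Definition theta_gain : R := Num.min 1 (rh_exp / 3).

(** Small enough that eps q (1 + eta) / eta <= 1, so that the first power of [F / l] controls the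
    gap factor. *)
Definition split_exp : R := theta_gain / ((1 + theta_gain) * cexp pm).

Local Notation eta := theta_gain.
Local Notation eps := split_exp.

Let qm_gt1 : 1 < cexp pm. Proof. exact: cexp_gt1. Qed.

Let K1_ge1 : 1 <= 8 * ca * C0.
Proof. by have := ca1; have := C01; nra. Qed.

Lemma chain_length_p : (2 * (8 * ca * C0)) `^ pP <= chain_length%:R.
Proof.
apply: ltW; apply: le_lt_trans (archi_boundP _); last by rewrite addr_ge0 ?powR_ge0.
by rewrite lerDl powR_ge0.
Qed.

Lemma chain_length_q : (2 * (8 * ca * C0)) `^ cexp pm <= chain_length%:R.
Proof.
apply: ltW; apply: le_lt_trans (archi_boundP _); last by rewrite addr_ge0 ?powR_ge0.
by rewrite lerDr powR_ge0.
Qed.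

Lemma rh_exp_gt0 (f : filtration mu cn) (x : T) : 0 < rh_exp.
Proof.
have r1 y : 1 <= p y <= pP.
  by have /andP[h1 h2] := ppP y; have := pm1; rewrite h2 andbT; lra.
exact: (rh_gain_gt0 r1 K1_ge1 cn1 chain_length_p x).
Qed.

Variable f : filtration mu cn.
Hypothesis HA : Ap_cells p ca f.
Hypothesis Hst : stopped_estimate p C0 f.
Local Notation cl := (cell f).
Local Notation m := (cell_size f).

Lemma reverse_holder_p k x t : 0 < t -> (I (cl k x) (fun y => t `^ p y) <= 1)%E ->
  (I (cl k x) (fun y => ((m k * t `^ p y) `^ (1 + rh_exp))%R) <= (7 * m k)%:E)%E.
Proof.
have r1 y : 1 <= p y <= pP.
  by have /andP[h1 h2] := ppP y; have := pm1; rewrite h2 andbT; lra.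
move=> t0 h0; apply: (reverse_holder mp r1 K1_ge1 cn1 chain_length_p _ t0 h0).
move=> K P Pinv k0 x0 Os E t' mE t'0 hE h.
exact: (reached_le_p mp pm1 ppP ca1 C01 HA Hst Pinv Os mE t'0 hE).
Qed.

Lemma reverse_holder_q k x t : 0 < t -> (I (cl k x) (fun y => t `^ q y) <= 1)%E ->
  (I (cl k x) (fun y => ((m k * t `^ q y) `^ (1 + rh_exp))%R) <= (7 * m k)%:E)%E.
Proof.
have mq := measurable_cexp mp pm1 ppP.
move=> t0 h0; apply: (reverse_holder mq (cexp_bounds pm1 ppP) K1_ge1 cn1 chain_length_q _ t0 h0).
move=> K P Pinv k0 x0 Os E t' mE t'0 hE h.
exact: (reached_le_q mp pm1 ppP ca1 C01 HA Hst Pinv Os mE t'0 hE).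
Qed.

Section OneCell.
Variables (k : nat) (x : T) (t s : R).
Local Notation D := (cl k x).
Hypotheses (t0 : 0 < t) (s0 : 0 < s).
Hypothesis ht : (I D (fun y => t `^ p y) <= 1)%E.
Hypothesis hs : (I D (fun y => s `^ q y) <= 1)%E.
Hypothesis hts : 1 <= ca * t * s * m k.
Variables (F : T -> R) (l : R).
Hypothesis mF : measurable_fun setT F.
Hypothesis F0 : forall y, 0 <= F y.
Hypothesis l0 : 0 < l.
Hypothesis Flow : ((l * m k)%:E < I D F)%E.
Hypothesis Fup : (I D F <= (2 * l * m k)%:E)%E.

Let mk0 : 0 < m k. Proof. exact: cell_size_gt0. Qed.

Let eta_gt0 : 0 < eta.
Proof. by rewrite /theta_gain lt_min ltr01 divr_gt0 ?(rh_exp_gt0 f x). Qed.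

Let eta_le1 : eta <= 1.
Proof. by rewrite /theta_gain ge_min lexx. Qed.

Let eta_sqr : (1 + eta) * (1 + eta) <= 1 + rh_exp.
Proof.
have h : eta <= rh_exp / 3 by rewrite /theta_gain ge_min lexx orbT.
have := eta_le1; have := eta_gt0; nra.
Qed.

Let eps_gt0 : 0 < eps.
Proof.
rewrite /split_exp divr_gt0 ?mulr_gt0//; first by have := eta_gt0; lra.
by have := qm_gt1; lra.
Qed.

Let p1 y : 1 < p y. Proof. exact: exponent_gt1 ppP y. Qed.
Let q1 y : 1 < q y. Proof. exact: cexp_gt1. Qed.

(** [upper_part] is the product of the other two. The damped factor is measured in the p-modular and
    is summable over the levels; the gap factor is measured in the q-modular and grows only like a
    small power of [F / l]. *)
Definition upper_part F l y := if l / 2 < F y then F y else 0.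
Definition gap_part F l y := if l / 2 < F y then (F y / l) `^ eps else 0.
Definition damped_part F l y :=
  if l / 2 < F y then F y `^ (1 - eps) * l `^ eps else 0.

Lemma measurable_upper (G H : T -> R) : measurable_fun setT G ->
  measurable_fun setT H ->
  measurable_fun setT (fun y => if l / 2 < G y then H y else 0).
Proof.
move=> mG mH; apply: measurable_fun_ifT => //.
by apply: measurable_fun_ltr => //; exact: measurable_cst.
Qed.

Lemma measurable_gap : measurable_fun setT (gap_part F l).
Proof.
by apply: measurable_upper => //; apply: measurable_powRc; exact: measurable_funM.
Qed.

Lemma measurable_damped : measurable_fun setT (damped_part F l).
Proof.
apply: measurable_upper => //; apply: measurable_funM => //.
exact: measurable_powRc.
Qed.

Lemma gap_ge0 y : 0 <= gap_part F l y.
Proof. by rewrite /gap_part; case: ifP => // _; exact: powR_ge0. Qed.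

Lemma damped_ge0 y : 0 <= damped_part F l y.
Proof. by rewrite /damped_part; case: ifP => // _; rewrite mulr_ge0 ?powR_ge0. Qed.

Lemma damped_mul_gap y : damped_part F l y * gap_part F l y = upper_part F l y.
Proof.
rewrite /damped_part /gap_part /upper_part; case: ifP => h; last by rewrite mulr0.
have Fy : 0 < F y by apply: lt_trans h; rewrite divr_gt0.
rewrite -mulrA -powRM ?divr_ge0 ?(ltW Fy) ?(ltW l0)//.
have -> : l * (F y / l) = F y by field; rewrite gt_eqF.
rewrite -powRD; last by rewrite (gt_eqF Fy) implybT.
by rewrite subrK powRr1 ?ltW.
Qed.

(** The values of [F] up to [l / 2] account for at most half of [l * m k], which the whole integral
    exceeds. *)
Lemma upper_part_int : ((l * m k / 2)%:E <= I D (upper_part F l))%E.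
Proof.
have mD := measurable_cell f k x.
have mU : measurable_fun setT (upper_part F l) by exact: measurable_upper.
have U0 y : 0 <= upper_part F l y by rewrite /upper_part; case: ifP.
have h : (I D F <= I D (fun y => l / 2 + upper_part F l y))%E.
  apply: I_le => //; first exact: measurable_funD.
  move=> y _; rewrite F0/= /upper_part; case: ltP => [_|]; last by rewrite addr0.
  by rewrite lerDr divr_ge0// ltW.
rewrite I_add// in h; last by move=> y _; rewrite divr_ge0// ltW.
rewrite I_cst// mu_cell -EFinM in h.
have := lt_le_trans Flow h.
have := I_ge0 (fun y _ => U0 y) : (0 <= I D (upper_part F l))%E.
case: (I D (upper_part F l)) => [r| |]//; rewrite ?leey// -EFinD lte_fin !lee_fin.
lra.
Qed.

(* [W `^ th * h `^ q <= W `^ (th (1 + eta)) + h `^ (q (1 + eta) / eta)] with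
   [W = m k * s `^ q]: the first power is controlled by the reverse Hölder
   inequality, the second one by [1 + F / l] through the choice of [eps]. *)
Lemma gap_bound th : 0 <= th <= 1 + eta ->
  (I D (fun y => ((gap_part F l y * s `^ th) `^ q y)%R) <= (11 * m k `^ (1 - th))%:E)%E.
Proof.
move=> /andP[th0 th1].
have mD := measurable_cell f k x.
have mq := measurable_cexp mp pm1 ppP.
pose W y := m k * s `^ q y.
have W0 y : 0 < W y by rewrite mulr_gt0// powR_gt0.
have mW : measurable_fun setT W by apply: measurable_funM => //; exact: measurable_cst_powR.
have mth0 : 0 < m k `^ th by exact: powR_gt0.
have hpt y : (gap_part F l y * s `^ th) `^ q y <=
    (m k `^ th)^-1 * ((2 + W y `^ (1 + rh_exp)) + l^-1 * F y).
  rewrite ler_pdivlMl//.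
  have -> : m k `^ th * (gap_part F l y * s `^ th) `^ q y =
      W y `^ th * gap_part F l y `^ q y.
    rewrite /W !powRM ?gap_ge0 ?powR_ge0 ?(ltW mk0)//.
    by rewrite -!powRrM (mulrC th); ring.
  have := @mul_le_powR_add _ (W y `^ th) (gap_part F l y `^ q y) eta
    (powR_ge0 _ _) (powR_ge0 _ _) eta_gt0.
  move=> /le_trans; apply.
  rewrite -!powRrM.
  have -> : 2 + W y `^ (1 + rh_exp) + l^-1 * F y
    = (1 + W y `^ (1 + rh_exp)) + (1 + l^-1 * F y) by ring.
  apply: lerD.
    apply: powR_le_1D; first exact: ltW.
    - by rewrite mulr_ge0//; have := eta_gt0; lra.
    - apply: le_trans eta_sqr; rewrite ler_wpM2r//; by have := eta_gt0; lra.
  have Fl0 : 0 <= l^-1 * F y by rewrite mulr_ge0// invr_ge0 ltW.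
  have ee : (1 + eta) / eta != 0.
    by rewrite mulf_neq0 ?invr_eq0 ?gt_eqF//; have := eta_gt0; lra.
  rewrite /gap_part; case: ifP => _; last first.
    rewrite powR0 ?addr_ge0// mulf_neq0// gt_eqF//.
    by have := q1 y; lra.
  have -> : ((F y / l) `^ eps) `^ (q y * ((1 + eta) / eta)) =
      (l^-1 * F y) `^ (q y * ((1 + eta) / eta) * eps).
    by rewrite -powRrM (mulrC (F y)) (mulrC eps).
  have := @powR_le_1D _ (l^-1 * F y) (q y * ((1 + eta) / eta) * eps) 1 Fl0.
  rewrite powRr1//; apply.
    apply: mulr_ge0; last exact/ltW/eps_gt0.
    apply: mulr_ge0; first by have := q1 y; lra.
    by apply: divr_ge0; [have := eta_gt0; lra|exact: ltW].
  rewrite /split_exp.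
  have -> : q y * ((1 + eta) / eta) * (eta / ((1 + eta) * cexp pm)) = q y / cexp pm.
    by field; rewrite !gt_eqF//; have := eta_gt0; have := qm_gt1; lra.
  rewrite ler_pdivrMr ?mul1r; last by have := qm_gt1; lra.
  by have /andP[] := cexp_bounds pm1 ppP y.
have mWr : measurable_fun setT (fun y => W y `^ (1 + rh_exp)) by exact: measurable_powRc.
have hI : (I D (fun y => (m k `^ th)^-1 * ((2 + W y `^ (1 + rh_exp)) + l^-1 * F y))
    <= ((m k `^ th)^-1 * (11 * m k))%:E)%E.
  have lF0 y : 0 <= l^-1 * F y by rewrite mulr_ge0// invr_ge0 ltW.
  have W20 y : 0 <= 2 + W y `^ (1 + rh_exp) by rewrite addr_ge0 ?powR_ge0.
  rewrite I_scale//; first last.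
  - by move=> y _; rewrite addr_ge0.
  - by rewrite invr_ge0 ltW.
  - by apply: measurable_funD; [exact: measurable_funD|exact: measurable_funM].
  rewrite EFinM; apply: lee_wpmul2l; first by rewrite lee_fin invr_ge0 ltW.
  rewrite I_add//; last 2 first.
  - exact: measurable_funD.
  - exact: measurable_funM.
  rewrite I_add//; last by move=> y _; exact: powR_ge0.
  rewrite I_cst// mu_cell I_scale//; last by rewrite invr_ge0 ltW.
  (* Here 7 is the constant of the reverse Hölder inequality, and the last 2 bounds the average of
     [F / l]. *)
  have -> : 11 * m k = (2 * m k + 7 * m k) + 2 * m k by ring.
  rewrite !EFinD; apply: leeD; first apply: leeD => //.
    exact: reverse_holder_q.
  apply: le_trans (lee_wpmul2l _ Fup) _; first by rewrite lee_fin invr_ge0 ltW.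
  rewrite -EFinM lee_fin le_eqVlt; apply/orP; left; apply/eqP; field.
  by rewrite gt_eqF.
apply: le_trans (le_trans hI _).
- apply: I_le; first exact: mD.
  + apply: measurable_powR2 => //; apply: measurable_funM => //.
    exact: measurable_gap.
  + apply: measurable_funM => //; apply: measurable_funD; first exact: measurable_funD.
    exact: measurable_funM.
  + by move=> y _; rewrite powR_ge0 hpt.
- rewrite lee_fin le_eqVlt; apply/orP; left; apply/eqP.
  rewrite powRD; last by rewrite (gt_eqF mk0) implybT.
  by rewrite powRr1 ?(ltW mk0)// powRN; ring.
Qed.

Let measurable_scaled c : measurable_fun setT (fun y => c * damped_part F l y).
Proof. by apply: measurable_funM => //; exact: measurable_damped. Qed.

(** The weights [c] and [b] stay free: [damped_norm_lower] takes b = s, and [damped_modular_lower]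
    takes c = K and b = s^th / K with [K] so large that the gap term is absorbed. *)
Lemma split_young c b : 0 < c -> 0 < b ->
  ((c * b * (l * m k / 2))%:E <= I D (fun y => ((c * damped_part F l y) `^ p y)%R) +
     I D (fun y => ((gap_part F l y * b) `^ q y)%R))%E.
Proof.
move=> c0 b0; have mD := measurable_cell f k x.
have mU : measurable_fun setT (upper_part F l) by exact: measurable_upper.
have U0 y : 0 <= upper_part F l y by rewrite /upper_part; case: ifP.
apply: le_trans (@young_int _ _ _ mu p pm pP mp pm1 ppP D
  (fun y => c * damped_part F l y) (fun y => gap_part F l y * b) mD _ _ _ _).
- rewrite (@I_eq _ _ _ _ _ _ (fun y => c * b * upper_part F l y)); last first.
    by move=> y _; rewrite -damped_mul_gap; ring.
  rewrite I_scale//; last by rewrite mulr_ge0// ltW.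
  rewrite EFinM; apply: lee_wpmul2l; last exact: upper_part_int.
  by rewrite lee_fin mulr_ge0// ltW.
- exact: measurable_scaled.
- by apply: measurable_funM => //; exact: measurable_gap.
- by move=> y; rewrite mulr_ge0 ?damped_ge0// ltW.
- by move=> y; rewrite mulr_ge0 ?gap_ge0// ltW.
Qed.

(** In terms of norms, [damped_part] has norm at least l / (24 ca t) on the cell. This is
    [gap_bound] at th = 1, with A_p trading [s] for [t]; 24 is 2 (1 + 11). *)
Lemma damped_norm_lower a : 0 < a ->
  (I D (fun y => ((a * damped_part F l y) `^ p y)%R) <= 1)%E -> a * l <= 24 * ca * t.
Proof.
move=> a0 h.
have h2 := split_young a0 s0.
have h3 : (I D (fun y => ((gap_part F l y * s) `^ q y)%R) <= 11%:E)%E.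
  have := @gap_bound 1; rewrite subrr powRr0 mulr1 powRr1 ?(ltW s0)//; apply.
  by have := eta_gt0; lra.
have : ((a * s * (l * m k / 2))%:E <= 1%:E + 11%:E)%E.
  by apply: le_trans h2 (leeD h h3).
rewrite -EFinD lee_fin => h4.
have sm0 : 0 < s * m k by exact: mulr_gt0.
rewrite -(ler_pM2r sm0).
have -> : a * l * (s * m k) = 2 * (a * s * (l * m k / 2)) by field.
have -> : 24 * ca * t * (s * m k) = 24 * (ca * t * s * m k) by ring.
have := hts; lra.
Qed.

(** With K = 44 ca^2 the gap term is half of the lower bound it is compared with. The 32 is 4, left
    by absorbing it, times 8, the constant for the modular of [l]. *)
Definition gain_const : R := 32 * ca ^+ 2 * (44 * ca ^+ 2) `^ pP.

(** Everything has the size of A = (m k)^(1 - th): the modular of l = t^th and the q-modular of the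
    gap factor times s^th are at most multiples of it, by the reverse Hölder inequality. So is, from
    below, the left side of [split_young], because A_p bounds (s t)^th below by a multiple of (m
    k)^(- th). *)
Lemma damped_modular_lower th : 0 <= th <= 1 + eta -> l = t `^ th ->
  (I D (fun y => l `^ p y) <= gain_const%:E * I D (fun y => damped_part F l y `^ p y))%E.
Proof.
move=> th01 lt; have /andP[th0 th1] := th01.
have mD := measurable_cell f k x.
have mq := measurable_cexp mp pm1 ppP.
pose V y := m k * t `^ p y.
have V0 y : 0 < V y by rewrite mulr_gt0// powR_gt0.
have mV : measurable_fun setT V by apply: measurable_funM => //; exact: measurable_cst_powR.
have mth0 : 0 < m k `^ th by exact: powR_gt0.
pose A := m k `^ (1 - th).
have A0 : 0 < A by exact: powR_gt0.
have AE : A = m k / m k `^ th.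
  rewrite /A powRD; last by rewrite (gt_eqF mk0) implybT.
  by rewrite powRr1 ?(ltW mk0)// powRN.
have hl : (I D (fun y => l `^ p y) <= (8 * A)%:E)%E.
  apply: (@le_trans _ _ (I D (fun y => (m k `^ th)^-1 * (1 + V y `^ (1 + rh_exp))))).
    apply: I_le => //.
    - exact: measurable_cst_powR.
    - apply: measurable_funM => //; apply: measurable_funD => //.
      exact: measurable_powRc.
    - move=> y _; rewrite powR_ge0/= ler_pdivlMl//.
      have -> : m k `^ th * l `^ p y = V y `^ th.
        rewrite lt /V [RHS]powRM; [|exact: ltW|exact: powR_ge0].
        by rewrite -!powRrM (mulrC th).
      apply: powR_le_1D => //; first exact: ltW.
      by have := eta_sqr; have := eta_gt0; nra.
  have mVr : measurable_fun setT (fun y => V y `^ (1 + rh_exp)) by exact: measurable_powRc.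
  rewrite I_scale//; first last.
  - by move=> y _; rewrite addr_ge0 ?powR_ge0.
  - by rewrite invr_ge0 ltW.
  - exact: measurable_funD.
  rewrite I_add//; last by move=> y _; exact: powR_ge0.
  rewrite I_cst// mu_cell mul1e.
  have hh : ((m k)%:E + I D (fun y => V y `^ (1 + rh_exp)) <= (8 * m k)%:E)%E.
    have -> : 8 * m k = m k + 7 * m k by ring.
    by rewrite EFinD; apply: leeD; [exact: lexx|exact: (reverse_holder_p t0 ht)].
  apply: le_trans (lee_wpmul2l _ hh) _; first by rewrite lee_fin invr_ge0 ltW.
  by rewrite -EFinM lee_fin AE le_eqVlt; apply/orP; left; apply/eqP; ring.
pose K := 44 * ca ^+ 2.
have ca2 : 1 <= ca ^+ 2 by rewrite exprn_ege1.
have K1 : 1 <= K by rewrite /K; lra.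
have K0 : 0 < K by lra.
have hg := @gap_bound th th01.
have b0 : 0 < s `^ th / K by rewrite divr_gt0// powR_gt0.
have hy := split_young K0 b0.
have hq : (I D (fun y => ((gap_part F l y * (s `^ th / K)) `^ q y)%R) <=
    (11 * A / K)%:E)%E.
  apply: (@le_trans _ _ (I D (fun y => K^-1 * (gap_part F l y * s `^ th) `^ q y))).
    have mG : measurable_fun setT (fun y => gap_part F l y * s `^ th).
      by apply: measurable_funM => //; exact: measurable_gap.
    apply: I_le => //.
    - apply: measurable_powR2 => //; apply: measurable_funM => //.
      exact: measurable_gap.
    - by apply: measurable_funM => //; exact: measurable_powR2.
    - move=> y _; rewrite powR_ge0/=.
      have -> : gap_part F l y * (s `^ th / K) = K^-1 * (gap_part F l y * s `^ th).
        by ring.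
      rewrite [leLHS]powRM ?invr_ge0 ?(ltW K0)//; last first.
        by apply: mulr_ge0; [exact: gap_ge0|exact: powR_ge0].
      rewrite ler_wpM2r ?powR_ge0//; apply: powR_le_self; last exact/ltW/q1.
      by rewrite invr_ge0 (ltW K0)/= invf_le1.
  rewrite I_scale//; first last.
  - by move=> y _; exact: powR_ge0.
  - by rewrite invr_ge0 ltW.
  - by apply: measurable_powR2 => //; apply: measurable_funM => //; exact: measurable_gap.
  apply: le_trans (lee_wpmul2l _ hg) _; first by rewrite lee_fin invr_ge0 ltW.
  by rewrite -EFinM lee_fin mulrC.
have hp : (I D (fun y => ((K * damped_part F l y) `^ p y)%R) <=
    (K `^ pP)%:E * I D (fun y => (damped_part F l y `^ p y)%R))%E.
  have mdp : measurable_fun setT (fun y => damped_part F l y `^ p y).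
    by apply: measurable_powR2 => //; exact: measurable_damped.
  rewrite -I_scale ?powR_ge0//; last by move=> y _; exact: powR_ge0.
  apply: I_le => //.
  - by apply: measurable_powR2.
  - exact: measurable_funM.
  - move=> y _; rewrite powR_ge0/= powRM ?damped_ge0 ?(ltW K0)//.
    by rewrite ler_wpM2r ?powR_ge0// ler_powR//; have /andP[] := ppP y.
have hsl : (ca ^+ 2)^-1 * A <= 2 * (K * (s `^ th / K) * (l * m k / 2)).
  have -> : 2 * (K * (s `^ th / K) * (l * m k / 2)) = s `^ th * l * m k.
    by field; rewrite gt_eqF.
  have st : (ca * m k)^-1 `^ th <= (s * t) `^ th.
    have cm : 0 < ca * m k by rewrite mulr_gt0//; have := ca1; lra.
    apply: ge0_ler_powR; rewrite ?nnegrE ?invr_ge0 ?(ltW cm)//.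
      by rewrite mulr_ge0// ltW.
    rewrite -[(_)^-1]mul1r ler_pdivrMr//.
    by apply: le_trans hts _; rewrite le_eqVlt; apply/orP; left; apply/eqP; ring.
  rewrite powRM ?(ltW s0) ?(ltW t0)// in st.
  rewrite -lt in st.
  have -> : (ca ^+ 2)^-1 * A = (ca ^+ 2)^-1 * (m k `^ th)^-1 * m k.
    by rewrite AE; ring.
  rewrite ler_pM2r//.
  apply: le_trans st.
  rewrite powRV ?mulr_ge0 ?(ltW mk0)//; last by have := ca1; lra.
  rewrite powRM ?(ltW mk0)//; last by have := ca1; lra.
  rewrite [leRHS]invfM ler_pM2r ?invr_gt0// lef_pV2 ?posrE ?powR_gt0 ?exprn_gt0//; last first.
  - by have := ca1; lra.
  - by have := ca1; lra.
  rewrite -powR_mulrn; last by have := ca1; lra.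
  by apply: ler_powR => //; have := eta_le1; lra.
have hge0 : (0 <= I D (fun y => damped_part F l y `^ p y))%E.
  by apply: I_ge0 => y _; exact: powR_ge0.
apply: le_trans hl _.
have {hy hp hq} := le_trans hy (leeD hp hq).
have g0 : 0 < gain_const.
  rewrite /gain_const -/K !mulr_gt0 ?powR_gt0//; first by have := ca1; lra.
  by have := ca1; lra.
move: hge0; case: (I D (fun y => damped_part F l y `^ p y)) => [Y| |]//; last first.
  by move=> _ _; rewrite gt0_muley ?lte_fin// leey.
rewrite lee_fin -!EFinM -EFinD !lee_fin /gain_const -/K => Y0 h.
have e : 11 * A / K = (ca ^+ 2)^-1 * A / 4.
  by rewrite /K; field; apply/eqP; have := ca1; lra.
rewrite e in h.
have i2 : 0 < ca ^+ 2 by lra.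
have h2 : (ca ^+ 2)^-1 * A <= 4 * (K `^ pP * Y) by lra.
rewrite ler_pdivrMl// in h2.
have -> : 32 * ca ^+ 2 * K `^ pP * Y = 8 * (ca ^+ 2 * (4 * (K `^ pP * Y))) by ring.
lra.
Qed.

End OneCell.

End CellEstimates.

(** * Bad cells *)

Section BadCells.
Context {R : realType} {d} {T : measurableType d}.
Variables (mu : {measure set T -> \bar R}) (cn : R).
Implicit Types (A B : set T) (F : T -> R).
Local Notation I A F := (\int[mu]_(x in A) (F x)%:E)%E.
Variables (p : T -> R) (pm pP : R).
Hypothesis mp : measurable_fun setT p.
Hypothesis pm1 : 1 < pm.
Hypothesis ppP : forall x, pm <= p x <= pP.
Local Notation q x := (cexp (p x)).
Variables (ca C0 : R).
Hypothesis ca1 : 1 <= ca.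
Hypothesis C01 : 1 <= C0.
Hypothesis cn1 : 1 <= cn.

Local Notation eta := (theta_gain cn pm pP ca C0).
Local Notation eps := (split_exp cn pm pP ca C0).
Local Notation damped F l := (damped_part cn pm pP ca C0 F l).

(** The value of 1 - 1 / th at the end point th = 1 + eta; for l = t^th one has l / t = l^(1 - 1 /
    th). *)
Definition kappa : R := eta / (1 + eta).
(** Bounds the modular of [u] once that of [u / C0] is at most one. *)
Definition star_const : R := C0 `^ pP.
(** The second summand rules out on bad cells every l = t^th covered by [damped_modular_lower]. The
    square gives a square root of at least 2 (star_const + 1), as the summation over the bad pieces
    requires. *)
Definition bad_const : R :=
  (2 * (star_const + 1)) ^+ 2 + gain_const pP ca.

Variable f : filtration mu cn.
Hypothesis HA : Ap_cells p ca f.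
Hypothesis Hst : stopped_estimate p C0 f.
Local Notation cl := (cell f).
Local Notation m := (cell_size f).

Let p1 y : 1 < p y. Proof. exact: exponent_gt1 ppP y. Qed.

Variables (F : T -> R).
Hypothesis mF : measurable_fun setT F.
Hypothesis F0 : forall y, 0 <= F y.
Hypothesis hF : (I setT (fun x => ((2 * ca * F x) `^ p x)%R) <= 1)%E.

Let hF1 : (I setT (fun x => F x `^ p x) <= 1)%E.
Proof.
apply: le_trans hF; apply: I_le => //.
- exact: measurable_powR2.
- by apply: measurable_powR2 => //; exact: measurable_funM.
- move=> x _; rewrite powR_ge0/=; apply: ge0_ler_powR; rewrite ?nnegrE//.
  + by have := p1 x; lra.
  + by rewrite mulr_ge0//; have := ca1; lra.
  + by rewrite ler_peMl//; have := ca1; lra.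
Qed.

(** The factor is twice the [24 * ca] of [damped_norm_lower], so that on a bad cell the modular of
    [test_part] divided by [l / t] exceeds one. *)
Definition test_part l y := 48 * ca * damped F l y.

Lemma measurable_test_part l : measurable_fun setT (test_part l).
Proof. by apply: measurable_funM => //; exact: measurable_damped. Qed.

Lemma test_part_ge0 l y : 0 <= test_part l y.
Proof. by rewrite mulr_ge0 ?damped_ge0//; have := ca1; lra. Qed.

Section OneBadCell.
Variables (k : nat) (x : T) (l : R).
Local Notation D := (cl k x).
Hypothesis l0 : 0 < l.
Hypothesis Fl : l < average f F k x <= 2 * l.
Hypothesis bad : (bad_const%:E * I D (fun y => test_part l y `^ p y)
  < I D (fun y => l `^ p y))%E.

Let eta01 : 0 < eta <= 1.
Proof.
rewrite /theta_gain lt_min ltr01 divr_gt0 ?(rh_exp_gt0 pm1 ppP ca1 C01 cn1 f x)//.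
by rewrite ge_min lexx.
Qed.

Let gain_gt0 : 0 < gain_const pP ca.
Proof.
have ca2 : 1 <= ca ^+ 2 by rewrite exprn_ege1.
by rewrite /gain_const mulr_gt0 ?powR_gt0//; lra.
Qed.

(** A cell with l = t^th and 0 <= th <= 1 + eta is good by [damped_modular_lower]. The normalisation
    of [F] gives l < t. If t >= 1, then l >= 1 would put th into [0, 1], so l < 1 and l / t <= l. If
    t < 1, then th is positive, hence above 1 + eta, and l / t = l^(1 - 1 / th) is at most
    l^kappa. *)
Lemma bad_cell_scale : l < 1 /\ exists t, [/\ 0 < t, l < t, l / t <= l `^ kappa,
  (I D (fun y => t `^ p y) <= 1)%E &
  forall a, 0 < a -> (I D (fun y => ((a * damped F l y) `^ p y)%R) <= 1)%E ->
    a * l <= 24 * ca * t].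
Proof.
have [t [s [t0 s0 ht hs hts]]] := HA k x.
have mD := measurable_cell f k x.
have mk0 := cell_size_gt0 f k.
have IF : I D F = (average f F k x * m k)%:E by exact: (I_average mp pm1 ppP f k x mF F0 hF1).
have /andP[Fl1 Fl2] := Fl.
have Flow : ((l * m k)%:E < I D F)%E by rewrite IF lte_fin ltr_pM2r.
have Fup : (I D F <= (2 * l * m k)%:E)%E by rewrite IF lee_fin ler_pM2r.
have ca20 : 0 < 2 * ca by have := ca1; lra.
have avt : average f F k x <= t.
  have h : (I D (fun y => ((2 * ca * F y) `^ p y)%R) <= 1)%E.
    apply: le_trans hF; apply: I_subset => //.
      by apply: measurable_powR2 => //; exact: measurable_funM.
    by move=> y _; exact: powR_ge0.
  have := average_le_Ap mp pm1 ppP mF F0 hF1 ca20 h t0 s0 hs hts.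
  by rewrite ler_pM2l.
have lt : l < t by exact: lt_le_trans avt.
have noA th : 0 <= th <= 1 + eta -> l <> t `^ th.
  move=> h e.
  have := damped_modular_lower mp pm1 ppP ca1 C01 cn1 HA Hst t0 s0 ht hs hts
    mF F0 l0 Flow Fup h e.
  apply/negP; rewrite -ltNge; apply: le_lt_trans bad.
  have h1 : (I D (fun y => damped F l y `^ p y) <= I D (fun y => test_part l y `^ p y))%E.
    apply: I_le => //.
    - by apply: measurable_powR2 => //; exact: measurable_damped.
    - by apply: measurable_powR2 => //; exact: measurable_test_part.
    - move=> y _; rewrite powR_ge0/=; apply: ge0_ler_powR; rewrite ?nnegrE ?damped_ge0 ?test_part_ge0//.
        by have := p1 y; lra.
      by rewrite /test_part ler_peMl ?damped_ge0//; have := ca1; lra.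
  apply: lee_pmul.
  - by rewrite lee_fin (ltW gain_gt0).
  - by apply: I_ge0 => y _; exact: powR_ge0.
  - by rewrite lee_fin /bad_const lerDr sqr_ge0.
  - exact: h1.
have /andP[e0 e1] := eta01.
have thE : t != 1 -> l = t `^ (ln l / ln t).
  move=> tn1; rewrite /powR gt_eqF// divfK ?lnK ?posrE//.
  by rewrite ln_eq0.
have k01 : 0 <= kappa <= 1.
  by rewrite /kappa divr_ge0 ?(ltW e0)//= ?ler_pdivrMr ?mul1r; lra.
have [l1 hk] : l < 1 /\ l / t <= l `^ kappa.
  have [t1|t1] := leP 1 t.
    have l1 : l < 1.
      rewrite ltNge; apply/negP => l1.
      have lnt : 0 < ln t by apply: ln_gt0; exact: le_lt_trans lt.
      apply: (noA (ln l / ln t)).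
        rewrite divr_ge0 ?ln_ge0 ?(ltW lnt)//= ler_pdivrMr//.
        have h2 : ln l <= ln t by rewrite ler_ln ?posrE// ltW.
        by have := mulr_gt0 e0 lnt; lra.
      by apply: thE; rewrite gt_eqF//; exact: le_lt_trans lt.
    split => //; apply: (@le_trans _ _ l); first by rewrite ler_pdivrMr// ler_peMr// ltW.
    rewrite -[leLHS]powRr1 ?(ltW l0)//; apply: ger_powR; first by rewrite l0 ltW.
    by case/andP: k01.
  have l1 : l < 1 by exact: lt_trans t1.
  split => //.
  have lnt : ln t < 0 by rewrite ln_lt0// t0.
  have lnl : ln l < 0 by rewrite ln_lt0// l0.
  pose th := ln l / ln t.
  have th0 : 0 < th by rewrite /th nmulr_rgt0// invr_lt0.
  have e := thE (negbT (lt_eqF t1)).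
  have th1 : 1 + eta < th.
    rewrite ltNge; apply/negP => th1; apply: (noA th) => //.
    by rewrite (ltW th0).
  have -> : l / t = l `^ (1 - th^-1).
    rewrite powRD; last by rewrite (gt_eqF l0) implybT.
    rewrite powRr1 ?(ltW l0)// powRN; congr (_ * _^-1).
    by rewrite [in RHS]e -powRrM mulfV ?gt_eqF// powRr1// ltW.
  apply: ger_powR; first by rewrite l0 ltW.
  rewrite /kappa.
  have -> : eta / (1 + eta) = 1 - (1 + eta)^-1 by field; apply/eqP; lra.
  by rewrite lerD2l lerN2 lef_pV2 ?posrE//; lra.
split => //; exists t; split => // a a0 h.
exact: (damped_norm_lower mp pm1 ppP ca1 C01 cn1 HA Hst s0 hs hts mF F0 l0 Flow Fup a0 h).
Qed.

Lemma bad_cell_lt1 : l < 1.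
Proof. by have [] := bad_cell_scale. Qed.

Local Notation X := (I D (fun y => l `^ p y)).

(** Since l / t <= 1 and p >= 1, l^p is at most (l / t) t^p, and [t] has modular at most one. *)
Lemma bad_cell_le : (X <= (l `^ kappa)%:E)%E.
Proof.
have mD := measurable_cell f k x.
have [l1 [t [t0 lt lk ht _]]] := bad_cell_scale.
have tau0 : 0 <= l / t by apply: divr_ge0; exact: ltW.
have tau1 : l / t <= 1 by rewrite ler_pdivrMr// mul1r ltW.
apply: (@le_trans _ _ (I D (fun y => l / t * t `^ p y))).
  apply: I_le => //; first exact: measurable_cst_powR.
    by apply: measurable_funM => //; exact: measurable_cst_powR.
  move=> y _; rewrite powR_ge0/=.
  have -> : l `^ p y = (l / t) `^ p y * t `^ p y.
    by rewrite -powRM ?(ltW t0)// divfK// gt_eqF.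
  rewrite ler_wpM2r ?powR_ge0//; apply: powR_le_self; last exact/ltW/p1.
  by rewrite tau0.
rewrite I_scale//; last by move=> y _; exact: powR_ge0.
  apply: le_trans (lee_wpmul2l _ ht) _; first by rewrite lee_fin.
  by rewrite mule1 lee_fin.
exact: measurable_cst_powR.
Qed.

(* The two test sets: [tau = l / t] is small, its p-th power is large somewhere
   on the cell and much smaller elsewhere on it. *)
Lemma bad_cell_test : exists al A B,
  [/\ 0 < al, measurable A /\ measurable B, A `<=` D /\ B `<=` D,
      (0 < mu A)%E /\ (0 < mu B)%E &
   forall y, (A y -> (fine X / 2) `^ 2^-1 <= al `^ p y) /\
     (B y -> al `^ p y <= 2 * (bad_const `^ 2^-1)^-1 * (fine X / 2) `^ 2^-1)].
Proof.
have mD := measurable_cell f k x.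
have mk0 := cell_size_gt0 f k.
have [l1 [t [t0 lt lk ht hv]]] := bad_cell_scale.
pose tau := l / t.
have tau0 : 0 < tau by exact: divr_gt0.
have tau1 : tau < 1 by rewrite ltr_pdivrMr// mul1r.
have le := bad_cell_le.
have Xge : (0 <= X)%E by apply: I_ge0 => y _; exact: powR_ge0.
have Xfin : X \is a fin_num by rewrite ge0_fin_numE// (le_lt_trans le)// ltry.
have bc0 : 0 < bad_const.
  by rewrite /bad_const ltr_wpDl ?sqr_ge0 ?gain_gt0.
pose v := test_part l.
have badv : (bad_const%:E * I D (fun y => v y `^ p y) < X)%E by exact: bad.
have mv : measurable_fun setT v by exact: measurable_test_part.
have v0 y : 0 <= v y by exact: test_part_ge0.
have mvp : measurable_fun setT (fun y => v y `^ p y) by exact: measurable_powR2.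
have Yge : (0 <= I D (fun y => v y `^ p y))%E by apply: I_ge0 => y _; exact: powR_ge0.
have [X' XE] : exists X', X = X'%:E by exists (fine X); rewrite (fineK Xfin).
have -> : fine X = X' by rewrite XE.
have X0 : 0 < X'.
  rewrite -lte_fin -XE.
  by apply: le_lt_trans badv; apply: mule_ge0 => //; rewrite lee_fin ltW.
have Yfin : I D (fun y => v y `^ p y) \is a fin_num.
  rewrite ge0_fin_numE//.
  move: badv; rewrite XE; case: (I D (fun y => v y `^ p y)) => //.
  - by move=> r; rewrite ltry.
  - by rewrite gt0_muley ?lte_fin.
have [Y' YE] : exists Y', I D (fun y => v y `^ p y) = Y'%:E.
  by exists (fine (I D (fun y => v y `^ p y))); rewrite (fineK Yfin).
have Y'0 : 0 <= Y' by rewrite -lee_fin -YE.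
have XY : bad_const * Y' < X'.
  by move: badv; rewrite YE XE -EFinM lte_fin.
have mtp := measurable_cst_powR tau mp.
have mttp := measurable_cst_powR t mp.
have msetle (g h : T -> R) : measurable_fun setT g -> measurable_fun setT h ->
    measurable [set y | g y <= h y].
  move=> mg mh.
  have := @measurable_fun_ler _ _ R setT g h mg mh measurableT [set true] Logic.I.
  by rewrite setTI; congr measurable; apply/seteqP; split => y.
pose A := D `&` [set y | X' / 2 <= tau `^ p y].
pose B := D `&` [set y | tau `^ p y <= 2 * Y'].
have mA : measurable A by apply: measurableI => //; exact: msetle.
have mB : measurable B by apply: measurableI => //; exact: msetle.
(* Otherwise [damped_norm_lower] with a = 48 ca / tau would give 48 <= 24. *)
have vbig : (1 < I D (fun y => ((tau^-1 * v y) `^ p y)%R))%E.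
  rewrite ltNge; apply/negP => h.
  have a0 : 0 < tau^-1 * (48 * ca).
    by rewrite mulr_gt0 ?invr_gt0//; have := ca1; lra.
  have := hv _ a0.
  rewrite (@I_eq _ _ _ _ _ _ (fun y => (tau^-1 * v y) `^ p y)).
    move=> /(_ h); rewrite /tau invf_div.
    have -> : t / l * (48 * ca) * l = 48 * ca * t by field; rewrite gt_eqF.
    have := mulr_gt0 (lt_le_trans ltr01 ca1) t0; lra.
  by move=> y _; congr (_ `^ _); rewrite /v /test_part; ring.
have vtau y : v y `^ p y = tau `^ p y * (tau^-1 * v y) `^ p y.
  rewrite -powRM ?(ltW tau0)//; last by rewrite mulr_ge0// invr_ge0 ltW.
  by rewrite mulrA mulfV ?mul1r// gt_eqF.
have mtv : measurable_fun setT (fun y => (tau^-1 * v y) `^ p y).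
  by apply: measurable_powR2 => //; exact: measurable_funM.
have nullsplit (N : set T) (g : T -> R) : measurable N -> N `<=` D -> mu N = 0%E ->
    measurable_fun setT g -> (forall y, 0 <= g y) -> I D g = I (D `\` N) g.
  move=> mN ND N0 mg g0.
  have e : D = (D `\` N) `|` N.
    apply/seteqP; split => y; last by move=> [[]//|/ND].
    by move=> Dy; have [Ny|nN] := pselect (N y); [right|left].
  by rewrite {1}e I_null//; exact: measurableD.
(* If [A] were null, l^p = tau^p t^p would be below (X' / 2) t^p almost everywhere, and the modular
   [X] would be at most half of itself. *)
have A0 : (0 < mu A)%E.
  rewrite lt_def measure_ge0 andbT; apply/eqP => A0.
  have : (X <= (X' / 2)%:E)%E.
    rewrite (nullsplit A _ mA (@subIsetl _ _ _) A0 (measurable_cst_powR l mp)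
      (fun y => powR_ge0 _ _)).
    apply: (@le_trans _ _ (I (D `\` A) (fun y => X' / 2 * t `^ p y))).
      apply: I_le.
      - exact: measurableD.
      - exact: measurable_cst_powR.
      - exact: measurable_funM.
      move=> y [Dy nA]; rewrite powR_ge0/=.
      have -> : l `^ p y = tau `^ p y * t `^ p y.
        by rewrite -powRM ?(ltW t0) ?(ltW tau0)// divfK// gt_eqF.
      rewrite ler_wpM2r ?powR_ge0//; rewrite leNgt; apply/negP => h; apply: nA.
      by split => //=; exact: ltW.
    rewrite I_scale; [|exact: measurableD|exact: mttp|by rewrite divr_ge0// ltW|by move=> y _; exact: powR_ge0].
    have h1 : (I (D `\` A) (fun y => t `^ p y) <= 1)%E.
      apply: le_trans ht; apply: I_subset.
      - exact: measurableD.
      - exact: mD.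
      - exact: mttp.
      - by move=> y _; exact: powR_ge0.
      - exact: subDsetl.
    apply: le_trans (lee_wpmul2l _ h1) _; last by rewrite mule1.
    by rewrite lee_fin divr_ge0// ltW.
  by rewrite XE lee_fin; lra.
have Y0 : 0 < Y'.
  rewrite lt_def Y'0 andbT; apply/eqP => Y0.
  have : (I D (fun y => ((tau^-1 * v y) `^ p y)%R) <=
     I D (fun y => tau^-1 `^ pP * v y `^ p y))%E.
    apply: I_le.
    - exact: mD.
    - exact: mtv.
    - exact: measurable_funM.
    - move=> y _; rewrite powR_ge0/= powRM ?invr_ge0 ?(ltW tau0)//.
      rewrite ler_wpM2r ?powR_ge0// ler_powR//.
        by rewrite invf_ge1// ltW.
      by have /andP[] := ppP y.
  rewrite I_scale; [|exact: mD|exact: mvp|exact: powR_ge0|by move=> y _; exact: powR_ge0].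
  rewrite YE Y0 mule0 => h; have := lt_le_trans vbig h.
  by rewrite ltNge lee_fin ler01.
(* If [B] were null, v^p would exceed 2 Y' (v / tau)^p almost everywhere, so its integral [Y'] would
   be at least 2 Y'. *)
have B0 : (0 < mu B)%E.
  rewrite lt_def measure_ge0 andbT; apply/eqP => B0.
  have : ((2 * Y')%:E <= Y'%:E)%E.
    rewrite -YE (nullsplit B _ mB (@subIsetl _ _ _) B0 mvp (fun y => powR_ge0 _ _)).
    apply: (@le_trans _ _ (I (D `\` B) (fun y => 2 * Y' * (tau^-1 * v y) `^ p y))).
      rewrite I_scale; [|exact: measurableD|exact: mtv|by rewrite mulr_ge0|by move=> y _; exact: powR_ge0].
      rewrite -[leLHS]mule1; apply: lee_wpmul2l; first by rewrite lee_fin mulr_ge0.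
      rewrite -(nullsplit B _ mB (@subIsetl _ _ _) B0 mtv (fun y => powR_ge0 _ _)).
      exact: ltW.
    apply: I_le.
    - exact: measurableD.
    - exact: measurable_funM.
    - exact: mvp.
    - move=> y [Dy nB]; rewrite mulr_ge0 ?mulr_ge0 ?powR_ge0//= vtau ler_wpM2r ?powR_ge0//.
      by rewrite leNgt; apply/negP => h; apply: nB; split => //=; exact: ltW.
  by rewrite lee_fin; lra.
have half0 : 0 <= 2^-1 :> R by rewrite invr_ge0.
have sq y : (tau `^ 2^-1) `^ p y = (tau `^ p y) `^ 2^-1.
  by rewrite -!powRrM mulrC.
(* The square root of tau in place of tau keeps a factor X^(1/2) in reserve for the summation over
   the levels. *)
exists (tau `^ 2^-1), A, B; split => //; first exact: powR_gt0.
  by split; exact: subIsetl.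
move=> y; split => [[_ /= h]|[_ /= h]]; rewrite sq.
  by apply: ge0_ler_powR; rewrite ?nnegrE ?powR_ge0// divr_ge0// ltW.
apply: (@le_trans _ _ ((4 * bad_const^-1 * (X' / 2)) `^ 2^-1)).
  apply: ge0_ler_powR; rewrite ?nnegrE ?powR_ge0//.
    by rewrite mulr_ge0 ?mulr_ge0 ?invr_ge0 ?divr_ge0 ?(ltW bc0) ?(ltW X0).
  apply: le_trans h _.
  have -> : 4 * bad_const^-1 * (X' / 2) = 2 * (X' / bad_const) by field; rewrite gt_eqF.
  by rewrite ler_pM2l// ler_pdivlMr// mulrC ltW.
rewrite !powRM ?invr_ge0 ?(ltW bc0)//; last 2 first.
- by rewrite mulr_ge0// invr_ge0 ltW.
- by rewrite divr_ge0// ltW.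
rewrite le_eqVlt; apply/orP; left; apply/eqP; congr (_ * _ * _).
  rewrite powR12_sqrt//.
  have -> : (4 : R) = 2 ^+ 2 by ring.
  by rewrite sqrtr_sqr ger0_norm.
  by rewrite powRV// ltW.
exact: ltW.
Qed.

End OneBadCell.
End BadCells.

(** * Level sets *)

Section LevelSets.
Context {R : realType} {d} {T : measurableType d}.
Variables (mu : {measure set T -> \bar R}) (cn : R).
Implicit Types (A B : set T) (F g : T -> R).
Local Notation I A F := (\int[mu]_(x in A) (F x)%:E)%E.
Variables (p : T -> R) (pm pP : R).
Hypothesis mp : measurable_fun setT p.
Hypothesis pm1 : 1 < pm.
Hypothesis ppP : forall x, pm <= p x <= pP.

Let p1 y : 1 < p y. Proof. exact: exponent_gt1 ppP y. Qed.

Lemma sum_only (N j : nat) (b : nat -> R) : (forall i, i != j -> b i = 0) ->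
  \sum_(i < N) b i = if (j < N)%N then b j else 0.
Proof.
move=> h; elim: N => [|N IH]; first by rewrite big_ord0.
rewrite big_ord_recr/= IH ltnS.
have [->|Nj] := eqVneq N j; first by rewrite ltnn leqnn add0r.
rewrite (h N Nj) addr0.
by have -> : (j <= N)%N = (j < N)%N by rewrite [LHS]leq_eqVlt eq_sym (negbTE Nj).
Qed.

(* [A] with the weight for which [bump A 1] has modular one. *)
Definition bump A (al : R) y : R := al * (fine (mu A))^-1 `^ (p y)^-1 * \1_A y.

Lemma measurable_bump A al : measurable A -> measurable_fun setT (bump A al).
Proof.
move=> mA; apply: measurable_funM; last exact: measurable_indic.
apply: measurable_funM => //; apply: measurable_cst_powR.
have -> : (fun y => (p y)^-1) = (fun y => p y `^ (-1)).
  by apply/funext => y; rewrite powR_inv1//; have := p1 y; lra.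
exact: measurable_powRc.
Qed.

Lemma bump_ge0 A al y : 0 <= al -> 0 <= bump A al y.
Proof. by move=> a0; rewrite !mulr_ge0 ?powR_ge0// indicE. Qed.

Lemma bump_out A al y : ~ A y -> bump A al y = 0.
Proof. by move=> nA; rewrite /bump indicE memNset// mulr0. Qed.

Lemma bump_powR A al c y : (0 < mu A < +oo)%E -> 0 <= al -> 0 <= c ->
  (c * bump A al y) `^ p y = (fine (mu A))^-1 * ((c * al) `^ p y * \1_A y).
Proof.
move=> A0 al0 c0; have fA : 0 < fine (mu A) by exact: fine_gt0.
have p0 := p1 y; rewrite /bump indicE; case: (y \in A) => /=; last first.
  by rewrite !mulr0 powR0//; apply/eqP; lra.
rewrite !mulr1 mulrA powRM ?powR_ge0 ?mulr_ge0// -powRrM mulVf; last by apply/eqP; lra.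
by rewrite powRr1 1?mulrC// invr_ge0 ltW.
Qed.

Lemma I_bump D A al c : measurable A -> A `<=` D -> (0 < mu A < +oo)%E ->
  0 <= al -> 0 <= c ->
  I D (fun y => (c * bump A al y) `^ p y)
  = ((fine (mu A))^-1%:E * I A (fun y => ((c * al) `^ p y)%R))%E.
Proof.
move=> mA AD A0 al0 c0; have fA : 0 < fine (mu A) by exact: fine_gt0.
rewrite (@I_eq _ _ _ _ _ _ (fun y => ((fine (mu A))^-1 * (c * al) `^ p y) * \1_A y)); last first.
  by move=> y _; rewrite bump_powR// mulrA.
rewrite I_indic setIidr// I_scale//; last by move=> y _; exact: powR_ge0.
exact: measurable_cst_powR.
Qed.

Lemma mean_ge A (c : R) g : measurable A -> (0 < mu A < +oo)%E ->
  measurable_fun setT g -> 0 <= c -> (forall y, A y -> c <= g y) ->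
  (c%:E <= (fine (mu A))^-1%:E * I A g)%E.
Proof.
move=> mA A0 mg c0 cg; have fA : 0 < fine (mu A) by exact: fine_gt0.
have Afin : mu A \is a fin_num by move: A0 => /andP[? ?]; rewrite ge0_fin_numE.
have h : (c%:E * mu A <= I A g)%E.
  by rewrite -I_cst//; apply: I_le => // y Ay; rewrite c0 cg.
apply: le_trans (lee_wpmul2l _ h); last by rewrite lee_fin invr_ge0 ltW.
rewrite -(fineK Afin) -!EFinM lee_fin.
by rewrite [leRHS](_ : _ = c)//; field; rewrite gt_eqF.
Qed.

Lemma mean_le A (c : R) g : measurable A -> (0 < mu A < +oo)%E ->
  measurable_fun setT g -> (forall y, A y -> 0 <= g y <= c) ->
  ((fine (mu A))^-1%:E * I A g <= c%:E)%E.
Proof.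
move=> mA A0 mg gc; have fA : 0 < fine (mu A) by exact: fine_gt0.
have Afin : mu A \is a fin_num by move: A0 => /andP[? ?]; rewrite ge0_fin_numE.
have h : (I A g <= c%:E * mu A)%E by rewrite -I_cst//; exact: I_le.
apply: le_trans (lee_wpmul2l _ h) _; first by rewrite lee_fin invr_ge0 ltW.
rewrite -(fineK Afin) -!EFinM lee_fin.
by rewrite [leLHS](_ : _ = c)//; field; rewrite gt_eqF.
Qed.

(* Both modulars are means of [(a * al) `^ p], over [A] and over [B], so each is
   at most one exactly when [a * al <= 1]. *)
Lemma bump_transfer D A B al a : measurable A -> measurable B ->
  A `<=` D -> B `<=` D -> (0 < mu A < +oo)%E -> (0 < mu B < +oo)%E ->
  0 < al -> 0 < a ->
  (I D (fun y => ((a * bump B al y) `^ p y)%R) <= 1)%E ->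
  (I D (fun y => ((a * bump A al y) `^ p y)%R) <= 1)%E.
Proof.
move=> mA mB AD BD A0 B0 al0 a0.
rewrite !I_bump ?(ltW al0) ?(ltW a0)// => h.
have aal0 : 0 <= a * al by rewrite mulr_ge0// ltW.
have mc := measurable_cst_powR (a * al) mp.
have h1 : a * al <= 1.
  rewrite leNgt; apply/negP => lt1.
  have := mean_ge mB B0 mc aal0.
  move=> /(_ _)/le_trans/(_ h); rewrite lee_fin leNgt lt1 => hh.
  suff : false by []; apply: hh => y _.
  by apply: self_le_powR; [exact: ltW|exact/ltW/p1].
apply: mean_le => // y _; rewrite powR_ge0/=.
by apply: powR_le1; [rewrite aal0|have := p1 y; lra].
Qed.

Variables (ca C0 : R).
Hypothesis ca1 : 1 <= ca.
Hypothesis C01 : 1 <= C0.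
Hypothesis cn1 : 1 <= cn.
Variable f : filtration mu cn.
Hypothesis HA : Ap_cells p ca f.
Hypothesis Hst : stopped_estimate p C0 f.
Local Notation cl := (cell f).
Local Notation m := (cell_size f).
Variables (F : T -> R).
Hypothesis mF : measurable_fun setT F.
Hypothesis F0 : forall y, 0 <= F y.
Hypothesis hF : (I setT (fun x => ((2 * ca * F x) `^ p x)%R) <= 1)%E.

Local Notation kap := (kappa cn pm pP ca C0).
Local Notation bc := (bad_const pP ca C0).
Local Notation sc := (star_const pP C0).
Local Notation v l := (test_part cn pm pP ca C0 F l).

Variables (K : nat) (l : R).
Hypothesis l0 : 0 < l.

Definition level_cell k : set T := [set x | l < average f F k x <= 2 * l].
Definition bad_cell k : set T :=
  [set x | (bc%:E * I (cl k x) (fun y => v l y `^ p y) < I (cl k x) (fun y => l `^ p y))%E].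
Definition level_bad k := level_cell k `&` bad_cell k.
Definition level_good k := level_cell k `\` bad_cell k.

Lemma level_bad_inv : cell_invariant f level_bad.
Proof.
move=> k x y xy []; rewrite /level_cell /bad_cell /= => h1 h2.
by split; rewrite /level_cell /bad_cell /= ?(average_cell F xy) ?(cell_eq xy).
Qed.

Lemma level_good_inv : cell_invariant f level_good.
Proof.
move=> k x y xy []; rewrite /level_cell /bad_cell /= => h1 h2.
by split; rewrite /level_cell /bad_cell /= ?(average_cell F xy) ?(cell_eq xy).
Qed.

Let mv : measurable_fun setT (v l). Proof. exact: measurable_test_part. Qed.
Let v0 y : 0 <= v l y. Proof. exact: test_part_ge0. Qed.
Let mvp : measurable_fun setT (fun y => v l y `^ p y).
Proof. exact: measurable_powR2. Qed.

Let bc0 : 0 < bc.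
Proof.
have ca2 : 1 <= ca ^+ 2 by rewrite exprn_ege1.
by rewrite /bad_const ltr_wpDl ?sqr_ge0// /gain_const mulr_gt0 ?powR_gt0//; lra.
Qed.

Lemma level_good_le : (I (reached K level_good) (fun y => l `^ p y)
  <= bc%:E * I setT (fun y => v l y `^ p y))%E.
Proof.
have mO := measurable_reached K level_good_inv.
apply: (@le_trans _ _ (I (reached K level_good) (fun y => bc * v l y `^ p y))).
  apply: (reached_integral_le level_good_inv).
  - exact: measurable_cst_powR.
  - exact: measurable_funM.
  - by move=> y; exact: powR_ge0.
  - by move=> y; rewrite mulr_ge0 ?powR_ge0// ltW.
  move=> x /stop_reached [_ /negP]; rewrite -leNgt => h.
  rewrite I_scale; [exact: h|exact: measurable_cell|exact: mvp|exact: ltW|].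
  by move=> y _; exact: powR_ge0.
rewrite I_scale; [|exact: mO|exact: mvp|exact: ltW|by move=> y _; exact: powR_ge0].
apply: lee_wpmul2l; first by rewrite lee_fin ltW.
by apply: I_subset => // y _; exact: powR_ge0.
Qed.

Local Notation Om := (reached K level_bad).
Local Notation sg := (stop K level_bad).
Local Notation piece := (stop_piece f K level_bad).

Lemma level_bad_lt1 x : Om x -> l < 1.
Proof.
move=> /stop_reached [h1 h2].
exact: (bad_cell_lt1 mp pm1 ppP ca1 C01 cn1 HA Hst mF F0 hF l0 h1 h2).
Qed.

Let X i := fine (I (piece i) (fun y => l `^ p y)).
Let xi i := (X i / 2) `^ 2^-1.

Lemma piece_integral_le i : (I (piece i) (fun y => l `^ p y) <= (l `^ kap)%:E)%E.
Proof.
have [->|[x [Ox _ ->]]] := stop_piece_0cell K level_bad_inv i.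
  by rewrite integral_set0 lee_fin powR_ge0.
have [h1 h2] := stop_reached Ox.
exact: (bad_cell_le mp pm1 ppP ca1 C01 cn1 HA Hst mF F0 hF l0 h1 h2).
Qed.

Lemma piece_integralE i : I (piece i) (fun y => l `^ p y) = (X i)%:E.
Proof.
rewrite /X fineK// ge0_fin_numE; first exact: le_lt_trans (piece_integral_le i) (ltry _).
by apply: I_ge0 => y _; exact: powR_ge0.
Qed.

Let X_ge0 i : 0 <= X i.
Proof. by rewrite /X fine_ge0//; apply: I_ge0 => y _; exact: powR_ge0. Qed.

Let X_le i : X i <= l `^ kap.
Proof. by rewrite -lee_fin -piece_integralE piece_integral_le. Qed.

Let X_empty i : piece i = set0 -> X i = 0.
Proof. by rewrite /X => ->; rewrite integral_set0. Qed.

Let test_data i (w : R * (set T * set T)) := piece i !=set0 ->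
  [/\ 0 < w.1,
      [/\ measurable w.2.1, w.2.1 `<=` piece i & (0 < mu w.2.1 < +oo)%E],
      [/\ measurable w.2.2, w.2.2 `<=` piece i & (0 < mu w.2.2 < +oo)%E] &
   forall y, (w.2.1 y -> xi i <= w.1 `^ p y) /\
     (w.2.2 y -> w.1 `^ p y <= 2 * (bc `^ 2^-1)^-1 * xi i)].

Lemma bad_pieces_test : exists w, forall i, test_data i (w i).
Proof.
suff /choice[w hw] : forall i, exists w, test_data i w by exists w.
move=> i.
have [e|[x [Ox _ e]]] := stop_piece_0cell K level_bad_inv i.
  by exists (1, (set0, set0)) => ne; exfalso; move: ne; rewrite e => -[].
have [h1 h2] := stop_reached Ox.
have [al [A [B]]] := bad_cell_test mp pm1 ppP ca1 C01 cn1 HA Hst mF F0 hF l0 h1 h2.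
rewrite -e -/(X i) => -[al0 [mA mB] [AD BD] [A0 B0] hAB].
have fin E : measurable E -> E `<=` piece i -> (mu E < +oo)%E.
  move=> mE ED; apply: (@le_lt_trans _ _ (mu (cl (sg x) x))); last by rewrite mu_cell ltry.
  by rewrite le_measure ?inE//; [exact: measurable_cell|rewrite -e].
exists (al, (A, B)) => _ /=; split => //; split => //.
- by rewrite A0 fin.
- by rewrite B0 fin.
Qed.

(* Induction on the number of pieces: the estimate itself keeps the next partial
   sum below the threshold needed to apply it. *)
Lemma bad_pieces_sum N : \sum_(i < N) xi i <= sc.
Proof.
have [w hw] := bad_pieces_test.
pose al i := (w i).1; pose A i := (w i).2.1; pose B i := (w i).2.2.
have sc0 : 0 <= sc by exact: powR_ge0.
pose dl := 2 * (bc `^ 2^-1)^-1.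
have dl0 : 0 <= dl by rewrite mulr_ge0// invr_ge0 powR_ge0.
(* The square in [bad_const] serves here: the modular of the bumps on the sets [B i] stays at most
   one as long as the sum of the [xi i] does not exceed [sc + 1]. *)
have dlsc : dl * (sc + 1) <= 1.
  have h : 2 * (sc + 1) <= bc `^ 2^-1.
    rewrite powR12_sqrt ?(ltW bc0)// -[leLHS]ger0_norm; last by rewrite mulr_ge0// addr_ge0.
    rewrite -sqrtr_sqr ler_wsqrtr// /bad_const lerDl /gain_const.
    by rewrite mulr_ge0 ?powR_ge0// mulr_ge0// sqr_ge0.
  rewrite /dl mulrAC ler_pdivrMr ?powR_gt0// mul1r.
  exact: h.
have xi0 i : 0 <= xi i by exact: powR_ge0.
have xi_empty i : ~ (piece i !=set0) -> xi i = 0.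
  move=> h; rewrite /xi X_empty ?mul0r ?powR0 ?invr_eq0//.
  by apply/seteqP; split=> // y yi; apply: h; exists y.
have xi1 i : xi i <= 1.
  have [ne|/xi_empty ->] := pselect (piece i !=set0); last exact: ler01.
  have [y [Oy _]] := ne.
  apply: powR_le1; last by rewrite invr_ge0.
  rewrite divr_ge0 ?X_ge0//= ler_pdivrMr// mul1r (le_trans (X_le i))//.
  apply: (@le_trans _ _ 1); last by rewrite ler1n.
  apply: powR_le1; first by rewrite (ltW l0)/= ltW// (level_bad_lt1 Oy).
  have r0 := rh_exp_gt0 pm1 ppP ca1 C01 cn1 f y.
  have t0 : 0 < theta_gain cn pm pP ca C0 by rewrite /theta_gain lt_min ltr01 divr_gt0.
  rewrite /kappa; apply: divr_ge0; first exact: ltW.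
  by apply: addr_ge0 => //; exact: ltW.
pose b (E : nat -> set T) i y := if `[< piece i !=set0 >] then bump (E i) (al i) y else 0.
have bE E i y : piece i !=set0 -> b E i y = bump (E i) (al i) y.
  by move=> ne; rewrite /b asboolT.
have bN E i y : ~ (piece i !=set0) -> b E i y = 0.
  by move=> ne; rewrite /b asboolF.
have al0 i : piece i !=set0 -> 0 <= al i.
  by move=> /hw[h _ _ _]; exact: ltW.
have b0 E i y : 0 <= b E i y.
  rewrite /b; case: asboolP => // ne; apply: bump_ge0; exact: al0.
have mb E i : (piece i !=set0 -> measurable (E i)) -> measurable_fun setT (b E i).
  move=> h; have [ne|ne] := pselect (piece i !=set0).
    rewrite (_ : b E i = bump (E i) (al i)); first exact/measurable_bump/h.
    by apply/funext => y; exact: bE.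
  rewrite (_ : b E i = cst 0); first exact: measurable_cst.
  by apply/funext => y; exact: bN.
have bout E i y : (piece i !=set0 -> E i `<=` piece i) -> ~ piece i y -> b E i y = 0.
  move=> h ny; rewrite /b; case: asboolP => // ne; apply: bump_out => yE.
  by apply: ny; exact: h.
have sumE E n y j : (forall i, piece i !=set0 -> E i `<=` piece i) ->
    (forall i, i != j -> ~ piece i y) ->
    \sum_(i < n) b E i y = if (j < n)%N then b E j y else 0.
  move=> h ny; apply: (@sum_only n j (fun i => b E i y)) => i ij.
  by apply: bout; [exact: h|exact: ny].
have sumP E n y : (forall i, piece i !=set0 -> E i `<=` piece i) ->
    (\sum_(i < n) b E i y) `^ p y = \sum_(i < n) b E i y `^ p y.
  move=> h.
  have hz : 0 `^ p y = 0 by rewrite powR0//; have := p1 y => ?; apply/eqP; lra.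
  have [[j yj]|ny] := pselect (exists j, piece j y).
    have nyi i : i != j -> ~ piece i y.
      move=> ij yi; move: ij; apply/negP; rewrite negbK; apply/eqP.
      by move: yi yj => [_ /= <-] [_ /= <-].
    rewrite (sumE _ _ _ j)//.
    rewrite (@sum_only n j (fun i => b E i y `^ p y)); first by case: ifP.
    by move=> i /nyi ni; rewrite bout//; exact: h.
  rewrite big1 => [|i _]; last by apply: bout; [exact: h|move=> yi; apply: ny; exists i].
  rewrite hz big1// => i _; rewrite bout//; first exact: h.
  by move=> yi; apply: ny; exists i.
have hA i : piece i !=set0 -> A i `<=` piece i by move=> /hw[_ []].
have hB i : piece i !=set0 -> B i `<=` piece i by move=> /hw[_ _ []].
have mA i : piece i !=set0 -> measurable (A i) by move=> /hw[_ []].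
have mB i : piece i !=set0 -> measurable (B i) by move=> /hw[_ _ []].
have mbA i : measurable_fun setT (b A i) by apply: mb; exact: mA.
have mbB i : measurable_fun setT (b B i) by apply: mb; exact: mB.
have Ipow E i : piece i !=set0 -> measurable (E i) -> (0 < mu (E i) < +oo)%E ->
    I setT (fun y => b E i y `^ p y) =
      ((fine (mu (E i)))^-1%:E * I (E i) (fun y => (al i `^ p y)%R))%E.
  move=> ne mE E0.
  transitivity (I setT (fun y => (1 * bump (E i) (al i) y) `^ p y)).
    by apply: I_eq => y _; rewrite bE// mul1r.
  by rewrite I_bump ?mul1r//; exact: al0.
have lowA i : ((xi i)%:E <= I setT (fun y => b A i y `^ p y))%E.
  have [ne|ne] := pselect (piece i !=set0); last first.
    by rewrite xi_empty//; apply: I_ge0 => y _; exact: powR_ge0.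
  have [_ [? ? muA] _ h] := hw _ ne.
  rewrite Ipow//; apply: mean_ge => //; first exact: measurable_cst_powR.
  by move=> y Ay; have [h1 _] := h y; exact: h1.
have upB i : (I setT (fun y => b B i y `^ p y) <= (dl * xi i)%:E)%E.
  have [ne|ne] := pselect (piece i !=set0); last first.
    rewrite (@I_eq _ _ _ _ _ _ (fun=> 0)); last first.
      by move=> y _; rewrite bN// powR0//; have := p1 y => ?; apply/eqP; lra.
    by rewrite I_cst// mul0e lee_fin mulr_ge0.
  have [_ _ [? ? muB] h] := hw _ ne.
  rewrite Ipow//; apply: mean_le => //; first exact: measurable_cst_powR.
  by move=> y By; have [_ h1] := h y; rewrite powR_ge0 /=; exact: h1.
have finA i : (I setT (fun y => b A i y `^ p y) < +oo)%E.
  have [ne|ne] := pselect (piece i !=set0); last first.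
    rewrite (@I_eq _ _ _ _ _ _ (fun=> 0)); last first.
      by move=> y _; rewrite bN// powR0//; have := p1 y => ?; apply/eqP; lra.
    by rewrite I_cst// mul0e ltry.
  have [_ [? ? muA] _ h] := hw _ ne.
  rewrite Ipow//; apply: (@le_lt_trans _ _ (1 + al i `^ pP)%:E); last exact: ltry.
  apply: mean_le => //; first exact: measurable_cst_powR.
  move=> y _; rewrite powR_ge0/=; apply: powR_le_1D; first exact: al0.
    by have := p1 y; lra.
  by have /andP[] := ppP y.
elim: N => [|N IH]; first by rewrite big_ord0.
(* On each piece the two bumps have the same norm [al i], but the modular is at least [xi i] for the
   one on [A i] and at most [dl * xi i] for the one on [B i]. *)
pose u y := \sum_(i < N.+1) b A i y; pose vv y := \sum_(i < N.+1) b B i y.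
have mu_ : measurable_fun setT u by apply: measurable_sum.
have mvv : measurable_fun setT vv by apply: measurable_sum.
have u0 y : 0 <= u y by apply: sumr_ge0 => i _; exact: b0.
have vv0 y : 0 <= vv y by apply: sumr_ge0 => i _; exact: b0.
have IE E : (forall i, measurable_fun setT (b E i)) ->
   (forall i, piece i !=set0 -> E i `<=` piece i) ->
   I setT (fun y => (\sum_(i < N.+1) b E i y) `^ p y) =
   (\sum_(i < N.+1) I setT (fun y => (b E i y `^ p y)%R))%E.
  move=> mE hE; rewrite -I_sum//; first by apply: I_eq => y _; rewrite sumP.
  - by move=> i; apply: measurable_powR2.
  - by move=> i y _; exact: powR_ge0.
have Iv1 : (I setT (fun y => vv y `^ p y) <= 1)%E.
  rewrite IE//; apply: (@le_trans _ _ (\sum_(i < N.+1) (dl * xi i)%:E)%E).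
    by apply: lee_sum => i _; exact: upB.
  rewrite sumEFin lee_fin -mulr_sumr (le_trans _ dlsc)// ler_wpM2l//.
  by rewrite big_ord_recr/=; apply: lerD; [exact: IH|exact: xi1].
have Iu : (I setT (fun y => u y `^ p y) < +oo)%E.
  by rewrite IE//; apply: lte_sum_pinfty => i _; exact: finA.
have key := Hst (K := K) level_bad_inv mu_ mvv u0 vv0 Iu (le_lt_trans Iv1 (ltry _)).
have {key} h1 : (I setT (fun x => (u x / C0) `^ p x) <= 1)%E.
  apply: key; last exact: Iv1.
  move=> x a a0.
  have z0 g : (forall y, cl (sg x) x y -> g y = 0) ->
      I (cl (sg x) x) (fun y => (a * g y) `^ p y) = 0%E.
    move=> g0; rewrite (@I_eq _ _ _ _ _ _ (fun=> 0)); last first.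
      move=> y /g0 ->; rewrite mulr0 powR0//; have := p1 y => ?; apply/eqP; lra.
    by rewrite I_cst ?mul0e//; exact: measurable_cell.
  have [Ox|nO] := pselect (Om x); last first.
    rewrite [X in _ -> (X <= _)%E]z0// => y xy.
    rewrite /u big1// => i _; apply: bout; first exact: hA.
    by move=> [Oy _]; exact: (notreached_cell level_bad_inv nO xy).
  have eD := stop_piece_cell level_bad_inv Ox.
  set j := stop_code f K level_bad x in eD.
  have only y i : cl (sg x) x y -> i != j -> ~ piece i y.
    rewrite -eD => -[_ /= <-] ij [_ /= e].
    by move: ij; rewrite -e eqxx.
  have ne : piece j !=set0 by rewrite eD; exists x.
  have uE y : cl (sg x) x y -> u y = if (j < N.+1)%N then bump (A j) (al j) y else 0.
    by move=> xy; rewrite /u (sumE _ _ _ j)// ?bE// => i; exact: only.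
  have vE y : cl (sg x) x y -> vv y = if (j < N.+1)%N then bump (B j) (al j) y else 0.
    by move=> xy; rewrite /vv (sumE _ _ _ j)// ?bE// => i; exact: only.
  case: (ltnP j N.+1) => jN; last first.
    by rewrite [X in _ -> (X <= _)%E]z0// => y /uE; rewrite ltnNge jN.
  have [alj [? Aj muA] [? Bj muB] _] := hw _ ne.
  rewrite (@I_eq _ _ _ _ _ _ (fun y => (a * bump (B j) (al j) y) `^ p y)); last first.
    by move=> y /vE ->; rewrite jN.
  rewrite [X in _ -> (X <= _)%E](@I_eq _ _ _ _ _ _ (fun y => (a * bump (A j) (al j) y) `^ p y)); last first.
    by move=> y /uE ->; rewrite jN.
  by apply: bump_transfer => //; rewrite -eD.
have h2 : (I setT (fun y => u y `^ p y) <= sc%:E)%E.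
  apply: (@le_trans _ _ (I setT (fun y => sc * (u y / C0) `^ p y))).
    have C00 : 0 < C0 by have := C01; lra.
    have muC : measurable_fun setT (fun y => (u y / C0) `^ p y).
      by apply: measurable_powR2 => //; exact: measurable_funM.
    apply: I_le => //; first exact: measurable_powR2.
      exact: measurable_funM.
    move=> y _; rewrite powR_ge0/=.
    have -> : u y `^ p y = C0 `^ p y * (u y / C0) `^ p y.
      by rewrite -powRM ?divr_ge0 ?(ltW C00)//; congr (_ `^ _); field; rewrite gt_eqF.
    by rewrite ler_wpM2r ?powR_ge0// /star_const ler_powR//; have /andP[] := ppP y.
  rewrite I_scale//; last by move=> y _; exact: powR_ge0.
    by apply: le_trans (lee_wpmul2l _ h1) _; rewrite ?mule1 ?lee_fin.
  by apply: measurable_powR2 => //; exact: measurable_funM.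
rewrite -lee_fin; apply: le_trans h2; rewrite IE// -sumEFin.
by apply: lee_sum => i _; exact: lowA.
Qed.

(** X i is 2 xi^2; one factor [xi i] is at most l^(kap / 2), and the other is summed by
    [bad_pieces_sum]. *)
Lemma level_bad_le : (I Om (fun y => l `^ p y) <= (2 * sc * l `^ (kap / 2))%:E)%E.
Proof.
rewrite -(bigcup_stop_piece f K level_bad) I_bigcup//; first last.
- by move=> y; exact: powR_ge0.
- exact: measurable_cst_powR.
- exact: trivIset_stop_piece.
- exact: (measurable_stop_piece K level_bad_inv).
apply: lime_le.
  by apply: is_cvg_nneseries => i _ _; apply: I_ge0 => y _; exact: powR_ge0.
apply: nearW => N.
rewrite big_mkord (eq_bigr (fun i : 'I_N => (X i)%:E)); last first.
  by move=> i _; exact: piece_integralE.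
rewrite sumEFin lee_fin.
have hX i : X i <= 2 * l `^ (kap / 2) * xi i.
  have -> : X i = 2 * (xi i * xi i).
    rewrite /xi -powRD; last by apply/implyP => /eqP ?; lra.
    have -> : 2^-1 + 2^-1 = 1 :> R by lra.
    by rewrite powRr1 ?divr_ge0//; field.
  rewrite -mulrA ler_pM2l// ler_wpM2r ?powR_ge0//.
  rewrite powRrM; apply: ge0_ler_powR; rewrite ?nnegrE ?invr_ge0 ?powR_ge0 ?divr_ge0//.
  rewrite ler_pdivrMr// (le_trans (X_le i))// ler_peMr ?powR_ge0//.
  by rewrite ler1n.
apply: (@le_trans _ _ (\sum_(i < N) 2 * l `^ (kap / 2) * xi i)).
  by apply: ler_sum => i _; exact: hX.
rewrite -mulr_sumr [leRHS]mulrAC; apply: ler_wpM2l; last exact: bad_pieces_sum.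
by rewrite mulr_ge0 ?powR_ge0.
Qed.

End LevelSets.

(** * The dyadic maximal function *)

Section GeometricLevels.
Context {R : realType}.
Implicit Types (e y : R).

(** Starting at 2^-N lets natural indices reach arbitrarily small levels. *)
Definition level N j : R := 2 ^+ j / 2 ^+ N.

Lemma level_gt0 N j : 0 < level N j.
Proof. by rewrite divr_gt0// exprn_gt0. Qed.

Lemma levelS N j : level N j.+1 = 2 * level N j.
Proof. by rewrite /level exprS mulrA. Qed.

Definition geo_const e : R := (2 `^ e - 1)^-1.

Lemma geo_den e : 0 < e -> 0 < 2 `^ e - 1.
Proof.
move=> e0; rewrite subr_gt0.
have := @gt0_ltr_powR R e e0 1 2; rewrite !nnegrE powR1; apply => //; lra.
Qed.

Lemma level_sum N J e y : 0 < e -> 0 < y ->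
  \sum_(j < J) (level N j / y) `^ e <= geo_const e * (level N J / y) `^ e.
Proof.
move=> e0 y0; have D0 := geo_den e0.
elim: J => [|J IH].
  by rewrite big_ord0 mulr_ge0 ?powR_ge0// invr_ge0 ltW.
rewrite big_ord_recr/= levelS.
have -> : 2 * level N J / y = 2 * (level N J / y) by rewrite mulrA.
have ly : 0 <= level N J / y by rewrite divr_ge0// ltW// level_gt0.
rewrite (powRM e _ ly)//; move: IH.
set a := (level N J / y) `^ e; set b := 2 `^ e in D0 *.
rewrite /geo_const -/b => IH.
have -> : (b - 1)^-1 * (b * a) = (b - 1)^-1 * a + a.
  by field; rewrite gt_eqF.
by rewrite lerD2r.
Qed.

(** The last level kept is below [2 * y], so the one after it is below [4 * y], and it controls the
    geometric sum. *)
Lemma level_sum_below N J e y : 0 < e -> 0 < y ->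
  \sum_(j < J) (if level N j / 2 < y then (level N j / y) `^ e else 0)
    <= geo_const e * 4 `^ e.
Proof.
move=> e0 y0; have D0 := geo_den e0.
have g0 : 0 <= geo_const e by rewrite invr_ge0 ltW.
elim: J => [|J IH]; first by rewrite big_ord0 mulr_ge0 ?powR_ge0.
rewrite big_ord_recr/=; case: ifP => [lt|_]; last by rewrite addr0.
have l0 j : 0 <= level N j / y by rewrite divr_ge0// ltW// level_gt0.
apply: (@le_trans _ _ (\sum_(j < J.+1) (level N j / y) `^ e)).
  rewrite [leRHS]big_ord_recr/= lerD2r; apply: ler_sum => j _.
  by case: ifP => // _; exact: powR_ge0.
apply: le_trans (level_sum N J.+1 e0 y0) _; rewrite ler_wpM2l//.
apply: ge0_ler_powR; rewrite ?nnegrE//; first exact: ltW.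
by rewrite levelS ler_pdivrMr//; lra.
Qed.

End GeometricLevels.

Section DyadicMaximal.
Context {R : realType} {d} {T : measurableType d}.
Variables (mu : {measure set T -> \bar R}) (cn : R).
Implicit Types (A B : set T) (F g : T -> R).
Local Notation I A F := (\int[mu]_(x in A) (F x)%:E)%E.
Variables (p : T -> R) (pm pP : R).
Hypothesis mp : measurable_fun setT p.
Hypothesis pm1 : 1 < pm.
Hypothesis ppP : forall x, pm <= p x <= pP.
Variables (ca C0 : R).
Hypothesis ca1 : 1 <= ca.
Hypothesis C01 : 1 <= C0.
Hypothesis cn1 : 1 <= cn.
Variable f : filtration mu cn.
Hypothesis HA : Ap_cells p ca f.
Hypothesis Hst : stopped_estimate p C0 f.
Local Notation cl := (cell f).
Local Notation m := (cell_size f).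

Let p1 y : 1 < p y. Proof. exact: exponent_gt1 ppP y. Qed.

Fixpoint dyadic_max K F x : R :=
  if K is K'.+1 then Num.max (dyadic_max K' F x) (average f F K x)
  else average f F 0 x.

Lemma dyadic_max_ge0 K F x : (forall y, 0 <= F y) -> 0 <= dyadic_max K F x.
Proof.
by move=> F0; elim: K => [|K IH] /=; [exact: average_ge0|rewrite le_max IH].
Qed.

Lemma average_le_max K F k x : (k <= K)%N -> average f F k x <= dyadic_max K F x.
Proof.
elim: K => [|K IH]; first by rewrite leqn0 => /eqP ->.
rewrite leq_eqVlt le_max => /predU1P[->|/IH ->//].
by rewrite lexx orbT.
Qed.

Lemma dyadic_max_attained K F x :
  exists2 k, (k <= K)%N & dyadic_max K F x = average f F k x.
Proof.
elim: K => [|K [k kK e]]; first by exists 0%N.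
have [le|lt] := leP (dyadic_max K F x) (average f F K.+1 x).
  by exists K.+1 => //=; apply/max_idPr.
by exists k; rewrite ?(leq_trans kK)//= -e; apply/max_idPl; exact: ltW.
Qed.

Lemma dyadic_max_cell K F x y : cl K x y -> dyadic_max K F x = dyadic_max K F y.
Proof.
elim: K => [|K IH] xy /=; first by rewrite (average_cell F xy).
rewrite -(average_cell F xy) IH//; exact: cell_subset xy.
Qed.

Lemma measurable_dyadic_max K F : measurable_fun setT (dyadic_max K F).
Proof. by apply: (@measurable_cell_fun _ _ _ _ _ f K) => x y; exact: dyadic_max_cell. Qed.

Local Notation kap := (kappa cn pm pP ca C0).
Local Notation eps := (split_exp cn pm pP ca C0).
Local Notation bc := (bad_const pP ca C0).
Local Notation sc := (star_const pP C0).

Definition overlap_const : R :=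
  (48 * ca) `^ pP * 2 `^ pP * (geo_const eps * 4 `^ eps).

Definition error_const : R := 2 * sc * (geo_const (kap / 2) * 4 `^ (kap / 2)).

Definition dyadic_const : R := 2 `^ pP * (bc * overlap_const + error_const).

Variables (K : nat) (F : T -> R).
Hypothesis mF : measurable_fun setT F.
Hypothesis F0 : forall y, 0 <= F y.
Hypothesis hF : (I setT (fun x => ((2 * ca * F x) `^ p x)%R) <= 1)%E.
Local Notation v l := (test_part cn pm pP ca C0 F l).
Local Notation M := (dyadic_max K F).

Let mMp : measurable_fun setT (fun y => M y `^ p y).
Proof. by apply: measurable_powR2 => //; exact: measurable_dyadic_max. Qed.

Let Mp0 y : 0 <= M y `^ p y. Proof. exact: powR_ge0. Qed.

Definition band a b : set T := [set x | a < M x <= b].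

Let measurable_between a b : measurable (band a b).
Proof.
by apply: (@measurable_cell_union _ _ _ _ _ f K) => x y xy; rewrite /band /= (dyadic_max_cell F xy).
Qed.

Let bc0 : 0 < bc.
Proof.
have ca2 : 1 <= ca ^+ 2 by rewrite exprn_ege1.
by rewrite /bad_const ltr_wpDl ?sqr_ge0// /gain_const mulr_gt0 ?powR_gt0//; lra.
Qed.

Let theta0 (x0 : T) : 0 < theta_gain cn pm pP ca C0.
Proof.
have := rh_exp_gt0 pm1 ppP ca1 C01 cn1 f x0.
by rewrite /theta_gain lt_min ltr01 => h; rewrite divr_gt0.
Qed.

Let eps0 (x0 : T) : 0 < eps.
Proof.
have h := theta0 x0; have q1 := cexp_gt1 pm1.
by rewrite /split_exp divr_gt0// mulr_gt0//; lra.
Qed.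

Let kap0 (x0 : T) : 0 < kap.
Proof. by have h := theta0 x0; rewrite /kappa divr_gt0//; lra. Qed.

(** At a point of the band the maximum is the average over some cell, of a generation up to [K].
    Stopping separately at the good and at the bad cells of this level covers the band by two
    reached sets. *)
Lemma level_set_le l : 0 < l ->
  (I (band l (2 * l)%R) (fun y => M y `^ p y) <= (2 `^ pP)%:E *
    (bc%:E * I setT (fun y => v l y `^ p y) +
     (if l < 1 then 2 * sc * l `^ (kap / 2) else 0)%:E))%E.
Proof.
move=> l0.
have mO := measurable_reached K (@level_good_inv _ _ _ _ _ p pm pP ca C0 f F l).
have mB := measurable_reached K (@level_bad_inv _ _ _ _ _ p pm pP ca C0 f F l).
set Og := reached K _ in mO; set Ob := reached K _ in mB.
have mS : measurable (band l (2 * l)%R) by exact: measurable_between.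
have sub : band l (2 * l)%R `<=` Og `|` Ob.
  move=> x /= /andP[lM Ml].
  have [k kK e] := dyadic_max_attained K F x.
  have lc : level_cell f F l k x by rewrite /level_cell /= -e lM.
  have [h|h] := pselect (bad_cell p pm pP ca C0 f F l k x).
  - by right; exists k.
  - by left; exists k.
have mc c := measurable_cst_powR c mp.
apply: (@le_trans _ _ ((2 `^ pP)%:E * I (Og `|` Ob) (fun y => l `^ p y))%E).
  rewrite -I_scale; [|exact: measurableU|exact: mc|exact: powR_ge0|by move=> y _; exact: powR_ge0].
  apply: (@le_trans _ _ (I (band l (2 * l)%R) (fun y => 2 `^ pP * l `^ p y))).
    apply: I_le; [exact: mS|exact: mMp|exact: measurable_funM|].
    move=> y /= /andP[_ h]; rewrite Mp0/=.
    apply: (@le_trans _ _ ((2 * l) `^ p y)).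
      apply: ge0_ler_powR; rewrite ?nnegrE ?dyadic_max_ge0//.
        by have := p1 y; lra.
      by rewrite mulr_ge0// ltW.
    rewrite powRM ?(ltW l0)// ler_wpM2r ?powR_ge0// ler_powR//; first lra.
    by have /andP[] := ppP y.
  apply: I_subset => //; [exact: measurableU|exact: measurable_funM|].
  by move=> y _; rewrite mulr_ge0 ?powR_ge0.
apply: lee_wpmul2l; first by rewrite lee_fin powR_ge0.
have -> : Og `|` Ob = Og `|` (Ob `\` Og).
  apply/seteqP; split => y /=; have [] := pselect (Og y); tauto.
have mD : measurable (Ob `\` Og) by exact: measurableD.
rewrite I_setU; [|exact: mO|exact: mD|exact: mc|by move=> y _; exact: powR_ge0|]; last first.
  by apply/disj_setPS => y [? []].
apply: leeD.
  exact: (level_good_le pm pP mp C0 ca1 f mF K l).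
apply: (@le_trans _ _ (I Ob (fun y => l `^ p y))).
  by apply: I_subset => // y _; exact: powR_ge0.
case: ifP => l1.
  exact: (level_bad_le mp pm1 ppP ca1 C01 cn1 HA Hst mF F0 hF K l0).
have -> : Ob = set0.
  apply/seteqP; split => // x Ox.
  have := level_bad_lt1 mp pm1 ppP ca1 C01 cn1 HA Hst mF F0 hF l0 Ox.
  by rewrite l1.
by rewrite integral_set0.
Qed.

(** The damped factor is F (l / F)^eps with l / F < 2. The power p >= 1 only decreases (l / F)^eps
    when l <= F, and costs at most 2^pP otherwise. *)
Lemma test_part_le l y : 0 < l -> v l y `^ p y <=
  (48 * ca) `^ pP * 2 `^ pP * (F y `^ p y * if l / 2 < F y then (l / F y) `^ eps else 0).
Proof.
move=> l0; have p0 := p1 y; have e0 := eps0 y.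
rewrite /test_part /damped_part; case: ifP => [lF|_]; last first.
  by rewrite !mulr0 powR0//; apply/eqP; lra.
have Fy : 0 < F y by apply: lt_trans lF; rewrite divr_gt0.
have -> : F y `^ (1 - eps) * l `^ eps = F y * (l / F y) `^ eps.
  rewrite powRD; last by rewrite (gt_eqF Fy) implybT.
  by rewrite powRr1 ?(ltW Fy)// powRN powRM ?invr_ge0 ?(ltW l0) ?(ltW Fy)// powRV ?(ltW Fy)//; ring.
have lF0 : 0 < l / F y by exact: divr_gt0.
have ca48 : 1 <= 48 * ca by have := ca1; lra.
have -> : (48 * ca * (F y * (l / F y) `^ eps)) `^ p y =
    (48 * ca) `^ p y * (F y `^ p y * ((l / F y) `^ eps) `^ p y).
  rewrite -powRM ?powR_ge0 ?(ltW Fy)// -powRM//; first by have := ca1; lra.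
  by apply: mulr_ge0; [exact: ltW|exact: powR_ge0].
have h1 : (48 * ca) `^ p y <= (48 * ca) `^ pP.
  by apply: ler_powR => //; have /andP[] := ppP y.
have h2 : ((l / F y) `^ eps) `^ p y <= 2 `^ pP * (l / F y) `^ eps.
  have [le1|lt1] := leP (l / F y) 1.
    apply: (@le_trans _ _ ((l / F y) `^ eps)).
      apply: powR_le_self; last exact: ltW.
      by rewrite powR_ge0/= powR_le1 ?(ltW e0)// (ltW lF0).
    rewrite ler_peMl ?powR_ge0// powR_ge1//; first lra.
    by have /andP[h _] := ppP y; have := pm1; have /andP[_] := ppP y; lra.
  apply: (@le_trans _ _ (2 `^ pP)).
    rewrite -powRrM.
    have lt2 : l / F y <= 2 by rewrite ler_pdivrMr//; lra.
    apply: (@le_trans _ _ (2 `^ (eps * p y))).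
      apply: ge0_ler_powR; rewrite ?nnegrE ?(ltW lF0)//.
      by rewrite mulr_ge0// ?ltW//; lra.
    apply: ler_powR; first lra.
    have /andP[_ h] := ppP y; apply: le_trans h.
    rewrite ler_piMl//; first lra.
    have q1 := cexp_gt1 pm1; have t0 := theta0 y.
    rewrite /split_exp ler_pdivrMr ?mul1r; last by rewrite mulr_gt0//; lra.
    by nra.
  rewrite ler_peMr ?powR_ge0// powR_ge1 ?(ltW e0)//.
  exact: ltW.
rewrite [leRHS](_ : _ = (48 * ca) `^ pP * (F y `^ p y * (2 `^ pP * (l / F y) `^ eps))); last by ring.
apply: ler_pM => //; rewrite ?mulr_ge0 ?powR_ge0//.
by apply: ler_pM => //; rewrite powR_ge0.
Qed.

Let hF1 : (I setT (fun x => F x `^ p x) <= 1)%E.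
Proof.
apply: le_trans hF; apply: I_le => //.
- exact: measurable_powR2.
- by apply: measurable_powR2 => //; exact: measurable_funM.
- move=> x _; rewrite powR_ge0/=; apply: ge0_ler_powR; rewrite ?nnegrE//.
  + by have := p1 x; lra.
  + by rewrite mulr_ge0//; have := ca1; lra.
  + by rewrite ler_peMl//; have := ca1; lra.
Qed.

Lemma overlap_ge0 (x0 : T) : 0 <= overlap_const.
Proof.
rewrite /overlap_const !mulr_ge0 ?powR_ge0// invr_ge0.
exact/ltW/geo_den/(eps0 x0).
Qed.

Lemma test_part_sum_le (x0 : T) N J :
  (\sum_(j < J) I setT (fun y => (v (level N j) y `^ p y)%R) <= overlap_const%:E)%E.
Proof.
have mv j : measurable_fun setT (fun y => v (level N j) y `^ p y).
  by apply: measurable_powR2 => //; exact: measurable_test_part.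
have oc0 := overlap_ge0 x0.
rewrite -I_sum//; last by move=> j y _; exact: powR_ge0.
apply: (@le_trans _ _ (I setT (fun y => overlap_const * F y `^ p y))).
  apply: I_le => //; first exact: measurable_sum.
    by apply: measurable_funM => //; exact: measurable_powR2.
  move=> y _; rewrite sumr_ge0/=; last by move=> j _; exact: powR_ge0.
  apply: (@le_trans _ _ (\sum_(j < J) (48 * ca) `^ pP * 2 `^ pP * (F y `^ p y *
     if level N j / 2 < F y then (level N j / F y) `^ eps else 0))).
    by apply: ler_sum => j _; apply: test_part_le; exact: level_gt0.
  rewrite -mulr_sumr -mulr_sumr /overlap_const.
  rewrite [leRHS](_ : _ = (48 * ca) `^ pP * 2 `^ pP *
    (F y `^ p y * (geo_const eps * 4 `^ eps))); last by ring.
  apply: ler_wpM2l; first by rewrite mulr_ge0 ?powR_ge0.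
  apply: ler_wpM2l; first exact: powR_ge0.
  have [Fy|] := ltP 0 (F y); first by apply: level_sum_below => //; exact: (eps0 x0).
  move=> Fy; rewrite big1; first by rewrite mulr_ge0 ?powR_ge0// invr_ge0 ltW// geo_den// (eps0 x0).
  move=> j _; case: ltP => // lt; have l0 : (0 : R) < level N j by exact: level_gt0.
  have h2 : (0 : R) < level N j / 2 by rewrite divr_gt0.
  by have := lt_trans h2 (lt_le_trans lt Fy); rewrite ltxx.
rewrite I_scale//; [|exact: measurable_powR2|by move=> y _; exact: powR_ge0].
by apply: le_trans (lee_wpmul2l _ hF1) _; rewrite ?mule1 ?lee_fin.
Qed.

(** The error term occurs for l < 1 only, where it decays geometrically: this is [level_sum_below]
    at y = 1. *)
Lemma error_sum_le (x0 : T) N J :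
  \sum_(j < J) (if (level N j : R) < 1 then 2 * sc * level N j `^ (kap / 2) else 0) <= error_const.
Proof.
have k2 : 0 < kap / 2 by rewrite divr_gt0// (kap0 x0).
have s0 : 0 <= 2 * sc by rewrite mulr_ge0// powR_ge0.
apply: le_trans (ler_wpM2l s0 (level_sum_below N J k2 ltr01)).
rewrite mulr_sumr; apply: ler_sum => j _; rewrite divr1.
have l0 : (0 : R) < level N j by exact: level_gt0.
case: ifP => lt1; first by rewrite ifT//; lra.
by rewrite mulr_ge0//; case: ifP => // _; exact: powR_ge0.
Qed.

Lemma between_le (x0 : T) N J :
  (I (band ((2 ^+ N)^-1)%R (level N J)) (fun y => M y `^ p y) <= dyadic_const%:E)%E.
Proof.
have h : (I (band ((2 ^+ N)^-1)%R (level N J)) (fun y => M y `^ p y) <=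
   \sum_(j < J) I (band (level N j) (2 * level N j)%R) (fun y => (M y `^ p y)%R))%E.
  elim: J => [|J IH].
    rewrite big_ord0 (_ : band _ _ = set0) ?integral_set0//.
    apply/seteqP; split => // x /=; rewrite /level expr0 mul1r.
    by move=> /andP[a b]; have := lt_le_trans a b; rewrite ltxx.
  rewrite big_ord_recr/=.
  have -> : (band ((2 ^+ N)^-1)%R (level N J.+1)) =
     (band ((2 ^+ N)^-1)%R (level N J)) `|` (band (level N J) (2 * level N J)%R).
    have lJ : (2 ^+ N)^-1 <= level N J :> R.
      by rewrite /level ler_peMl ?invr_ge0 ?exprn_ge0// exprn_ege1//; lra.
    have lJ2 : level N J <= 2 * level N J :> R by have := @level_gt0 R N J; lra.
    rewrite levelS /band; apply/seteqP; split => x /=.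
      move=> /andP[a b]; have [le|lt] := leP (M x) (level N J); first by left; rewrite a.
      by right; rewrite b.
    move=> [/andP[a b]|/andP[a b]]; first by rewrite a (le_trans b).
    by rewrite b andbT (le_lt_trans lJ).
  rewrite I_setU; [| | |exact: mMp|by move=> y _|]; last first.
    by apply/disj_setPS => x [/andP[_ a] /andP[b _]]; have := lt_le_trans b a; rewrite ltxx.
  - exact: measurable_between.
  - exact: measurable_between.
  exact: leeD.
apply: le_trans h _.
apply: (@le_trans _ _ (\sum_(j < J) ((2 `^ pP)%:E *
    (bc%:E * I setT (fun y => (v (level N j) y `^ p y)%R) +
     (if ((level N j : R) < 1)%R then 2 * sc * level N j `^ (kap / 2) else 0)%:E)))%E).
  by apply: lee_sum => j _; apply: level_set_le; exact: level_gt0.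
have Iv0 j : (0 <= I setT (fun y => (v (level N j) y `^ p y)%R))%E.
  by apply: I_ge0 => y _; exact: powR_ge0.
have er0 j : 0 <= if (level N j : R) < 1 then 2 * sc * level N j `^ (kap / 2) else 0.
  by case: ifP => // _; rewrite !mulr_ge0 ?powR_ge0.
rewrite -ge0_sume_distrr; last first.
  by move=> j _; rewrite adde_ge0 ?lee_fin// mule_ge0// lee_fin ltW.
rewrite /dyadic_const [leRHS]EFinM; apply: lee_wpmul2l; first by rewrite lee_fin powR_ge0.
rewrite big_split/= [leRHS]EFinD; apply: leeD.
  rewrite -ge0_sume_distrr; last by move=> j _.
  rewrite EFinM; apply: lee_wpmul2l; first by rewrite lee_fin ltW.
  exact: test_part_sum_le.
by rewrite sumEFin lee_fin; exact: error_sum_le.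
Qed.

(** The bands from 2^-N to 2^N increase to the set where the maximal function is positive, and
    [between_le] is uniform in [N]. The constant is independent of [K] as well, which permits
    arbitrarily many generations later. *)
Lemma dyadic_max_bounded (x0 : T) :
  (I setT (fun y => (M y `^ p y)%R) <= dyadic_const%:E)%E.
Proof.
pose S N := band (2 ^+ N)^-1 (level N (N + N)).
have lN N : level N (N + N) = 2 ^+ N :> R by rewrite /level exprD mulfK// gt_eqF// exprn_gt0.
have uS : \bigcup_N S N = [set x | 0 < M x].
  apply/seteqP; split => x; rewrite /S /band /=.
    by move=> [N _ /= /andP[a _]]; apply: lt_trans a; rewrite invr_gt0 exprn_gt0.
  move=> M0.
  have hb (a : R) : 0 <= a -> exists N : nat, a < 2 ^+ N.
    move=> a0; exists (Num.Def.archi_bound a).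
    apply: lt_le_trans (archi_boundP a0) _; rewrite -natrX ler_nat ltnW//.
    exact: ltn_expl.
  have [N1 h1] := hb _ (ltW M0).
  have [N2 h2] : exists N, (M x)^-1 < 2 ^+ N by apply: hb; rewrite invr_ge0 ltW.
  exists (maxn N1 N2) => //=; rewrite lN; apply/andP; split.
    rewrite invf_plt ?posrE ?exprn_gt0//; apply: lt_le_trans h2 _.
    by rewrite ler_weXn2l ?leq_maxr//; lra.
  apply: le_trans (ltW h1) _.
  by rewrite ler_weXn2l ?leq_maxl//; lra.
have hE : I setT (fun y => M y `^ p y) = I (\bigcup_N S N) (fun y => M y `^ p y).
  rewrite uS -[in RHS](setTI [set x | 0 < M x]) -I_indic; apply: I_eq => y _.
  rewrite indicE; have [yM|] := boolP (y \in _); first by rewrite mulr1.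
  rewrite mulr0 notin_setE /= => /negP; rewrite -leNgt => M0.
  have -> : M y = 0 by apply/eqP; rewrite eq_le M0 dyadic_max_ge0.
  by rewrite powR0//; have := p1 y => ?; apply/eqP; lra.
rewrite hE; apply: I_nondecreasing_le => //.
- by move=> N; exact: measurable_between.
- move=> a b ab x; rewrite /S /band /= !lN => /andP[h1 h2].
  have ab2 : 2 ^+ a <= 2 ^+ b :> R by rewrite ler_weXn2l//; lra.
  rewrite (le_trans h2 ab2) andbT; apply: le_lt_trans h1.
  by rewrite lef_pV2 ?posrE ?exprn_gt0.
- by move=> N; exact: between_le.
Qed.

End DyadicMaximal.

(** * Cubes and grids in R^n *)

Lemma measure_diff0 {R : realType} {d} {T : measurableType d}
    (mu : {measure set T -> \bar R}) (A B : set T) (c : R) :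
  measurable A -> measurable B -> B `<=` A -> mu A = c%:E -> mu B = c%:E ->
  mu (A `\` B) = 0%E.
Proof.
move=> mA mB BA hA hB; have lt : (mu A < +oo)%E by rewrite hA ltry.
apply: etrans (measureD mA mB lt) _; rewrite setIidr//.
by apply: etrans (_ : c%:E - c%:E = 0)%E; [rewrite -{1}hA -hB|rewrite subee].
Qed.

Section Boxes.
Context {R : realType}.
Notation RR := (measurableTypeR R).

Definition box n (A : 'I_n -> set R) : set (n.-tuple RR) :=
  [set x | forall i, A i (tnth x i)].

Lemma measurable_box n (A : 'I_n -> set R) : (forall i, measurable (A i : set RR)) ->
  measurable (box A).
Proof.
move=> mA.
have -> : box A = \bigcap_(i in [set: 'I_n]) ((fun x : n.-tuple RR => tnth x i) @^-1` A i).
  by apply/seteqP; split => x h => [i _|i]; exact: h.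
apply: fin_bigcap_measurable; first exact: finite_finset.
move=> i _; rewrite -[X in measurable X]setTI.
exact: (measurable_tnth i measurableT).
Qed.

Lemma borel_lebesgue_box n (A : 'I_n -> set R) : (forall i, measurable (A i : set RR)) ->
  borel_lebesgue R n (box A) = (\prod_(i < n) lebesgue_measure (A i))%E.
Proof.
elim: n A => [|n IH] A mA.
  rewrite big_ord0 /= diracE mem_set//.
  by move=> [].
rewrite big_ord_recl /= /cons_measure /pushforward.
have -> : @tuple_cons R n @^-1` box A = box (fun i => A (lift ord0 i)) `*` A ord0.
  apply/seteqP; split => -[x y] /=.
    move=> h; split => /= [i|]; last by have := h ord0.
    by have := h (lift ord0 i); rewrite tnthS.
  move=> [h1 h2] i; rewrite /tuple_cons /=.
  by have [j ->|->//] := unliftP ord0 i; rewrite tnthS; exact: h1.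
rewrite product_measure1E; last 2 first.
- exact: measurable_box.
- exact: mA.
by rewrite IH// muleC.
Qed.

Lemma measurable_Rn n (A : set (n.-tuple RR)) : measurable A ->
  measurable (A : set (Rn R n)).
Proof. exact: caratheodory_measurable_mu_ext. Qed.

Lemma lebesgue_RnE n (A : set (n.-tuple RR)) : measurable A ->
  lebesgue_Rn R n A = borel_lebesgue R n A.
Proof. exact: measurable_mu_extE. Qed.

Lemma lebesgue_Rn_box n (A : 'I_n -> set R) (s : R) :
  (forall i, measurable (A i : set RR)) ->
  (forall i, lebesgue_measure (A i) = s%:E) ->
  lebesgue_Rn R n (box A) = (s ^+ n)%:E.
Proof.
move=> mA sA; rewrite lebesgue_RnE; last exact: measurable_box.
rewrite borel_lebesgue_box// (eq_bigr (fun=> s%:E)) => [|i _]; last exact: sA.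
rewrite prodEFin; congr EFin.
by rewrite prodr_const card_ord.
Qed.

Lemma box_measurable_Rn n (A : 'I_n -> set R) :
  (forall i, measurable (A i : set RR)) -> measurable (box A : set (Rn R n)).
Proof. by move=> mA; apply: measurable_Rn; exact: measurable_box. Qed.

Lemma open_cubeE n (a : n.-tuple R) s :
  open_cube a s = box (fun i => [set` `]tnth a i, tnth a i + s[%R]).
Proof.
by apply/seteqP; split => x h i; have := h i; rewrite /= in_itv.
Qed.

Lemma closed_cubeE n (a : n.-tuple R) s :
  closed_cube a s = box (fun i => [set` `[tnth a i, tnth a i + s]%R]).
Proof.
by apply/seteqP; split => x h i; have := h i; rewrite /= in_itv.
Qed.

Let itv_length b1 b2 (a s : R) : 0 < s ->
  lebesgue_measure [set` Interval (BSide b1 a) (BSide b2 (a + s))] = s%:E.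
Proof.
move=> s0; rewrite lebesgue_measure_itv /= lte_fin ltrDl s0.
by rewrite -EFinD addrAC subrr add0r.
Qed.

Lemma measurable_open_cube n (a : n.-tuple R) s : measurable (open_cube a s).
Proof. by rewrite open_cubeE; apply: box_measurable_Rn => i; exact: measurable_itv. Qed.

Lemma measurable_closed_cube n (a : n.-tuple R) s : measurable (closed_cube a s).
Proof. by rewrite closed_cubeE; apply: box_measurable_Rn => i; exact: measurable_itv. Qed.

Lemma mu_open_cube n (a : n.-tuple R) s : 0 < s ->
  lebesgue_Rn R n (open_cube a s) = (s ^+ n)%:E.
Proof.
move=> s0; rewrite open_cubeE; apply: lebesgue_Rn_box => i; first exact: measurable_itv.
exact: itv_length.
Qed.

Lemma mu_closed_cube n (a : n.-tuple R) s : 0 < s ->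
  lebesgue_Rn R n (closed_cube a s) = (s ^+ n)%:E.
Proof.
move=> s0; rewrite closed_cubeE; apply: lebesgue_Rn_box => i; first exact: measurable_itv.
exact: itv_length.
Qed.

(** Grid cells have to partition the space exactly, hence are half-open; they differ by null sets
    from the open cubes that [cube_partitions] asks for. *)
Definition halfopen_cube n (a : n.-tuple R) s : set (Rn R n) :=
  [set x | forall i, tnth a i <= tnth x i < tnth a i + s].

Lemma halfopen_cubeE n (a : n.-tuple R) s :
  halfopen_cube a s = box (fun i => [set` `[tnth a i, tnth a i + s[%R]).
Proof.
by apply/seteqP; split => x h i; have := h i; rewrite /= in_itv.
Qed.

Lemma measurable_halfopen_cube n (a : n.-tuple R) s : measurable (halfopen_cube a s).
Proof. by rewrite halfopen_cubeE; apply: box_measurable_Rn => i; exact: measurable_itv. Qed.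

Lemma mu_halfopen_cube n (a : n.-tuple R) s : 0 < s ->
  lebesgue_Rn R n (halfopen_cube a s) = (s ^+ n)%:E.
Proof.
move=> s0; rewrite halfopen_cubeE; apply: lebesgue_Rn_box => i; first exact: measurable_itv.
exact: itv_length.
Qed.

Lemma open_sub_halfopen n (a : n.-tuple R) s : open_cube a s `<=` halfopen_cube a s.
Proof. by move=> x h i; have /andP[/ltW -> ->] := h i. Qed.

Lemma halfopen_boundary n (a : n.-tuple R) s : 0 < s ->
  lebesgue_Rn R n (halfopen_cube a s `\` open_cube a s) = 0%E.
Proof.
move=> s0; apply: (@measure_diff0 _ _ _ _ _ _ (s ^+ n)).
- exact: measurable_halfopen_cube.
- exact: measurable_open_cube.
- exact: open_sub_halfopen.
- exact: mu_halfopen_cube.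
- exact: mu_open_cube.
Qed.

End Boxes.

Section Grids.
Context {R : realType} (n : nat).
Notation RR := (measurableTypeR R).
Notation mu := (lebesgue_Rn R n).
Variables (o : n.-tuple R) (L : R).
Hypothesis L0 : 0 < L.

Definition mesh k : R := L / 2 ^+ k.

Lemma mesh_gt0 k : 0 < mesh k.
Proof. by rewrite divr_gt0// exprn_gt0. Qed.

Lemma meshS k : mesh k = 2 * mesh k.+1.
Proof.
rewrite /mesh exprS; field; by rewrite gt_eqF// exprn_gt0.
Qed.

Definition grid_coord k (x : Rn R n) (i : 'I_n) : int :=
  Num.floor ((tnth x i - tnth o i) / mesh k).

Definition grid_idx k (x : Rn R n) : nat := pickle [ffun i => grid_coord k x i].

Definition corner k (x : Rn R n) : n.-tuple R :=
  [tuple tnth o i + mesh k * (grid_coord k x i)%:~R | i < n].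

Lemma grid_idxP k x y : grid_idx k x = grid_idx k y <-> forall i, grid_coord k x i = grid_coord k y i.
Proof.
split => [/(pcan_inj pickleK)/ffunP h i|h]; first by have := h i; rewrite !ffunE.
by congr pickle; apply/ffunP => i; rewrite !ffunE.
Qed.

Lemma grid_coordP k x (z : int) i :
  (grid_coord k x i = z) <->
  (tnth o i + mesh k * z%:~R <= tnth x i < tnth o i + mesh k * z%:~R + mesh k).
Proof.
have m0 := mesh_gt0 k.
rewrite /grid_coord; split => [<-|/andP[h1 h2]].
  have /andP[h1 h2] := floor_itv ((tnth x i - tnth o i) / mesh k).
  move: h1 h2; set w := Num.floor _ => h1 h2.
  rewrite ler_pdivlMr// in h1; rewrite ltr_pdivrMr// intrD in h2.
  by apply/andP; split; lra.
apply/eqP; rewrite floor_eq intrD; apply/andP; split.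
  by rewrite ler_pdivlMr//; lra.
by rewrite ltr_pdivrMr//; lra.
Qed.

Lemma grid_cellE k x :
  [set y | grid_idx k y = grid_idx k x] = halfopen_cube (corner k x) (mesh k).
Proof.
apply/seteqP; split => y.
  move=> /grid_idxP h i; rewrite tnth_mktuple.
  by apply/grid_coordP; exact: h.
move=> h; apply/grid_idxP => i; apply/grid_coordP.
by have := h i; rewrite tnth_mktuple.
Qed.

Lemma grid_nested k x y : grid_idx k.+1 x = grid_idx k.+1 y -> grid_idx k x = grid_idx k y.
Proof.
move=> /grid_idxP h; apply/grid_idxP => i; apply/esym/grid_coordP.
have m1 := mesh_gt0 k.+1.
have e : grid_coord k x i = grid_coord k x i by [].
move/grid_coordP : e; rewrite meshS; set z := grid_coord k x i => /andP[a b].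
have e1 : grid_coord k.+1 x i = grid_coord k.+1 x i by [].
have e2 : grid_coord k.+1 y i = grid_coord k.+1 x i by rewrite h.
move/grid_coordP : e1 => /andP[]; move/grid_coordP : e2 => /andP[].
set w := grid_coord k.+1 x i => c1 c2 c3 c4.
have w2 : w < 2 * z + 2.
  rewrite -(ltr_int R) intrD intrM -(ltr_pM2l m1); lra.
have z2 : 2 * z < w + 1.
  rewrite -(ltr_int R) intrD intrM -(ltr_pM2l m1); lra.
have {}w2 : w <= 2 * z + 1 by lia.
have {}z2 : 2 * z <= w by lia.
have w2R : w%:~R <= 2 * z%:~R + 1 :> R by move: w2; rewrite -(ler_int R) intrD intrM.
have z2R : 2 * z%:~R <= w%:~R :> R by move: z2; rewrite -(ler_int R) intrM.
rewrite -(ler_pM2l m1) in w2R; rewrite -(ler_pM2l m1) in z2R.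
by apply/andP; split; lra.
Qed.

Lemma measurable_grid_idx k i : measurable [set y | grid_idx k y = i].
Proof.
have [[x <-]|h] := pselect (exists x, grid_idx k x = i).
  by rewrite grid_cellE; exact: measurable_halfopen_cube.
rewrite (_ : [set y | _] = set0); first exact: measurable0.
by apply/seteqP; split => // y yi; apply: h; exists y.
Qed.

Lemma mu_grid_idx k x : mu [set y | grid_idx k y = grid_idx k x] = (mesh k ^+ n)%:E.
Proof. by rewrite grid_cellE mu_halfopen_cube//; exact: mesh_gt0. Qed.

Lemma mesh_doubling k : mesh k ^+ n <= 2 ^+ n * mesh k.+1 ^+ n.
Proof. by rewrite -exprMn -meshS. Qed.

End Grids.

(** * Approximation by unions of cells, and density in grid cells *)

Section Approximation.
Context {R : realType} {d} {T : measurableType d}.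
Variables (mu : {measure set T -> \bar R}) (ix : nat -> T -> nat).
Implicit Types (A B : set T).
Local Notation I A F := (\int[mu]_(x in A) (F x)%:E)%E.
Hypothesis ix_nested : forall k x y, ix k.+1 x = ix k.+1 y -> ix k x = ix k y.
Hypothesis measurable_ix : forall k i, measurable [set y | ix k y = i].
Variable Q : set T.
Hypotheses (mQ : measurable Q) (Qfin : (mu Q < +oo)%E).

Definition level_set k A := forall x y, ix k x = ix k y -> A x -> A y.

Let ix_le j k x y : (j <= k)%N -> ix k x = ix k y -> ix j x = ix j y.
Proof.
elim: k => [|k IH]; first by rewrite leqn0 => /eqP ->.
rewrite leq_eqVlt => /predU1P[->//|jk /ix_nested]; exact: IH.
Qed.

Lemma level_set_widen j k A : (j <= k)%N -> level_set j A -> level_set k A.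
Proof. by move=> jk h x y xy; apply: h; exact: ix_le xy. Qed.

Lemma measurable_level_set k A : level_set k A -> measurable A.
Proof.
move=> hA.
have -> : A = \bigcup_i (A `&` [set y | ix k y = i]).
  apply/seteqP; split => [x Ax|x [i _ []//]].
  by exists (ix k x).
apply: bigcup_measurable => i _.
have [[x [Ax xi]]|h] := pselect (exists x, A x /\ ix k x = i).
  rewrite (_ : _ `&` _ = [set y | ix k y = i]); first exact: measurable_ix.
  apply/seteqP; split => y /=; first by case.
  by move=> yi; split => //; apply: hA Ax; rewrite xi yi.
rewrite (_ : _ `&` _ = set0) //.
by apply/seteqP; split => y //= -[Ay yi]; apply: h; exists y.
Qed.

Definition symdiff A B := (A `\` B) `|` (B `\` A).

(** Approximation in measure inside [Q] by unions of cells. Such sets form a sigma-algebra, so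
    generators suffice. *)
Definition approximable B := measurable B /\ forall e : R, 0 < e ->
  exists k A, level_set k A /\ (mu (symdiff B A `&` Q) <= e%:E)%E.

Let measurable_symdiff A B : measurable A -> measurable B -> measurable (symdiff A B).
Proof. by move=> mA mB; apply: measurableU; exact: measurableD. Qed.

Lemma approximable_level k A : level_set k A -> approximable A.
Proof.
move=> hA; split => [|e e0]; first exact: measurable_level_set hA.
exists k, A; split => //.
rewrite (_ : _ `&` _ = set0) ?measure0 ?lee_fin ?ltW//.
by apply/seteqP; split => // x [[[]|[]]].
Qed.

Lemma approximableC B : approximable B -> approximable (~` B).
Proof.
move=> [mB hB]; split => [|e e0]; first exact: measurableC.
have [k [A [hA h]]] := hB e e0.
exists k, (~` A); split.
  by move=> x y xy nA Ay; apply: nA; apply: hA Ay.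
rewrite (_ : symdiff _ _ = symdiff B A)//.
apply/seteqP; split => x; rewrite /symdiff /=; have [] := pselect (A x);
  have [] := pselect (B x); tauto.
Qed.

Lemma approximable_close B : measurable B ->
  (forall e : R, 0 < e -> exists B', [/\ approximable B', measurable B' &
     (mu (symdiff B B' `&` Q) <= e%:E)%E]) -> approximable B.
Proof.
move=> mB h; split => // e e0.
have e20 : 0 < e / 2 by rewrite divr_gt0.
have [B' [[_ aB'] mB' hB']] := h _ e20.
have [k [A [hA hAB]]] := aB' _ e20.
exists k, A; split => //.
have mA := measurable_level_set hA.
apply: (@le_trans _ _ (mu ((symdiff B B' `&` Q) `|` (symdiff B' A `&` Q)))).
  apply: le_measure; rewrite ?inE.
  - by apply: measurableI => //; exact: measurable_symdiff.
  - by apply: measurableU; apply: measurableI => //; exact: measurable_symdiff.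
  - move=> x [] /=; rewrite /symdiff /=; have [] := pselect (B' x);
    have [] := pselect (B x); have [] := pselect (A x); tauto.
apply: le_trans (measureU2 _ _ _) _.
- by apply: measurableI => //; exact: measurable_symdiff.
- by apply: measurableI => //; exact: measurable_symdiff.
apply: le_trans (leeD hB' hAB) _.
by rewrite -EFinD lee_fin; lra.
Qed.

Lemma approximableU B1 B2 : approximable B1 -> approximable B2 ->
  approximable (B1 `|` B2).
Proof.
move=> [m1 h1] [m2 h2]; split => [|e e0]; first exact: measurableU.
have e20 : 0 < e / 2 by rewrite divr_gt0.
have [k1 [A1 [hA1 hB1]]] := h1 _ e20.
have [k2 [A2 [hA2 hB2]]] := h2 _ e20.
exists (maxn k1 k2), (A1 `|` A2); split.
  move=> x y xy [A1x|A2x]; [left|right].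
  - by apply: (level_set_widen (leq_maxl k1 k2) hA1) A1x.
  - by apply: (level_set_widen (leq_maxr k1 k2) hA2) A2x.
have mA1 := measurable_level_set hA1; have mA2 := measurable_level_set hA2.
apply: (@le_trans _ _ (mu ((symdiff B1 A1 `&` Q) `|` (symdiff B2 A2 `&` Q)))).
  apply: le_measure; rewrite ?inE.
  - by apply: measurableI => //; apply: measurable_symdiff; exact: measurableU.
  - by apply: measurableU; apply: measurableI => //; exact: measurable_symdiff.
  - move=> x [] /=; rewrite /symdiff /=; have [] := pselect (B1 x);
    have [] := pselect (B2 x); have [] := pselect (A1 x);
    have [] := pselect (A2 x); tauto.
apply: le_trans (measureU2 _ _ _) _.
- by apply: measurableI => //; exact: measurable_symdiff.
- by apply: measurableI => //; exact: measurable_symdiff.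
apply: le_trans (leeD hB1 hB2) _.
by rewrite -EFinD lee_fin; lra.
Qed.

(** Finite unions are approximable, and because [Q] has finite measure they come arbitrarily close
    to the countable union there. *)
Lemma approximable_bigcup (B : nat -> set T) : (forall i, approximable (B i)) ->
  approximable (\bigcup_i B i).
Proof.
move=> h; have mB i : measurable (B i) by have [] := h i.
apply: approximable_close; first exact: bigcup_measurable.
move=> e e0.
pose U N := \big[setU/set0]_(i < N) B i.
have aU N : approximable (U N).
  rewrite /U; elim: N => [|N IH].
    rewrite big_ord0; apply: (@approximable_level 0%N); by [].
  by rewrite big_ord_recr/=; apply: approximableU.
have mU N : measurable (U N) by have [] := aU N.
have sub N : U N `<=` \bigcup_i B i by exact: bigsetU_bigcup.
have mBQ : measurable (\bigcup_i B i `&` Q).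
  by apply: measurableI => //; exact: bigcup_measurable.
have mUQ N : measurable (U N `&` Q) by exact: measurableI.
have fin N : (mu (U N `&` Q) <= mu Q)%E.
  by apply: le_measure; rewrite ?inE//; exact: subIsetr.
have finB : (mu (\bigcup_i B i `&` Q) < +oo)%E.
  by apply: le_lt_trans Qfin; apply: le_measure; rewrite ?inE//; exact: subIsetr.
have cv : mu (U N `&` Q) @[N --> \oo] --> mu (\bigcup_i B i `&` Q).
  have -> : \bigcup_i B i `&` Q = \bigcup_N (U N `&` Q).
    rewrite -setI_bigcupl; congr (_ `&` _).
    apply/seteqP; split => [x [i _ Bx]|x [N _ /sub//]].
    exists i.+1 => //; rewrite /U big_ord_recr/=; by right.
  apply: nondecreasing_cvg_mu => //; first exact: bigcup_measurable.
  move=> a b ab; apply/subsetPset; apply: setSI.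
  by apply: subset_bigsetU.
have [N hN] : exists N, (mu (\bigcup_i B i `&` Q) - e%:E <= mu (U N `&` Q))%E.
  apply: contrapT => hn.
  have lt N : (mu (U N `&` Q) < mu (\bigcup_i B i `&` Q) - e%:E)%E.
    by rewrite ltNge; apply/negP => hN; apply: hn; exists N.
  have : (mu (\bigcup_i B i `&` Q) <= mu (\bigcup_i B i `&` Q) - e%:E)%E.
    rewrite -{1}(cvg_lim _ cv)//; apply: lime_le.
      by apply/cvg_ex; eexists; exact: cv.
    by apply: nearW => N; exact: ltW.
  have f1 : mu (\bigcup_i B i `&` Q) \is a fin_num by rewrite ge0_fin_numE.
  by rewrite -(fineK f1) -EFinB lee_fin; lra.
exists (U N); split => //.
have -> : symdiff (\bigcup_i B i) (U N) `&` Q = (\bigcup_i B i `&` Q) `\` (U N `&` Q).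
  apply/seteqP; split => x; rewrite /symdiff /=; have := @sub N x; tauto.
have e1 : mu ((\bigcup_i B i `&` Q) `\` (U N `&` Q))
   = (mu (\bigcup_i B i `&` Q) - mu (U N `&` Q))%E.
  apply: etrans (measureD mBQ (mUQ N) finB) _; congr (_ - mu _)%E.
  by apply: setIidr; apply: setSI; exact: sub.
rewrite e1; move: hN.
have f1 : mu (\bigcup_i B i `&` Q) \is a fin_num by rewrite ge0_fin_numE.
have f2 : mu (U N `&` Q) \is a fin_num.
  by rewrite ge0_fin_numE// (le_lt_trans (fin N)).
by rewrite -(fineK f1) -(fineK f2) -!EFinB !lee_fin; lra.
Qed.

Lemma sub_approximable (C : set (set T)) : C `<=` approximable ->
  <<s C>> `<=` approximable.
Proof.
move=> h; apply: smallest_sub => //; split.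
- by apply: (@approximable_level 0%N).
- by move=> B hB; rewrite setTD; exact: approximableC.
- exact: approximable_bigcup.
Qed.

(** Let [A] be a union of cells within e of [N]. Density at most 1/2 passes from the cells to [A],
    so |N| <= |A| / 2 + e, while |A| <= |N| + e; together |N| <= 3 e. *)
Lemma approximable_density k0 N : level_set k0 Q -> approximable N -> N `<=` Q ->
  (forall j y, (k0 <= j)%N -> Q y ->
     (mu (N `&` [set z | ix j z = ix j y]) <= 2^-1%:E * mu [set z | ix j z = ix j y])%E) ->
  mu N = 0%E.
Proof.
move=> hQ [mN aN] NQ hN.
have hle (e : R) : 0 < e -> (mu N <= (3 * e)%:E)%E.
  move=> e0; have [k [A' [hA' hAN]]] := aN e e0.
  pose j := maxn k0 k.
  pose A := A' `&` Q.
  have hA : level_set j A.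
    move=> x y xy [Ax Qx]; split.
    - exact: (level_set_widen (leq_maxr k0 k) hA' xy).
    - exact: (level_set_widen (leq_maxl k0 k) hQ xy).
  have mA := measurable_level_set hA.
  have hNA : (mu (N `&` A) <= 2^-1%:E * mu A)%E.
    have eA : A = \bigcup_i (A `&` [set y | ix j y = i]).
      apply/seteqP; split => [x Ax|x [i _ []//]].
      by exists (ix j x).
    have mS i : measurable (A `&` [set y | ix j y = i]) by exact: measurableI.
    have : (I A \1_N <= I A (fun=> 2^-1))%E.
      rewrite eA; apply: I_bigcup_le => //.
      - by move=> a b _ _ [x [[_ <-] [_ <-]]].
      move=> i; rewrite integral_indic// I_cst//.
      have [[x [Ax xi]]|h] := pselect (exists x, A x /\ ix j x = i); last first.
        rewrite (_ : A `&` _ = set0) ?setI0 ?measure0 ?mule0//.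
        by apply/seteqP; split => y //= -[Ay yi]; apply: h; exists y.
      have -> : A `&` [set y | ix j y = i] = [set y | ix j y = ix j x].
        apply/seteqP; split => y /=; first by rewrite xi; case.
        by move=> yi; split; [apply: hA Ax; rewrite yi|rewrite yi].
      by apply: hN; [exact: leq_maxl|case: Ax].
    by rewrite integral_indic// I_cst.
  have mAN : measurable (symdiff N A' `&` Q).
    by apply: measurableI => //; apply: measurable_symdiff => //; exact: measurable_level_set hA'.
  have le1 : (mu N <= mu (N `&` A) + e%:E)%E.
    apply: (@le_trans _ _ (mu ((N `&` A) `|` (symdiff N A' `&` Q)))).
      apply: le_measure; rewrite ?inE//; first by apply: measurableU => //; exact: measurableI.
      move=> x Nx; have Qx := NQ x Nx; rewrite /A /symdiff /=.
      by have [] := pselect (A' x); tauto.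
    apply: le_trans (measureU2 _ _ _) _ => //; first exact: measurableI.
    exact: leeD.
  have le2 : (mu A <= mu N + e%:E)%E.
    apply: (@le_trans _ _ (mu (N `|` (symdiff N A' `&` Q)))).
      apply: le_measure; rewrite ?inE//; first exact: measurableU.
      move=> x [A'x Qx]; rewrite /symdiff /=.
      by have [] := pselect (N x); tauto.
    apply: le_trans (measureU2 _ _ _) _ => //.
    exact: leeD.
  have fN : mu N \is a fin_num.
    rewrite ge0_fin_numE//; apply: le_lt_trans Qfin.
    by apply: le_measure; rewrite ?inE.
  have fA : mu A \is a fin_num.
    rewrite ge0_fin_numE//; apply: le_lt_trans Qfin.
    by apply: le_measure; rewrite ?inE//; exact: subIsetr.
  have := le_trans le1 (leeD2r e%:E hNA).
  move: le2; rewrite -(fineK fN) -(fineK fA) -EFinM -!EFinD !lee_fin; lra.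
apply/eqP; rewrite eq_le measure_ge0 andbT.
apply/lee_addgt0Pr => e e0; rewrite add0e.
have := hle (e / 3); rewrite divr_gt0// => /(_ isT).
by rewrite mulrC divfK.
Qed.

End Approximation.

Section GridDensity.
Context {R : realType} (n : nat).
Notation RR := (measurableTypeR R).
Local Notation mu := (lebesgue_Rn R n).
Variables (o : n.-tuple R) (L : R).
Hypothesis L0 : 0 < L.
Local Notation ix := (grid_idx o L).

Let nested := @grid_nested R n o L L0.
Let measurable_ix := @measurable_grid_idx R n o L L0.

Lemma mesh_small (e : R) : 0 < e -> exists k, mesh L k < e.
Proof.
move=> e0; exists (Num.Def.archi_bound (L / e)).
rewrite /mesh ltr_pdivrMr ?exprn_gt0// mulrC -ltr_pdivrMr//.
apply: lt_le_trans (archi_boundP _) _; first by rewrite divr_ge0// ltW.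
by rewrite -natrX ler_nat ltnW// ltn_expl.
Qed.

Section InCube.
Variable Q : set (Rn R n).
Hypotheses (mQ : measurable Q) (Qfin : (mu Q < +oo)%E).
Local Notation approx := (approximable mu ix Q).

(** Once the mesh is small, a point beyond [a] has the corner of its cell beyond [a]; for each
    generation the latter condition defines a union of cells. *)
Lemma approximable_ray (i : 'I_n) (a : R) :
  approx [set x : Rn R n | a < tnth x i].
Proof.
have -> : [set x : Rn R n | a < tnth x i] =
    \bigcup_k [set x | a < tnth (corner o L k x) i].
  apply/seteqP; split => x /=.
    move=> ax; have [|k hk] := @mesh_small (tnth x i - a); first by rewrite subr_gt0.
    exists k => //=; have [/(_ erefl)/andP[_ h] _] := @grid_coordP R n o L L0 k x (grid_coord o L k x i) i.
    by rewrite tnth_mktuple; lra.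
  move=> [k _ /=]; rewrite tnth_mktuple => h.
  have [/(_ erefl)/andP[h1 _] _] := @grid_coordP R n o L L0 k x (grid_coord o L k x i) i.
  exact: lt_le_trans h1.
apply: approximable_bigcup => // k; apply: (@approximable_level _ _ _ _ _ measurable_ix _ k).
move=> x y /grid_idxP xy /=; rewrite !tnth_mktuple.
by rewrite (xy i).
Qed.

(** Coordinate preimages generate the sigma-algebra on tuples, and open rays generate that of the
    line. *)
Lemma approximable_borel (B : set (n.-tuple RR)) : measurable B -> approx (B : set (Rn R n)).
Proof.
pose tns (i : 'I_n) (x : n.-tuple RR) : RR := tnth x i.
move=> mB; have sub := @sub_approximable _ _ _ mu ix nested measurable_ix Q mQ Qfin
  (\big[setU/set0]_(i < n) preimage_set_system setT (tns i) measurable).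
apply: sub mB => A; rewrite -bigcup_seq => -[i _ [U mU <-]]; rewrite setTI; pose tn := tns i.
suff h : <<s (@RGenOInfty.G R) >> `<=` [set V | approx (tn @^-1` V)].
  apply: h; have := @RGenOInfty.measurableE R.
  by move=> /(congr1 (fun C : set (set R) => C U)) e; exact: (eq_ind _ id mU _ e).
apply: smallest_sub; first split => /=.
- by rewrite preimage_set0; apply: (@approximable_level _ _ _ _ _ measurable_ix _ 0%N).
- by move=> V hV; rewrite setTD preimage_setC; exact: approximableC.
- by move=> V hV; rewrite preimage_bigcup; exact: approximable_bigcup.
move=> _ [a ->] /=.
rewrite (_ : _ @^-1` _ = [set x : Rn R n | a < tnth x i]); first exact: approximable_ray.
by apply/seteqP; split => x /=; rewrite in_itv/= andbT.
Qed.

(** The measure is an infimum over countable Borel covers; this carries approximability from Borel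
    sets over to Lebesgue-measurable ones. *)
Lemma borel_cover (N : set (Rn R n)) (e : R) : measurable N -> (mu N < +oo)%E -> 0 < e ->
  exists B : set (n.-tuple RR), [/\ measurable B, N `<=` B & (mu B <= mu N + e%:E)%E].
Proof.
move=> mN Nfin e0.
have fN : mu N \is a fin_num by rewrite ge0_fin_numE.
have [_ [F [mF NF] <-] hF] := lb_ereal_inf_adherent e0 fN.
exists (\bigcup_k F k); split => //; first exact: bigcup_measurable.
apply: le_trans (ltW hF).
have mU : measurable (\bigcup_k F k) by exact: bigcup_measurable.
rewrite lebesgue_RnE//.
exact: (measure_sigma_subadditive (borel_lebesgue R n) mF mU (@subset_refl _ _)).
Qed.

Lemma approximable_Rn (N : set (Rn R n)) : measurable N -> (mu N < +oo)%E -> approx N.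
Proof.
move=> mN Nfin; apply: approximable_close => // e e0.
have [B [mB NB hB]] := borel_cover mN Nfin e0.
have mB' : measurable (B : set (Rn R n)) by exact: measurable_Rn.
exists B; split => //; first exact: approximable_borel.
apply: (@le_trans _ _ (mu (B `\` N))).
  apply: le_measure; rewrite ?inE.
  - by apply: measurableI => //; apply: measurableU; exact: measurableD.
  - exact: measurableD.
  - by move=> x [[[Nx nB]|//] _]; have := NB x Nx.
have fN : mu N \is a fin_num by rewrite ge0_fin_numE.
have Bfin : (mu B < +oo)%E.
  by apply: le_lt_trans hB _; rewrite -(fineK fN) -EFinD ltry.
apply: (@le_trans _ _ (mu B - mu N)%E).
  have -> // : mu (B `\` N) = (mu B - mu N)%E.
  by apply: etrans (measureD mB' mN Bfin) _; rewrite setIidr.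
have fB : mu B \is a fin_num by rewrite ge0_fin_numE.
by move: hB; rewrite -(fineK fN) -(fineK fB) -EFinB -EFinD !lee_fin; lra.
Qed.

End InCube.

Lemma grid_density k x (N : set (Rn R n)) : measurable N ->
  N `<=` [set y | ix k y = ix k x] ->
  (forall j y, (k <= j)%N -> ix k y = ix k x ->
     (mu (N `&` [set z | ix j z = ix j y]) <= (2^-1 * mesh L j ^+ n)%:E)%E) ->
  mu N = 0%E.
Proof.
move=> mN NQ h.
have Qfin : (mu [set y | ix k y = ix k x] < +oo)%E by rewrite mu_grid_idx// ltry.
have mQ : measurable [set y | ix k y = ix k x] by exact: measurable_ix.
apply: (@approximable_density _ _ _ mu ix nested measurable_ix _ mQ Qfin k) => //.
- by move=> y z yz /= <-.
- apply: approximable_Rn => //.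
  by apply: le_lt_trans Qfin; apply: le_measure; rewrite ?inE.
- move=> j y kj yQ; apply: le_trans (h j y kj yQ) _.
  by rewrite mu_grid_idx.
Qed.

Definition grid_filtration : filtration mu (2 ^+ n : R) :=
  Filtration nested measurable_ix
    (fun k => exprn_gt0 n (mesh_gt0 L0 k)) (mu_grid_idx o L0)
    (mesh_doubling n L) grid_density.

End GridDensity.

(** * Modulars and norms *)

Section Modulars.
Context {R : realType} {d} {T : measurableType d}.
Variable (mu : {measure set T -> \bar R}).
Local Notation I A F := (\int[mu]_(x in A) (F x)%:E)%E.
Variables (r : T -> R) (rP : R).
Hypothesis mr : measurable_fun setT r.
Hypothesis r1 : forall x, 1 <= r x <= rP.

Lemma I_modular_le (u : T -> R) (l c : R) : measurable_fun setT u -> 0 < l -> l <= c ->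
  (I setT (fun x => (`|u x| / c) `^ r x) <= I setT (fun x => (`|u x| / l) `^ r x))%E.
Proof.
move=> mu' l0 lc.
have c0 : 0 < c by exact: lt_le_trans lc.
have mm (a : R) : measurable_fun setT (fun x => (`|u x| / a) `^ r x).
  apply: measurable_powR2; last exact: mr.
  apply: measurable_funM; last exact: measurable_cst.
  exact: (measurableT_comp (@normr_measurable _ _)).
apply: I_le; [exact: measurableT|exact: mm|exact: mm|] => x _.
rewrite powR_ge0/=.
have [l0' c0'] := (ltW l0, ltW c0).
apply: ge0_ler_powR; [|by rewrite nnegrE divr_ge0|by rewrite nnegrE divr_ge0|].
  by have := r1 x; lra.
by rewrite ler_wpM2l// lef_pV2.
Qed.

Lemma I_modular_indic (A : set T) (u : T -> R) (l : R) :
  I setT (fun x => (`|u x * \1_A x| / l) `^ r x) = I A (fun x => (`|u x| / l) `^ r x).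
Proof.
rewrite -[in RHS](setTI A) -I_indic; apply: I_eq => x _.
rewrite indicE; case: (x \in A); rewrite ?mulr1; first by [].
rewrite !mulr0 normr0 mul0r powR0; first by [].
by apply/eqP; have := r1 x; lra.
Qed.

(** Together with the next lemma, a crude two-sided bound showing that the norm of an indicator is
    positive and finite. *)
Lemma modular_cst_ge (A : set T) (m l : R) : measurable A -> mu A = m%:E -> 0 < l ->
  (I A (fun x => l^-1 `^ r x) <= 1)%E -> Num.min 1 m <= l.
Proof.
move=> mA Am l0 hl.
have [l1|l1] := leP 1 l; first by rewrite ge_min l1.
rewrite ge_min; apply/orP; right.
have : (I A (fun=> l^-1) <= 1)%E.
  apply: le_trans hl.
  apply: I_le; [exact: mA|exact: measurable_cst|exact: measurable_cst_powR|] => x _.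
  rewrite invr_ge0 (ltW l0)/=; apply: self_le_powR; last by have /andP[] := r1 x.
  by rewrite invf_ge1// ltW.
by rewrite I_cst// Am -EFinM lee_fin mulrC ler_pdivrMr// mul1r.
Qed.

Lemma modular_cst_le (A : set T) (m : R) : measurable A -> mu A = m%:E ->
  (I A (fun x => (Num.max 1 m)^-1 `^ r x) <= 1)%E.
Proof.
move=> mA Am; set l := Num.max 1 m.
have l1 : 1 <= l by rewrite le_max lexx.
have lm : m <= l by rewrite le_max lexx orbT.
have l0 : 0 < l by exact: lt_le_trans l1.
apply: (@le_trans _ _ (I A (fun=> l^-1))).
  apply: I_le; [exact: mA|exact: measurable_cst_powR|exact: measurable_cst|] => x _.
  rewrite powR_ge0/=; apply: powR_le_self; last by have /andP[] := r1 x.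
  by rewrite invr_ge0 (ltW l0)/= invf_le1.
by rewrite I_cst// Am -EFinM lee_fin mulrC ler_pdivrMr// mul1r.
Qed.

End Modulars.

Section Norms.
Context {R : realType} (n : nat).
Local Notation T := (Rn R n).
Local Notation mu := (lebesgue_Rn R n).
Local Notation I A F := (\int[mu]_(x in A) (F x)%:E)%E.
Variables (r : T -> R) (rP : R).
Hypothesis mr : measurable_fun setT r.
Hypothesis r1 : forall x, 1 <= r x <= rP.

Lemma modularE (u : T -> R) (l : R) : 0 < l ->
  modular r (EFin \o u) l = I setT (fun x => (`|u x| / l) `^ r x).
Proof.
move=> l0; apply: eq_integral => x _ /=.
by rewrite inver gt_eqF// -EFinM poweR_EFin.
Qed.

Lemma vnorm_ge0 (g : T -> \bar R) : (0 <= vnorm r g)%E.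
Proof. by apply: le_ereal_inf_tmp => _ [l [l0 _] <-]; rewrite lee_fin ltW. Qed.

Lemma vnorm_le (g : T -> \bar R) (l : R) : 0 < l -> (modular r g l <= 1)%E ->
  (vnorm r g <= l%:E)%E.
Proof. by move=> l0 h; apply: ereal_inf_lbound; exists l. Qed.

Lemma vnorm_mono (g h : T -> \bar R) :
  (forall l : R, 0 < l -> (modular r h l <= 1)%E -> (modular r g l <= 1)%E) ->
  (vnorm r g <= vnorm r h)%E.
Proof.
move=> gh; apply: le_ereal_inf_tmp => _ [l [l0 hl] <-].
exact: (vnorm_le l0 (gh l l0 hl)).
Qed.

Lemma modular_le1 (u : T -> R) (c : R) : measurable_fun setT u ->
  (vnorm r (EFin \o u) < c%:E)%E ->
  (I setT (fun x => (`|u x| / c) `^ r x) <= 1)%E.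
Proof.
move=> mu' /ereal_inf_lt[_ [l [l0 hl] <-]]; rewrite lte_fin => lc.
rewrite (modularE u l0) in hl; apply: le_trans hl.
exact: (I_modular_le mu mr r1 mu' l0 (ltW lc)).
Qed.

Lemma modular_indicE (A : set T) (u : T -> R) (l : R) : 0 < l ->
  modular r (fun x => (u x * \1_A x)%:E) l = I A (fun x => (`|u x| / l) `^ r x).
Proof.
by move=> l0; apply: etrans (modularE _ l0) _; exact: (I_modular_indic mu r1).
Qed.

Lemma modular_indic1E (A : set T) (l : R) : 0 < l ->
  modular r (EFin \o \1_A) l = I A (fun x => l^-1 `^ r x).
Proof.
move=> l0; transitivity (modular r (fun x => (1 * \1_A x)%:E) l).
  by congr (modular r _ l); apply/funext => x /=; rewrite mul1r.
by rewrite (modular_indicE _ _ l0); apply: I_eq => x _; rewrite normr1 mul1r.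
Qed.

(* Doubling the norm avoids having to attain the infimum defining it. *)
Lemma vnorm_indic (A : set T) (m : R) : measurable A -> mu A = m%:E -> 0 < m ->
  exists2 N : R, 0 < N & vnorm r (EFin \o \1_A) = N%:E /\
    (I A (fun x => (2 * N)^-1 `^ r x) <= 1)%E.
Proof.
move=> mA Am m0.
have lo : ((Num.min 1 m)%:E <= vnorm r (EFin \o \1_A))%E.
  apply: le_ereal_inf_tmp => _ [l [l0 hl] <-]; rewrite lee_fin.
  rewrite (modular_indic1E _ l0) in hl.
  exact: (modular_cst_ge mr r1 mA Am l0 hl).
have up : (vnorm r (EFin \o \1_A) <= (Num.max 1 m)%:E)%E.
  have l0 : 0 < Num.max 1 m by rewrite lt_max ltr01.
  apply: (vnorm_le l0); rewrite (modular_indic1E _ l0).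
  exact: (modular_cst_le mr r1 mA Am).
have fN : vnorm r (EFin \o \1_A) \is a fin_num.
  by rewrite ge0_fin_numE ?vnorm_ge0// (le_lt_trans up)// ltry.
move: (fineK fN) lo; set N := fine _ => NE; rewrite -NE lee_fin => lo.
have N0 : 0 < N by apply: lt_le_trans lo; rewrite lt_min ltr01.
exists N; first by [].
split; first by [].
have N20 : 0 < 2 * N by rewrite mulr_gt0.
have h : (vnorm r (EFin \o \1_A) < (2 * N)%:E)%E by rewrite -NE lte_fin; lra.
rewrite -(modular_indic1E _ N20) (modularE _ N20).
by apply: (modular_le1 _ h); exact: measurable_indic.
Qed.

End Norms.

Section GridHypotheses.
Context {R : realType} (n : nat).
Local Notation T := (Rn R n).
Local Notation mu := (lebesgue_Rn R n).
Local Notation I A F := (\int[mu]_(x in A) (F x)%:E)%E.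
Variables (o : n.-tuple R) (L : R).
Hypothesis L0 : 0 < L.
Local Notation gf := (grid_filtration o L0).

Definition grid_cube k x : set T := open_cube (corner o L k x) (mesh L k).

Lemma grid_cellE' k x : cell gf k x = halfopen_cube (corner o L k x) (mesh L k).
Proof. exact: grid_cellE. Qed.

Lemma grid_cube_cell k x : grid_cube k x `<=` cell gf k x.
Proof. by rewrite grid_cellE'; exact: open_sub_halfopen. Qed.

Lemma measurable_grid_cube k x : measurable (grid_cube k x).
Proof. exact: measurable_open_cube. Qed.

Lemma mu_grid_cube k x : mu (grid_cube k x) = (mesh L k ^+ n)%:E.
Proof. by apply: mu_open_cube; exact: mesh_gt0. Qed.

Lemma grid_boundary k x : mu (cell gf k x `\` grid_cube k x) = 0%E.
Proof. by rewrite grid_cellE'; apply: halfopen_boundary; exact: mesh_gt0. Qed.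

Lemma grid_cube_eq k x y : cell gf k x y -> grid_cube k y = grid_cube k x.
Proof.
move=> /grid_idxP xy; congr (open_cube _ _).
by apply: eq_from_tnth => i; rewrite !tnth_mktuple xy.
Qed.

Lemma I_grid_cube k x (F : T -> R) : measurable_fun setT F -> (forall y, 0 <= F y) ->
  I (cell gf k x) F = I (grid_cube k x) F.
Proof.
move=> mF F0; have e : grid_cube k x `|` (cell gf k x `\` grid_cube k x) = cell gf k x.
  by rewrite setDUK//; exact: grid_cube_cell.
rewrite -{1}e; apply: I_null.
- exact: measurable_grid_cube.
- by apply: measurableD; [exact: measurable_cell|exact: measurable_grid_cube].
- exact: mF.
- exact: F0.
- exact: grid_boundary.
Qed.

Definition stop_cubes K P : set (set T) :=
  [set Q | exists x, Q = grid_cube (stop K P x) x].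

(** Every point of [N] lies on the boundary of its cell in some generation, and there are countably
    many such null boundaries. The measure is an outer measure on all sets, which gives the
    monotonicity used for an arbitrary [N]. *)
Lemma boundaries_null (N : set T) :
  (forall y, N y -> exists k, ~ grid_cube k y y) -> mu N = 0%E.
Proof.
move=> hN.
pose S k i : set T := [set y | grid_idx o L k y = i /\ ~ grid_cube k y y].
have S0 k i : mu (S k i) = 0%E.
  have [[x xi]|h] := pselect (exists x, grid_idx o L k x = i); last first.
    rewrite (_ : S k i = set0) ?measure0//.
    by apply/seteqP; split => // y [yi _]; apply: h; exists y.
  rewrite -(grid_boundary k x); congr (mu _); apply/seteqP; split => y.
    move=> [yi hy]; have xy : cell gf k x y by rewrite /cell /= yi xi.
    by split => //; rewrite -(grid_cube_eq xy).
  by move=> [xy hy]; split; [rewrite -xi|rewrite (grid_cube_eq xy)].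
have outer0 (F : nat -> set T) : (forall i, mu (F i) = 0%E) -> mu (\bigcup_i F i) = 0%E.
  move=> F0; apply/eqP; rewrite eq_le measure_ge0 andbT.
  have := @outer_measure_sigma_subadditive _ _ (mu_ext (borel_lebesgue R n)) F.
  move=> /le_trans; apply; rewrite eseries0// => i _ _; exact: F0.
have h0 : mu (\bigcup_k \bigcup_i S k i) = 0%E by apply: (outer0) => k; apply: (outer0) => i; exact: S0.
apply/eqP; rewrite eq_le measure_ge0 andbT -h0.
apply: (@le_outer_measure _ _ (mu_ext (borel_lebesgue R n))) => y /hN[k hk].
by exists k => //; exists (grid_idx o L k y).
Qed.

Lemma stop_cubes_partition K P : cell_invariant gf P ->
  cube_partitions R n (stop_cubes K P).
Proof.
move=> Pinv; split.
- move=> _ [x ->]; exists (corner o L (stop K P x) x), (mesh L (stop K P x)); split => //.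
  exact: mesh_gt0.
- move=> _ _ [x ->] [y ->] [z [xz yz]].
  have {}xz := grid_cube_cell xz; have {}yz := grid_cube_cell yz.
  have ex := stop_eq Pinv xz; have ey := stop_eq Pinv yz.
  rewrite -(grid_cube_eq xz) -(grid_cube_eq yz); congr grid_cube.
  by rewrite -ex -ey.
- apply: boundaries_null => y hy; exists (stop K P y) => hq; apply: hy.
  by exists (grid_cube (stop K P y) y) => //; exists y.
Qed.

Section Exponent.
Variables (p : T -> R) (pm pP : R).
Hypothesis mp : measurable_fun setT p.
Hypothesis pm1 : 1 < pm.
Hypothesis ppP : forall x, pm <= p x <= pP.

Let p1 x : 1 <= p x <= pP.
Proof. by have /andP[h1 h2] := ppP x; rewrite h2 andbT; have := pm1; lra. Qed.

Let modular_cube (u : T -> R) (l : R) k x : measurable_fun setT u ->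
  (forall y, 0 <= u y) -> 0 < l ->
  modular p (fun y => (u y * \1_(grid_cube k x) y)%:E) l =
  I (cell gf k x) (fun y => (l^-1 * u y) `^ p y).
Proof.
move=> mu' u0 l0; rewrite (modular_indicE p1 _ _ l0).
rewrite I_grid_cube.
- by apply: I_eq => y _; rewrite ger0_norm// mulrC.
- apply: measurable_powR2; last exact: mp.
  by apply: measurable_funM; [exact: measurable_cst|exact: mu'].
- by move=> y; exact: powR_ge0.
Qed.

(** The comparison on cells orders the local norms of [u] and [v], and the lattice property of the
    sequence norm links the upper estimate for [u] to the lower estimate for [v]. The added 1 makes
    the norm bound strict, so that it yields a modular bound whether or not the infimum is
    attained. *)
Lemma estimates_stopped (Y : set (set (set T)))
    (l : forall Qs : Y, sequential_space R (val Qs)) (C1 C2 : R) :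
  (forall K P, cell_invariant gf P -> Y (stop_cubes K P)) ->
  0 < C1 -> 0 < C2 ->
  (forall f, in_Lp p f -> forall Qs : Y,
     bss_norm (l Qs) (@local_norms R n p f (val Qs)) <= C1%:E * vnorm p (EFin \o f))%E ->
  (forall f, in_Lp p f -> forall Qs : Y,
     vnorm p (EFin \o f) <= C2%:E * bss_norm (l Qs) (@local_norms R n p f (val Qs)))%E ->
  stopped_estimate p (C2 * C1 + 1) gf.
Proof.
move=> hY C10 C20 hlo hup.
move=> K P Pinv u v mu' mv u0 v0 fu fv huv hv.
have norm1 (w : T -> R) : (forall y, 0 <= w y) ->
    modular p (EFin \o w) 1 = I setT (fun y => w y `^ p y).
  move=> w0; rewrite (modularE _ _ ltr01); apply: I_eq => y _.
  by rewrite divr1 ger0_norm.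
have Lu : in_Lp p u.
  split; first exact: mu'.
  by exists 1; split; [exact: ltr01|rewrite (norm1 u u0); exact: fu].
have Lv : in_Lp p v.
  split; first exact: mv.
  by exists 1; split; [exact: ltr01|rewrite (norm1 v v0); exact: fv].
have v1 : (vnorm p (EFin \o v) <= 1%:E)%E.
  by apply: (vnorm_le ltr01); rewrite (norm1 v v0); exact: hv.
pose Qs : Y := SigSub (mem_set (hY K P Pinv)).
have loc (i : val Qs) : local_norms p u i <= local_norms p v i /\ 0 <= local_norms p u i.
  have [x ix] : stop_cubes K P (val i) by apply: set_mem; exact: valP i.
  set k := stop K P x in ix.
  have le_uv : (vnorm p (fun y => (u y * \1_(val i) y)%:E) <=
       vnorm p (fun y => (v y * \1_(val i) y)%:E))%E.
    apply: vnorm_mono => a a0; rewrite ix (modular_cube _ _ mv v0 a0) (modular_cube _ _ mu' u0 a0).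
    by apply: huv; rewrite invr_gt0.
  have v1i : (vnorm p (fun y => (v y * \1_(val i) y)%:E) <= 1%:E)%E.
    apply: (vnorm_le ltr01); rewrite ix (modular_cube _ _ mv v0 ltr01).
    apply: le_trans hv.
    apply: (@le_trans _ _ (I (cell gf k x) (fun y => v y `^ p y))).
      rewrite le_eqVlt; apply/orP; left; apply/eqP; apply: I_eq => y _; by rewrite invr1 mul1r.
    apply: I_subset.
    - exact: measurable_cell.
    - exact: measurableT.
    - exact: (measurable_powR2 mv mp).
    - by move=> y _; exact: powR_ge0.
    - exact: subsetT.
  split; last by apply: fine_ge0; exact: vnorm_ge0.
  have fv1 : vnorm p (fun y => (v y * \1_(val i) y)%:E) \is a fin_num.
    by rewrite ge0_fin_numE ?vnorm_ge0// (le_lt_trans v1i)// ltry.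
  apply: fine_le; [|exact: fv1|exact: le_uv].
  by rewrite ge0_fin_numE ?vnorm_ge0// (le_lt_trans (le_trans le_uv v1i))// ltry.
have le1 : (vnorm p (EFin \o u) <= (C2 * C1)%:E)%E.
  apply: le_trans (hup u Lu Qs) _; rewrite EFinM.
  apply: lee_wpmul2l; first by rewrite lee_fin ltW.
  apply: le_trans (@bss_lattice _ _ (l Qs) (local_norms (Qs := val Qs) p v) _ _) _.
    have aux (a b : R) : a <= b /\ 0 <= a -> `|a| <= `|b|.
      by move=> [ab a0]; rewrite !ger0_norm// (le_trans a0).
    move=> i; exact: aux (loc i).
  apply: le_trans (hlo v Lv Qs) _.
  rewrite -[leRHS]mule1; apply: lee_wpmul2l; last exact: v1.
  by rewrite lee_fin ltW.
have lt1 : (vnorm p (EFin \o u) < (C2 * C1 + 1)%:E)%E.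
  by apply: le_lt_trans le1 _; rewrite lte_fin; lra.
apply: le_trans (modular_le1 mp p1 mu' lt1).
by rewrite le_eqVlt; apply/orP; left; apply/eqP; apply: I_eq => y _; rewrite ger0_norm.
Qed.

(** [t] and [s] are inverses of doubled norms, whence the factor 4; the added 1 makes the constant
    at least one, as the cell estimates assume. *)
Lemma muckenhoupt_Ap_cells (B : set (set T)) (C : R) :
  (forall k x, B (grid_cube k x)) -> 0 < C ->
  (forall Q, B Q -> vnorm p (EFin \o \1_Q) * vnorm (conj_exponent p) (EFin \o \1_Q) / mu Q
        <= C%:E)%E ->
  Ap_cells p (4 * C + 1) gf.
Proof.
move=> hB C0 hC k x; have mQ := measurable_grid_cube k x; have Qm := mu_grid_cube k x.
have m0 : 0 < mesh L k ^+ n by rewrite exprn_gt0// mesh_gt0.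
have mq := measurable_cexp mp pm1 ppP.
have [N1 N10 [e1 h1]] := vnorm_indic mp p1 mQ Qm m0.
have [N2 N20 [e2 h2]] := vnorm_indic mq (cexp_bounds pm1 ppP) mQ Qm m0.
have := hC _ (hB k x); rewrite Qm e1.
rewrite (_ : vnorm (conj_exponent p) _ = N2%:E); last exact: e2.
set m := mesh L k ^+ n in m0 Qm *.
have -> : (N1%:E * N2%:E / m%:E)%E = (N1 * N2 / m)%:E.
  by rewrite inver gt_eqF// -!EFinM.
rewrite lee_fin (ler_pdivrMr _ _ m0) => hN.
have i1 : 0 < (2 * N1)^-1 by rewrite invr_gt0 mulr_gt0.
have i2 : 0 < (2 * N2)^-1 by rewrite invr_gt0 mulr_gt0.
exists (2 * N1)^-1, (2 * N2)^-1; split; [exact: i1|exact: i2| | |].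
- rewrite I_grid_cube; first exact: h1.
  + exact: measurable_cst_powR.
  + by move=> y; exact: powR_ge0.
- rewrite I_grid_cube; first exact: h2.
  + exact: measurable_cst_powR.
  + by move=> y; exact: powR_ge0.
rewrite (_ : cell_size gf k = m); last by [].
rewrite (_ : _ * m = ((4 * C + 1) * m) / (4 * (N1 * N2))); last first.
  by field; rewrite !gt_eqF.
rewrite ler_pdivlMr ?mulr_gt0//; lra.
Qed.

End Exponent.
End GridHypotheses.

(** * Shifted grids *)

Section Shifts.
Context {R : realType}.

Lemma pow2_mod3 k (w : int) : (2 ^+ k : int) + 3 * w != 0.
Proof.
apply/eqP => h; have : (3 %| 2 ^ k)%N.
  have e : (2 ^ k)%:Z = 3 * - w by rewrite -natz natrX; lia.
  by have : (3 %| (2 ^ k)%:Z)%Z; [rewrite e dvdz_mulr|].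
by rewrite Euclid_dvdX.
Qed.

Definition shift (L : R) (b : bool) : R := if b then L / 3 else 0.

(* The boundary points of the two grids of mesh h = L / 2^k are at distance at
   least h / 3, because 3 does not divide 2^k. *)
Lemma interval_in_grid (L a s : R) k : 0 < L -> 0 <= s -> 3 * s < mesh L k ->
  exists (b : bool) (z : int), shift L b + mesh L k * z%:~R <= a /\
    a + s < shift L b + mesh L k * z%:~R + mesh L k.
Proof.
move=> L0 s0; set h := mesh L k => sh.
have h0 : 0 < h by exact: mesh_gt0.
have Lh : L = h * 2 ^+ k by rewrite /h /mesh divfK// gt_eqF// exprn_gt0.
have fl (c : R) : exists z : int, c + h * z%:~R <= a < c + h * z%:~R + h.
  exists (Num.floor ((a - c) / h)).
  have /andP[h1 h2] := floor_itv ((a - c) / h).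
  move: h1 h2; set w := Num.floor _ => h1 h2.
  rewrite ler_pdivlMr// in h1; rewrite ltr_pdivrMr// intrD in h2.
  by apply/andP; split; lra.
have [z0 /andP[a0 b0]] := fl 0; have [z1 /andP[a1 b1]] := fl (L / 3).
have [lt0|le0] := ltP (a + s) (0 + h * z0%:~R + h); first by exists false, z0.
have [lt1|le1] := ltP (a + s) (L / 3 + h * z1%:~R + h); first by exists true, z1.
(* If both grids fail, each has a boundary point in ]a, a + s]. The two points differ by h (2^k + 3
   w) / 3 with w = z1 - z0, and by less than h / 3 in absolute value, so the integer 2^k + 3 w is
   zero. *)
exfalso; move/eqP : (pow2_mod3 k (z1 - z0)); apply.
have e : ((2 ^+ k + 3 * (z1 - z0) : int)%:~R : R) = 2 ^+ k + 3 * (z1%:~R - z0%:~R).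
  by rewrite intrD intrM intrB rmorphXn.
have l1 : h * (2 ^+ k + 3 * (z1%:~R - z0%:~R)) < h * 1.
  by move: Lh a0 b0 a1 b1 le0 le1 sh; rewrite mulrDr => <-; lra.
have l2 : h * -1 < h * (2 ^+ k + 3 * (z1%:~R - z0%:~R)).
  by move: Lh a0 b0 a1 b1 le0 le1 sh; rewrite mulrDr => <-; lra.
rewrite !(ltr_pM2l h0) -e in l1 l2.
have l1' : (2 ^+ k + 3 * (z1 - z0) : int) < 1 by rewrite -(ltr_int R).
have l2' : -1 < (2 ^+ k + 3 * (z1 - z0) : int) by rewrite -(ltr_int R).
by move: l1' l2'; move: (_ + _ : int) => w; clear; lia.
Qed.

Lemma scale_between (L s : R) K : 3 * s < L -> mesh L K <= 3 * s ->
  exists2 k, (k <= K)%N & 3 * s < mesh L k /\ mesh L k <= 6 * s.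
Proof.
move=> sL; have m0 : 3 * s < mesh L 0 by rewrite /mesh expr0 divr1.
elim: K => [|K IH] h; first by have := lt_le_trans m0 h; rewrite ltxx.
have [/IH[k kK hk]|lt] := leP (mesh L K) (3 * s).
  by exists k => //; exact: leqW.
exists K => //; split => //; rewrite meshS; lra.
Qed.

Variable n : nat.
Local Notation T := (Rn R n).
Local Notation mu := (lebesgue_Rn R n).
Local Notation I A F := (\int[mu]_(x in A) (F x)%:E)%E.

Definition origin (L : R) (e : {ffun 'I_n -> bool}) : n.-tuple R :=
  [tuple shift L (e i) | i < n].

(** The shift is chosen in each coordinate separately, which is why all 2^n combinations of shifts
    are needed. *)
Lemma cube_in_cell (L : R) (L0 : 0 < L) (a : n.-tuple R) (s : R) k : 0 <= s ->
  3 * s < mesh L k -> exists e, forall x, closed_cube a s x ->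
  closed_cube a s `<=` cell (grid_filtration (origin L e) L0) k x.
Proof.
move=> s0 sh.
suff /choice[g hg] : forall i, exists bz : bool * int,
    shift L bz.1 + mesh L k * bz.2%:~R <= tnth a i /\
    tnth a i + s < shift L bz.1 + mesh L k * bz.2%:~R + mesh L k.
  exists [ffun i => (g i).1] => x hx y hy.
  have h z i : closed_cube a s z -> grid_coord (origin L [ffun i => (g i).1]) L k z i = (g i).2.
    move=> hz; apply/(grid_coordP _ L0); rewrite tnth_mktuple ffunE.
    have [h1 h2] := hg i; have /andP[h3 h4] := hz i.
    by rewrite (le_trans h1 h3) (le_lt_trans h4 h2).
  by apply/grid_idxP => i; rewrite !h.
move=> i; have [b [z h]] := interval_in_grid (tnth a i) L0 s0 sh.
by exists (b, z).
Qed.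

Lemma open_sub_closed (a : n.-tuple R) (s : R) : open_cube a s `<=` closed_cube a s.
Proof. by move=> x h i; have /andP[/ltW -> /ltW ->] := h i. Qed.

End Shifts.

Section UnitBall.
Context {R : realType} {d} {T : measurableType d}.
Variable (mu : {measure set T -> \bar R}).
Local Notation I A F := (\int[mu]_(x in A) (F x)%:E)%E.
Variables (p : T -> R) (pm pP : R).
Hypothesis mp : measurable_fun setT p.
Hypothesis pm1 : 1 < pm.
Hypothesis ppP : forall x, pm <= p x <= pP.
Implicit Types F : T -> R.

Definition unit_ball F := [/\ measurable_fun setT F, forall x, 0 <= F x &
  (I setT (fun x => F x `^ p x) <= 1)%E].

Let p1 x : 1 < p x. Proof. exact: exponent_gt1 pm1 ppP x. Qed.

Lemma powR_div_le (t c : R) x : 0 <= t -> 1 <= c -> (t / c) `^ p x <= c^-1 * t `^ p x.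
Proof.
move=> t0 c1; have c0 : 0 < c by exact: lt_le_trans c1.
rewrite powRM ?invr_ge0 ?(ltW c0)// mulrC ler_wpM2r ?powR_ge0//.
apply: powR_le_self; last exact: ltW.
by rewrite invr_ge0 (ltW c0) invf_le1.
Qed.

Lemma I_powR_div F c (M : R) : measurable_fun setT F -> (forall x, 0 <= F x) -> 1 <= c ->
  (I setT (fun x => F x `^ p x) <= M%:E)%E ->
  (I setT (fun x => (F x / c) `^ p x) <= (M / c)%:E)%E.
Proof.
move=> mF F0 c1 h; have c0 : 0 < c by exact: lt_le_trans c1.
have mFp : measurable_fun setT (fun x => F x `^ p x) by exact: measurable_powR2 mF mp.
apply: (@le_trans _ _ (I setT (fun x => c^-1 * F x `^ p x))).
  apply: I_le.
  - exact: measurableT.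
  - apply: measurable_powR2; last exact: mp.
    by apply: measurable_funM; [exact: mF|exact: measurable_cst].
  - by apply: measurable_funM; [exact: measurable_cst|exact: mFp].
  - by move=> x _; rewrite powR_ge0; exact: powR_div_le.
rewrite I_scale; [|exact: measurableT|exact: mFp|by rewrite invr_ge0 ltW|
  by move=> x _; exact: powR_ge0].
rewrite mulrC EFinM; apply: lee_wpmul2l; last exact: h.
by rewrite lee_fin invr_ge0 ltW.
Qed.

Lemma unit_ball_div F c : 1 <= c -> unit_ball F -> unit_ball (fun x => F x / c).
Proof.
move=> c1 [mF F0 hF]; have c0 : 0 < c by exact: lt_le_trans c1.
split; [|by move=> x; rewrite divr_ge0// ltW|].
  by apply: measurable_funM; [exact: mF|exact: measurable_cst].
apply: le_trans (I_powR_div mF F0 c1 hF) _.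
by rewrite lee_fin mul1r invf_le1.
Qed.

Variables (cn ca C0 : R).
Hypothesis ca1 : 1 <= ca.
Hypothesis C01 : 1 <= C0.
Hypothesis cn1 : 1 <= cn.
Variable f : filtration mu cn.
Hypothesis HA : Ap_cells p ca f.
Hypothesis Hst : stopped_estimate p C0 f.

Let c1 : 1 <= 2 * ca. Proof. by have := ca1; lra. Qed.
Let dmax K F := dyadic_max f K (fun x => F x / (2 * ca)).

Lemma dyadic_max_unit_ball (x0 : T) K F c : unit_ball F -> 1 <= c ->
  (I setT (fun x => (dmax K F x / c) `^ p x) <= (dyadic_const cn pm pP ca C0 / c)%:E)%E.
Proof.
move=> [mF F0 hF] hc; have [mF' F0' _] := unit_ball_div c1 (And3 mF F0 hF).
apply: I_powR_div.
- exact: measurable_dyadic_max.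
- by move=> x; exact: dyadic_max_ge0.
- exact: hc.
apply: (dyadic_max_bounded mp pm1 ppP ca1 C01 cn1 HA Hst K mF' F0' _ x0).
apply: le_trans hF; rewrite le_eqVlt; apply/orP; left; apply/eqP; apply: I_eq => x _.
by congr (_ `^ _); field; have := ca1; lra.
Qed.

Lemma I_cell_dyadic_max K F k x : unit_ball F -> (k <= K)%N ->
  (I (cell f k x) F <= (2 * ca * dmax K F x * cell_size f k)%:E)%E.
Proof.
move=> uF kK; have [mF F0 hF] := uF.
have [mF' F0' hF'] := unit_ball_div c1 uF.
have e : I (cell f k x) F = I (cell f k x) (fun y => 2 * ca * (F y / (2 * ca))).
  by apply: I_eq => y _; field; have := ca1; lra.
have ca0 : 0 <= 2 * ca by have := ca1; lra.
rewrite e I_scale; [|exact: measurable_cell|exact: mF'|exact: ca0|by move=> y _; exact: F0'].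
rewrite (I_average mp pm1 ppP f k x mF' F0' hF') -EFinM lee_fin -mulrA.
apply: ler_wpM2l; first exact: ca0.
by apply: ler_wpM2r; [exact/ltW/cell_size_gt0|exact: average_le_max].
Qed.

End UnitBall.

(** * Majorants for averages over arbitrary cubes *)

Section StrongType.
Context {R : realType} (n : nat).
Local Notation T := (Rn R n).
Local Notation mu := (lebesgue_Rn R n).
Local Notation I A F := (\int[mu]_(x in A) (F x)%:E)%E.
Variables (p : T -> R) (pm pP : R).
Hypothesis mp : measurable_fun setT p.
Hypothesis pm1 : 1 < pm.
Hypothesis ppP : forall x, pm <= p x <= pP.
Implicit Types F : T -> R.
Local Notation unit_ball := (unit_ball mu p).

(** Here [r] bounds the average of [F] over the cube. A sequence of majorants is used because each
    grid has a largest mesh and is followed through finitely many generations: a given cube is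
    handled only from some index on. Fatou's lemma will take the limit, with measurability asked of
    the [h m] rather than of the maximal function. *)
Definition strong_type (S : set R) (D : R) := forall F, unit_ball F ->
  exists h : nat -> T -> R, [/\ forall m, measurable_fun setT (h m),
    forall m x, 0 <= h m x, forall m, (I setT (h m) <= 1)%E &
    forall a s x, S s -> closed_cube a s x -> exists N, forall m, (N <= m)%N ->
      exists r, [/\ 0 <= r, (I (closed_cube a s) F <= (r * s ^+ n)%:E)%E &
        (r / D) `^ p x <= h m x]].

Section OneScale.
Variables (L : R) (L0 : 0 < L) (K : nat) (ca C0 : R).
Hypothesis ca1 : 1 <= ca.
Hypothesis C01 : 1 <= C0.
Let gf (e : {ffun 'I_n -> bool}) := grid_filtration (origin L e) L0.
Hypothesis HA : forall e, Ap_cells p ca (gf e).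
Hypothesis Hst : forall e, stopped_estimate p C0 (gf e).
Let J := index_enum {ffun 'I_n -> bool}.

Definition shift_max e F := dyadic_max (gf e) K (fun x => F x / (2 * ca)).

(** The number of shifts enters because the majorant is a sum over all of them and must keep modular
    at most one. *)
Definition shift_const : R :=
  Num.max 1 ((size J)%:R * dyadic_const (2 ^+ n) pm pP ca C0).

Definition shift_majorant F x : R := \sum_(e <- J) (shift_max e F x / shift_const) `^ p x.

Lemma shift_const_ge1 : 1 <= shift_const.
Proof. by rewrite le_max lexx. Qed.

Lemma shift_max_ge0 e F x : (forall y, 0 <= F y) -> 0 <= shift_max e F x.
Proof.
move=> F0; apply: dyadic_max_ge0 => y; rewrite divr_ge0//.
by have := ca1; lra.
Qed.

Let mterm e F : measurable_fun setT (fun x => (shift_max e F x / shift_const) `^ p x).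
Proof.
apply: measurable_powR2; last exact: mp.
by apply: measurable_funM; [exact: measurable_dyadic_max|exact: measurable_cst].
Qed.

Lemma measurable_shift_majorant F : measurable_fun setT (shift_majorant F).
Proof. by apply: measurable_sum => e; exact: mterm. Qed.

Lemma shift_majorant_ge0 F x : 0 <= shift_majorant F x.
Proof. by apply: sumr_ge0 => e _; exact: powR_ge0. Qed.

Lemma shift_max_le_majorant e F x :
  (shift_max e F x / shift_const) `^ p x <= shift_majorant F x.
Proof.
rewrite /shift_majorant (bigD1_seq e) ?mem_index_enum ?index_enum_uniq//= lerDl.
by apply: sumr_ge0 => e' _; exact: powR_ge0.
Qed.

Lemma I_shift_majorant F : unit_ball F -> (I setT (shift_majorant F) <= 1)%E.
Proof.
have cn1 : 1 <= 2 ^+ n :> R by rewrite exprn_ege1//; lra.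
have E0 : 0 < shift_const by exact: lt_le_trans shift_const_ge1.
move=> uF; rewrite /shift_majorant I_sum; [|exact: measurableT|by move=> e; exact: mterm|
  by move=> e x _; exact: powR_ge0].
apply: (@le_trans _ _ (\sum_(e <- J) (dyadic_const (2 ^+ n) pm pP ca C0 / shift_const)%:E)%E).
  apply: lee_sum => e _.
  exact: (dyadic_max_unit_ball mp pm1 ppP ca1 C01 cn1 (@HA e) (@Hst e) point K uF
    shift_const_ge1).
rewrite sumEFin lee_fin big_const_seq count_predT iter_addr_0.
have le : (size J)%:R * dyadic_const (2 ^+ n) pm pP ca C0 <= shift_const.
  by rewrite le_max lexx orbT.
move: le E0; move: (dyadic_const _ _ _ _ _) shift_const => dc E le E0.
by rewrite -mulr_natl mulrA ler_pdivrMr// mul1r.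
Qed.

(* A cube lies in a cell of one of the shifted grids, at every scale where the
   mesh exceeds three times its side. *)
Lemma I_cube_le F a s k : unit_ball F -> 0 <= s -> 3 * s < mesh L k -> (k <= K)%N ->
  exists e, forall x, closed_cube a s x ->
    (I (closed_cube a s) F <= (2 * ca * shift_max e F x * mesh L k ^+ n)%:E)%E.
Proof.
move=> uF s0 sk kK; have [mF F0 _] := uF.
have [e he] := cube_in_cell L0 a s0 sk; exists e => x ax.
apply: (@le_trans _ _ (I (cell (gf e) k x) F)).
  apply: I_subset; [exact: measurable_closed_cube|exact: measurable_cell|exact: mF|
    by move=> y _; exact: F0|exact: he x ax].
exact: (I_cell_dyadic_max mp pm1 ppP ca1 (gf e) x uF kK).
Qed.

End OneScale.

Section Grids.
Variables (S : set R) (Ls : nat -> R) (Ls0 : forall m, 0 < Ls m) (Ks : nat -> nat).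
Hypothesis scales : forall s, S s -> 0 < s /\ exists N, forall m, (N <= m)%N ->
  3 * s < Ls m /\ mesh (Ls m) (Ks m) <= 3 * s.
Variables (ca C0 : R).
Hypothesis ca1 : 1 <= ca.
Hypothesis C01 : 1 <= C0.
Let gf m (e : {ffun 'I_n -> bool}) := grid_filtration (origin (Ls m) e) (Ls0 m).
Hypothesis HA : forall m e, Ap_cells p ca (gf m e).
Hypothesis Hst : forall m e, stopped_estimate p C0 (gf m e).

(** The cell found has mesh at most six times the side of the cube, hence 6^n; [2 * ca] undoes the
    normalisation inside [shift_max]. *)
Lemma strong_type_grids : exists2 D, 0 < D & strong_type S D.
Proof.
set E := shift_const ca C0.
have E0 : 0 < E by apply: lt_le_trans (shift_const_ge1 ca C0).
have c0 : 0 < 2 * ca by have := ca1; lra.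
have c60 : 0 < 2 * ca * 6 ^+ n by apply: (mulr_gt0 c0); exact: exprn_gt0.
exists (2 * ca * 6 ^+ n * E); first exact: (mulr_gt0 c60 E0).
move=> F uF; have [mF F0 hF] := uF.
exists (fun m => shift_majorant (Ls0 m) (Ks m) ca C0 F); split.
- by move=> m; exact: measurable_shift_majorant.
- by move=> m x; exact: shift_majorant_ge0.
- by move=> m; exact: (I_shift_majorant (Ks m) ca1 C01 (@HA m) (@Hst m) uF).
move=> a s x Ss ax; have [s0 [N hN]] := scales Ss; exists N => m Nm.
have [h1 h2] := hN m Nm.
have [k kK [h3 h4]] := scale_between h1 h2.
have [e he] := I_cube_le (Ls0 m) ca1 a uF (ltW s0) h3 kK.
set M := shift_max (Ls0 m) (Ks m) ca e F x.
have M0 : 0 <= M by exact: shift_max_ge0.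
exists (2 * ca * 6 ^+ n * M); split.
- exact: (mulr_ge0 (ltW c60) M0).
- apply: le_trans (he x ax) _.
  rewrite lee_fin (_ : 2 * ca * 6 ^+ n * _ * _ = 2 * ca * M * (6 * s) ^+ n).
    apply: ler_wpM2l; first exact: (mulr_ge0 (ltW c0) M0).
    have l0 : 0 <= mesh (Ls m) k by apply/ltW/mesh_gt0.
    by apply: lerXn2r; rewrite ?nnegrE// mulr_ge0// ltW.
  by rewrite exprMn; ring.
have -> : 2 * ca * 6 ^+ n * M / (2 * ca * 6 ^+ n * E) = M / E.
  by rewrite -mulf_div divff ?mul1r// gt_eqF.
exact: shift_max_le_majorant.
Qed.

End Grids.

(** Averaging the two majorants keeps the integral at most one; the factor 1/2 lost on each is paid
    by the 2 in the constant, because p >= 1. *)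
Lemma strong_typeU (S1 S2 : set R) (D1 D2 : R) : 0 < D1 -> 0 < D2 ->
  strong_type S1 D1 -> strong_type S2 D2 -> strong_type (S1 `|` S2) (2 * (D1 + D2)).
Proof.
move=> D10 D20 H1 H2 F uF.
have [h1 [m1 h10 I1 c1]] := H1 F uF; have [h2 [m2 h20 I2 c2]] := H2 F uF.
have half (r D t x : R) : 0 <= r -> 0 < D -> D <= D1 + D2 -> (r / D) `^ t <= x -> 1 <= t ->
    (r / (2 * (D1 + D2))) `^ t <= 2^-1 * x.
  move=> r0 D0 DD hr t1.
  have rD : 0 <= r / D by rewrite divr_ge0// ltW.
  have rD2 : 0 <= r / D / 2 by rewrite divr_ge0.
  apply: (@le_trans _ _ ((r / D / 2) `^ t)).
    apply: ge0_ler_powR; [lra|rewrite nnegrE divr_ge0//; lra|by rewrite nnegrE|].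
    by rewrite -mulrA ler_wpM2l// -invfM lef_pV2 ?posrE; lra.
  have i2 : 0 <= (2^-1 : R) <= 1 by apply/andP; split; lra.
  have i20 : 0 <= (2^-1 : R) by lra.
  rewrite (powRM t rD i20) mulrC; apply: ler_pM; [exact: powR_ge0|exact: powR_ge0| |exact: hr].
  exact: powR_le_self i2 t1.
exists (fun m x => 2^-1 * (h1 m x + h2 m x)); split.
- by move=> m; apply: measurable_funM; [exact: measurable_cst|apply: measurable_funD].
- by move=> m x; rewrite mulr_ge0// addr_ge0.
- move=> m; rewrite I_scale; [|exact: measurableT|by apply: measurable_funD| by rewrite invr_ge0|
    by move=> x _; rewrite addr_ge0].
  rewrite I_add; [|exact: measurableT|exact: m1|exact: m2|by move=> x _|by move=> x _].
  apply: (@le_trans _ _ (2^-1%:E * (1 + 1))%E).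
    apply: lee_wpmul2l; first by rewrite lee_fin invr_ge0.
    exact: leeD.
  by rewrite -EFinD -EFinM lee_fin; lra.
have p1 x : 1 <= p x by exact/ltW/(exponent_gt1 pm1 ppP).
move=> a s x [Ss|Ss] ax.
- have [N hN] := c1 a s x Ss ax; exists N => m /hN[r [r0 hr hD]].
  exists r; split; [exact: r0|exact: hr|].
  apply: (half _ D1); [exact: r0|exact: D10|lra| |exact: p1].
  by apply: le_trans hD _; rewrite lerDl.
- have [N hN] := c2 a s x Ss ax; exists N => m /hN[r [r0 hr hD]].
  exists r; split; [exact: r0|exact: hr|].
  apply: (half _ D2); [exact: r0|exact: D20|lra| |exact: p1].
  by apply: le_trans hD _; rewrite lerDr.
Qed.

End StrongType.

(** * Averages at one fixed scale and their iteration *)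

Section FixedScale.
Context {R : realType} (n : nat).
Local Notation T := (Rn R n).
Local Notation mu := (lebesgue_Rn R n).
Local Notation I A F := (\int[mu]_(x in A) (F x)%:E)%E.
Variables (p : T -> R) (pm pP : R).
Hypothesis mp : measurable_fun setT p.
Hypothesis pm1 : 1 < pm.
Hypothesis ppP : forall x, pm <= p x <= pP.
Implicit Types F G : T -> R.
Local Notation unit_ball := (unit_ball mu p).

Let p0 x : p x != 0.
Proof. by apply/eqP; have := exponent_gt1 pm1 ppP x; lra. Qed.

(** The integral is not divided by the volume, which is fixed and absorbed by [D]. Since [G / D] is
    again in the unit ball, the property can be applied to its own output. *)
Definition scale_bounded (s D : R) := forall F, unit_ball F ->
  exists G, [/\ measurable_fun setT G, forall x, 0 <= G x,
    (I setT (fun x => (G x / D) `^ p x) <= 1)%E &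
    forall a x, closed_cube a s x -> (I (closed_cube a s) F <= (G x)%:E)%E].

Lemma scale_bounded_grid (L : R) (L0 : 0 < L) (ca C0 s : R) :
  1 <= ca -> 1 <= C0 ->
  (forall e, Ap_cells p ca (grid_filtration (origin (n := n) L e) L0)) ->
  (forall e, stopped_estimate p C0 (grid_filtration (origin (n := n) L e) L0)) ->
  0 <= s -> 3 * s < L -> exists2 D, 0 < D & scale_bounded s D.
Proof.
move=> ca1 C01 HA Hst s0 sL.
set E := shift_const n pm pP ca C0.
have E0 : 0 < E by apply: lt_le_trans (shift_const_ge1 n pm pP ca C0).
have c0 : 0 < 2 * ca by lra.
have D0 : 0 < 2 * ca * L ^+ n * E.
  by apply: mulr_gt0 => //; apply: mulr_gt0 => //; exact: exprn_gt0.
exists (2 * ca * L ^+ n * E); first exact: D0.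
move=> F uF; have [mF F0 hF] := uF.
pose H := shift_majorant p pm pP L0 0 ca C0 F.
have H0 x : 0 <= H x by exact: shift_majorant_ge0.
have r0 x : 0 <= H x `^ (p x)^-1 by exact: powR_ge0.
have mp' : measurable_fun setT (fun x => (p x)^-1).
  rewrite (_ : (fun x => _) = (fun x => p x `^ (-1))).
    exact: measurable_powRc.
  by apply/funext => x; rewrite powR_inv1//; have := exponent_gt1 pm1 ppP x; lra.
exists (fun x => 2 * ca * L ^+ n * E * H x `^ (p x)^-1); split.
- apply: measurable_funM; first exact: measurable_cst.
  by apply: measurable_powR2; [exact: measurable_shift_majorant|exact: mp'].
- by move=> x; apply: mulr_ge0; [exact: ltW|exact: r0].
- apply: (@le_trans _ _ (I setT H)); last first.
    by have := I_shift_majorant mp pm1 ppP 0 ca1 C01 HA Hst uF; apply.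
  rewrite le_eqVlt; apply/orP; left; apply/eqP; apply: I_eq => x _.
  by rewrite mulrC mulKf ?gt_eqF// -powRrM mulVf// powRr1.
move=> a x ax.
have m0 : 3 * s < mesh L 0 by rewrite /mesh expr0 divr1.
have [e he] := I_cube_le mp pm1 ppP L0 ca1 a uF s0 m0 (leqnn 0).
apply: le_trans (he x ax) _; rewrite lee_fin /mesh expr0 divr1.
set M := shift_max _ _ _ _ _ _.
have M0 : 0 <= M by exact: shift_max_ge0.
have ME0 : 0 <= M / E by rewrite divr_ge0// ltW.
have -> : 2 * ca * M * L ^+ n = 2 * ca * L ^+ n * E * (M / E).
  by field; rewrite gt_eqF.
apply: ler_wpM2l; first exact: ltW.
have -> : M / E = ((M / E) `^ p x) `^ (p x)^-1 by rewrite -powRrM mulfV// powRr1.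
apply: ge0_ler_powR; rewrite ?nnegrE.
- by rewrite invr_ge0; have := exponent_gt1 pm1 ppP x; lra.
- exact: powR_ge0.
- exact: H0.
- exact: shift_max_le_majorant.
Qed.

Definition corner_shift (a : n.-tuple R) (t : R) (e : {ffun 'I_n -> bool}) : n.-tuple R :=
  [tuple tnth a i + (if e i then t else 0) | i < n].

Lemma closed_cube_cover (a : n.-tuple R) (s : R) x : 0 <= s -> closed_cube a (3 / 2 * s) x ->
  exists e, closed_cube (corner_shift a (s / 2) e) s x.
Proof.
move=> s0 h; exists [ffun i => tnth a i + s < tnth x i] => i.
have /andP[h1 h2] := h i; rewrite tnth_mktuple ffunE.
by case: ltP => ?; apply/andP; split; lra.
Qed.

Lemma closed_cube_center (a : n.-tuple R) (s : R) e : 0 <= s ->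
  closed_cube [tuple tnth a i + s / 2 | i < n] (s / 2)
    `<=` closed_cube (corner_shift a (s / 2) e) s.
Proof.
move=> s0 x h i; have := h i; rewrite !tnth_mktuple => /andP[h1 h2].
by case: (e i); apply/andP; split; lra.
Qed.

(* The corner cubes of side [s] of a cube of side [3 s / 2] cover it and all
   contain its central cube, so averaging twice at scale [s] reaches across. *)
Lemma scale_boundedS (s D : R) : 0 < s -> 0 < D -> scale_bounded s D ->
  exists2 D', 0 < D' & scale_bounded (3 / 2 * s) D'.
Proof.
move=> s0 D0 H.
pose J := index_enum {ffun 'I_n -> bool}.
have t0 : 0 < s / 2 by lra.
have z0 : 0 < (s / 2) ^+ n by exact: exprn_gt0.
pose c : R := (size J)%:R * (D / (s / 2) ^+ n).
have J0 : (0 < size J)%N.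
  have := mem_index_enum ([ffun=> true] : {ffun 'I_n -> bool}); rewrite -/J.
  by case: (J).
have c0 : 0 < c by rewrite mulr_gt0 ?ltr0n// divr_gt0.
exists (c * D); first exact: mulr_gt0.
move=> F uF; have [mF F0 hF] := uF.
have [G1 [mG1 G10 hG1 F1]] := H F uF.
have uG1 : unit_ball (fun x => G1 x / D).
  split; [|by move=> x; rewrite divr_ge0// ltW|exact: hG1].
  by apply: measurable_funM; [exact: mG1|exact: measurable_cst].
have [G2 [mG2 G20 hG2 F2]] := H _ uG1.
exists (fun x => c * G2 x); split.
- by apply: measurable_funM; [exact: measurable_cst|exact: mG2].
- by move=> x; rewrite mulr_ge0// ltW.
- apply: le_trans hG2; rewrite le_eqVlt; apply/orP; left; apply/eqP; apply: I_eq => x _.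
  by rewrite -mulf_div divff ?mul1r// gt_eqF.
move=> a x ax.
pose Q e := closed_cube (corner_shift a (s / 2) e) s.
pose Z : set T := closed_cube [tuple tnth a i + s / 2 | i < n] (s / 2).
have mZ : measurable Z by exact: measurable_closed_cube.
have mQ e : measurable (Q e) by exact: measurable_closed_cube.
have ZQ e : Z `<=` Q e by exact/closed_cube_center/ltW.
have [e0 xe0] := closed_cube_cover (ltW s0) ax.
(* On the central cube [G1] is at least the whole integral over [Q e]. A second application, at the
   corner cube containing [x], sees the central cube and carries this value to [x]. *)
have corner e : (I (Q e) F <= (D / (s / 2) ^+ n * G2 x)%:E)%E.
  pose z : T := [tuple tnth a i + s / 2 | i < n].
  have Zz : Z z by move=> i; rewrite tnth_mktuple lexx lerDl ltW.
  have I0 : (0 <= I (Q e) F)%E by apply: I_ge0 => y _; exact: F0.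
  have fI : I (Q e) F \is a fin_num.
    by rewrite (ge0_fin_numE I0); apply: le_lt_trans (F1 _ z (ZQ e z Zz)) _; exact: ltry.
  have v0 : 0 <= fine (I (Q e) F) by exact: fine_ge0.
  have vG y : Z y -> fine (I (Q e) F) <= G1 y.
    by move=> Zy; rewrite -lee_fin (fineK fI); exact: F1 _ y (ZQ e y Zy).
  rewrite -(fineK fI) lee_fin; set v := fine _ in v0 vG *.
  have : (I Z (fun=> v / D) <= (G2 x)%:E)%E.
    apply: le_trans (F2 _ x xe0).
    apply: (@le_trans _ _ (I Z (fun y => G1 y / D))).
      apply: I_le; [exact: mZ|exact: measurable_cst|by have [] := uG1|] => y Zy.
      by rewrite divr_ge0 ?(ltW D0)//= ler_wpM2r ?invr_ge0 ?(ltW D0)// vG.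
    apply: I_subset; [exact: mZ|exact: mQ|by have [] := uG1| |exact: ZQ].
    by move=> y _; rewrite divr_ge0// ltW.
  rewrite (I_cst _ mZ) (mu_closed_cube _ t0) -EFinM lee_fin => h.
  have -> : D / (s / 2) ^+ n * G2 x = G2 x * D / (s / 2) ^+ n by ring.
  by rewrite ler_pdivlMr// -ler_pdivrMr// mulrAC.
have mFQ e : measurable_fun setT (fun y => F y * \1_(Q e) y).
  by apply: measurable_funM; [exact: mF|exact: measurable_indic].
have FQ0 e y : 0 <= F y * \1_(Q e) y by rewrite mulr_ge0.
apply: (@le_trans _ _ (\sum_(e <- J) I (Q e) F)%E).
  rewrite -(setTI (closed_cube _ _)) -I_indic.
  rewrite (eq_bigr (fun e => I setT (fun y => F y * \1_(Q e) y))); last first.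
    by move=> e _; rewrite I_indic setTI.
  rewrite -I_sum; [|exact: measurableT|exact: mFQ|by move=> e y _; exact: FQ0].
  apply: I_le; [exact: measurableT| |exact: measurable_sum|] => [|y _].
    by apply: measurable_funM; [exact: mF|apply: measurable_indic; exact: measurable_closed_cube].
  rewrite mulr_ge0//=; have s0' := sumr_ge0 _ (fun e (_ : true) => FQ0 e y).
  rewrite [in leLHS]indicE; have [/set_mem yC|_] := boolP (y \in _); last first.
    by rewrite mulr0; exact: s0'.
  have [e ye] := closed_cube_cover (ltW s0) yC.
  rewrite (bigD1_seq e) ?mem_index_enum ?index_enum_uniq//= [X in _ <= _ * X + _]indicE.
  by rewrite mem_set// lerDl; apply: sumr_ge0 => e' _; exact: FQ0.
apply: (@le_trans _ _ (\sum_(e <- J) (D / (s / 2) ^+ n * G2 x)%:E)%E).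
  by apply: lee_sum => e _; exact: corner.
rewrite sumEFin lee_fin big_const_seq count_predT iter_addr_0 /c -[leRHS]mulrA.
by rewrite [leRHS]mulr_natl.
Qed.

Lemma scale_bounded_iter (s D : R) k : 0 < s -> 0 < D -> scale_bounded s D ->
  exists2 D', 0 < D' & scale_bounded ((3 / 2) ^+ k * s) D'.
Proof.
move=> s0 D0 H; elim: k => [|k [D' D'0 IH]]; first by exists D; rewrite ?expr0 ?mul1r.
rewrite exprS -mulrA; apply: scale_boundedS D'0 IH.
by rewrite mulr_gt0// exprn_gt0//; lra.
Qed.

(** A cube of side t <= 1 lies in the cube of side [s] with the same corner, and 6 t >= 1 pays for
    the change of volume. *)
Lemma strong_type_large (s D : R) : 1 <= s -> 0 < D -> scale_bounded s D ->
  strong_type p [set t | 1 / 6 <= t <= 1] (6 ^+ n * D).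
Proof.
move=> s1 D0 H F uF; have [mF F0 hF] := uF; have [G [mG G0 hG FG]] := H F uF.
exists (fun _ x => (G x / D) `^ p x); split.
- move=> _; apply: measurable_powR2; last exact: mp.
  by apply: measurable_funM; [exact: mG|exact: measurable_cst].
- by move=> _ x; exact: powR_ge0.
- by move=> _; exact: hG.
move=> a t x /andP[t6 t1] ax; exists 0%N => _ _; exists (6 ^+ n * G x).
have c6 : 0 < 6 ^+ n :> R by exact: exprn_gt0.
have sub : closed_cube a t `<=` closed_cube a s.
  by move=> y h i; have /andP[h1 h2] := h i; rewrite h1/=; lra.
split.
- by rewrite mulr_ge0// ltW.
- apply: (@le_trans _ _ (I (closed_cube a s) F)).
    apply: I_subset; [exact: measurable_closed_cube|exact: measurable_closed_cube|
      exact: mF|by move=> y _; exact: F0|exact: sub].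
  apply: le_trans (FG a x (sub x ax)) _; rewrite lee_fin mulrAC -exprMn.
  rewrite -[leLHS]mul1r ler_wpM2r// exprn_ege1//; lra.
by rewrite -mulf_div divff ?mul1r// gt_eqF.
Qed.

End FixedScale.

(** * The maximal operator *)

Section ExtendedReals.
Context {R : realType}.

Lemma poweR_mono (x y : \bar R) (r : R) : 0 <= r -> (0 <= x)%E -> (x <= y)%E ->
  (x `^ r <= y `^ r)%E.
Proof.
move=> r0 x0 xy; have y0 := le_trans x0 xy.
by apply: (gt0_ler_poweR r0); rewrite ?in_itv/= ?x0 ?y0 ?leey.
Qed.

Lemma limn_einf_le (u : (\bar R)^nat) (c : \bar R) : (forall m, (u m <= c)%E) ->
  (limn_einf u <= c)%E.
Proof.
move=> h; rewrite limn_einf_lim; apply: lime_le; first exact: is_cvg_einfs.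
apply: nearW => m; apply: le_trans (h m); apply: ereal_inf_lbound.
by exists m => //=.
Qed.

Lemma limn_einf_ge (u : (\bar R)^nat) (c : \bar R) N :
  (forall m, (N <= m)%N -> (c <= u m)%E) -> (c <= limn_einf u)%E.
Proof.
move=> h; rewrite limn_einf_lim; apply: lime_ge; first exact: is_cvg_einfs.
exists N => // m /= Nm; apply: le_ereal_inf_tmp => _ [k /= mk <-].
by apply: h; exact: leq_trans mk.
Qed.

(** The integral of a non-negative function is a supremum over the simple functions below it, hence
    monotone for arbitrary functions; it is applied to maximal functions. *)
Lemma integral_le_nonmeasurable {d} {T : measurableType d} (mu : {measure set T -> \bar R})
    (f g : T -> \bar R) : (forall x, (0 <= f x)%E) -> (forall x, (f x <= g x)%E) ->
  (\int[mu]_x f x <= \int[mu]_x g x)%E.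
Proof.
move=> f0 fg; have g0 x : (0 <= g x)%E by exact: le_trans (fg x).
rewrite (ge0_integralTE _ f0) (ge0_integralTE _ g0).
apply: ereal_sup_le => _ [h hf <-]; exists h => // x.
by apply: le_trans (fg x); exact: hf.
Qed.

End ExtendedReals.

Section FromStrongType.
Context {R : realType} (n : nat).
Local Notation T := (Rn R n).
Local Notation mu := (lebesgue_Rn R n).
Local Notation I A F := (\int[mu]_(x in A) (F x)%:E)%E.
Variables (p : T -> R) (pm pP : R).
Hypothesis mp : measurable_fun setT p.
Hypothesis pm1 : 1 < pm.
Hypothesis ppP : forall x, pm <= p x <= pP.
Variables (B : set (set T)) (S : set R) (D : R).
Hypothesis D0 : 0 < D.
Hypothesis BS : forall Q, B Q -> exists a s,
  [/\ 0 < s, S s & Q = open_cube a s \/ Q = closed_cube a s].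
Hypothesis Bx : forall x, exists2 Q, B Q & Q x.
Hypothesis HS : strong_type p S D.
Implicit Types F f : T -> R.

Let p1 x : 1 < p x. Proof. exact: exponent_gt1 pm1 ppP x. Qed.

Let p1' x : 1 <= p x <= pP.
Proof. by rewrite ltW//=; have /andP[] := ppP x. Qed.

Let cube_facts Q : B Q -> exists a s, [/\ 0 < s, S s, Q `<=` closed_cube a s,
  measurable Q & mu Q = (s ^+ n)%:E].
Proof.
move=> /BS[a [s [s0 Ss [->|->]]]]; exists a, s; split => //.
- exact: open_sub_closed.
- exact: measurable_open_cube.
- exact: mu_open_cube.
- exact: measurable_closed_cube.
- exact: mu_closed_cube.
Qed.

Let maximal_ge0 f x : (0 <= maximal B f x)%E.
Proof.
have [Q BQ Qx] := Bx x; have [a [s [s0 _ _ _ Qs]]] := cube_facts BQ.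
apply: (@le_trans _ _ ((\int[mu]_(y in Q) `|f y|%:E) / mu Q)%E).
  rewrite Qs inver gt_eqF ?exprn_gt0//; apply: mule_ge0.
    by apply: integral_ge0 => y _; rewrite lee_fin.
  by rewrite lee_fin invr_ge0 exprn_ge0// ltW.
by apply: ereal_sup_ubound; exists Q.
Qed.

(** By Fatou's lemma the lower limit [W] of the majorants has integral at most one. It dominates the
    p-th power of every average at [x] divided by [D], and taking p-th roots allows the supremum
    over the cubes. *)
Lemma modular_maximal F : unit_ball mu p F -> (modular p (maximal B F) D <= 1)%E.
Proof.
move=> uF; have [mF F0 _] := uF; have [h [mh h0 Ih hc]] := HS uF.
pose W x := limn_einf (fun m => (h m x)%:E).
have W0 x : (0 <= W x)%E.
  by apply: (@limn_einf_ge _ _ _ 0) => m _; rewrite lee_fin.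
apply: (@le_trans _ _ (\int[mu]_x W x)%E); last first.
  apply: le_trans (fatou mu measurableT _ _) _.
  - by move=> m; apply/measurable_EFinP; exact: mh.
  - by move=> m x _; rewrite lee_fin.
  - by apply: limn_einf_le => m; exact: Ih.
apply: integral_le_nonmeasurable => x; first exact: poweR_ge0.
have px0 : 0 <= p x by have := p1 x; lra.
have [->|Wfin] := eqVneq (W x) +oo%E; first exact: leey.
have {Wfin} Wfin : W x \is a fin_num by rewrite ge0_fin_numE// lt_neqAle Wfin leey.
rewrite -(fineK Wfin); set w := fine (W x).
have w0 : 0 <= w by exact: fine_ge0.
have key : (maximal B F x <= (D * w `^ (p x)^-1)%:E)%E.
  apply: ge_ereal_sup => _ [Q [BQ Qx] <-].
  have [a [s [s0 Ss QC mQ Qs]]] := cube_facts BQ.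
  have sn0 : 0 < s ^+ n by exact: exprn_gt0.
  have [N hN] := hc a s x Ss (QC x Qx).
  have -> : (\int[mu]_(y in Q) `|F y|%:E = I Q F)%E.
    by apply: eq_integral => y _; rewrite ger0_norm.
  have IQ m : (N <= m)%N -> exists r, [/\ 0 <= r, (I Q F <= (r * s ^+ n)%:E)%E &
        (r / D) `^ p x <= h m x].
    move=> /hN[r [r0 hr hD]]; exists r; split; [exact: r0| |exact: hD].
    apply: le_trans hr; apply: I_subset; [exact: mQ|exact: measurable_closed_cube|exact: mF|
      by move=> y _; exact: F0|exact: QC].
  have I0 : (0 <= I Q F)%E by apply: I_ge0 => y _; exact: F0.
  have fI : I Q F \is a fin_num.
    have [r [_ hr _]] := IQ N (leqnn N).
    by rewrite (ge0_fin_numE I0); apply: le_lt_trans hr _; exact: ltry.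
  move: IQ; rewrite -(fineK fI) Qs inver (gt_eqF sn0) -EFinM lee_fin.
  have v0 := fine_ge0 I0; set v := fine _ in v0 * => IQ.
  have vD0 : 0 <= v / s ^+ n / D by rewrite !divr_ge0// ltW.
  have : (((v / s ^+ n / D) `^ p x)%:E <= W x)%E.
    apply: (@limn_einf_ge _ _ _ N) => m /IQ[r [r0 hr hD]].
    rewrite lee_fin; apply: le_trans hD; rewrite lee_fin in hr.
    apply: (ge0_ler_powR px0); rewrite ?nnegrE//; first by rewrite divr_ge0// ltW.
    by rewrite ler_wpM2r ?invr_ge0 ?(ltW D0)// ler_pdivrMr.
  rewrite -(fineK Wfin) lee_fin -/w => hw.
  rewrite [leRHS]mulrC -(ler_pdivrMr _ _ D0).
  have -> : v / s ^+ n / D = ((v / s ^+ n / D) `^ p x) `^ (p x)^-1.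
    by rewrite -powRrM mulfV ?powRr1// gt_eqF//; have := p1 x; lra.
  apply: ge0_ler_powR; rewrite ?nnegrE ?powR_ge0 ?invr_ge0//.
have -> : w%:E = ((w `^ (p x)^-1)%:E `^ p x)%E.
  rewrite poweR_EFin -powRrM mulVf ?powRr1// gt_eqF//; have := p1 x; lra.
apply: poweR_mono => //.
  by rewrite inver gt_eqF//; apply: mule_ge0 => //; rewrite lee_fin invr_ge0 ltW.
rewrite gee0_abs// inver gt_eqF// lee_pdivrMr// -EFinM mulrC.
exact: key.
Qed.

Lemma strong_type_maximal_bounded : maximal_bounded B p.
Proof.
exists D; split; first exact: D0.
move=> f [mf _].
have N0 : (0 <= vnorm p (EFin \o f))%E by exact: vnorm_ge0.
have [->|Nfin] := eqVneq (vnorm p (EFin \o f)) +oo%E.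
  by rewrite gt0_muley ?lte_fin// leey.
have {Nfin} Nfin : vnorm p (EFin \o f) \is a fin_num.
  by rewrite ge0_fin_numE// lt_neqAle Nfin leey.
have := fine_ge0 N0; move: (fineK Nfin); set N := fine _ => eN N0'.
rewrite -eN -EFinM; apply/lee_addgt0Pr => e e0; rewrite -EFinD.
(* The slack makes [c] strictly larger than the norm, and positive even when the norm is zero. *)
pose c := N + e / D.
have c0 : 0 < c by rewrite ltr_wpDl// divr_gt0.
have -> : D * N + e = c * D by rewrite /c mulrDl divfK ?gt_eqF// mulrC.
have Nc : (vnorm p (EFin \o f) < c%:E)%E by rewrite -eN lte_fin ltrDl divr_gt0.
have uF : unit_ball mu p (fun x => `|f x| / c).
  split; [|by move=> x; rewrite divr_ge0// ltW|exact: (modular_le1 mp p1' mf Nc)].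
  apply: measurable_funM; last exact: measurable_cst.
  exact: (measurableT_comp (@normr_measurable _ _)).
apply: vnorm_le; first exact: mulr_gt0.
apply: le_trans (modular_maximal uF).
apply: integral_le_nonmeasurable => x; first exact: poweR_ge0.
have px0 : 0 <= p x by have := p1 x; lra.
have cD0 : 0 < c * D by exact: mulr_gt0.
apply: (poweR_mono px0).
  by rewrite inver (gt_eqF cD0); apply: mule_ge0 => //; rewrite lee_fin invr_ge0 ltW.
rewrite (gee0_abs (maximal_ge0 _ _)) (gee0_abs (maximal_ge0 _ _)).
have le : (maximal B f x <= c%:E * maximal B (fun x => (`|f x| / c)%R) x)%E.
  apply: ge_ereal_sup => _ [Q [BQ Qx] <-].
  have [a [s [s0 Ss QC mQ Qs]]] := cube_facts BQ.
  have -> : (\int[mu]_(y in Q) `|f y|%:E =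
     c%:E * \int[mu]_(y in Q) `|(`|f y| / c)%R|%:E)%E.
    rewrite -(@I_scale _ _ _ mu Q c (fun y => `|(`|f y| / c)%R|)).
    - apply: I_eq => y _; rewrite (@ger0_norm _ (`|f y| / c)) ?divr_ge0 ?(ltW c0)//.
      by rewrite mulrCA mulfV ?mulr1// gt_eqF.
    - exact: mQ.
    - by have [mF _ _] := uF; exact: (measurableT_comp (@normr_measurable _ _) mF).
    - exact: ltW.
    - by move=> y _.
  rewrite -muleA; apply: lee_wpmul2l; first by rewrite lee_fin ltW.
  by apply: ereal_sup_ubound; exists Q.
rewrite inver (gt_eqF cD0) inver (gt_eqF D0).
apply: (@le_trans _ _ ((c%:E * maximal B (fun x => (`|f x| / c)%R) x) * ((c * D)^-1)%:E)%E).
  by apply: lee_wpmul2r => //; rewrite lee_fin invr_ge0 ltW.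
rewrite muleC muleA -EFinM invfM mulrAC mulVf ?gt_eqF// mul1r muleC.
exact: lexx.
Qed.

End FromStrongType.

(** * Necessity of the A_p condition *)

Section Necessity.
Context {R : realType} (n : nat).
Local Notation T := (Rn R n).
Local Notation mu := (lebesgue_Rn R n).
Local Notation I A F := (\int[mu]_(x in A) (F x)%:E)%E.
Variables (p : T -> R) (pm pP : R).
Hypothesis mp : measurable_fun setT p.
Hypothesis pm1 : 1 < pm.
Hypothesis ppP : forall x, pm <= p x <= pP.
Variable B : set (set T).
Hypothesis BS : forall Q, B Q -> measurable Q /\ exists2 m : R, 0 < m & mu Q = m%:E.
Local Notation q x := (cexp (p x)).

Let p1 x : 1 < p x. Proof. exact: exponent_gt1 pm1 ppP x. Qed.

Let p1' x : 1 <= p x <= pP.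
Proof. by rewrite ltW//=; have /andP[] := ppP x. Qed.

Let mq : measurable_fun setT (fun x => q x) := measurable_cexp mp pm1 ppP.

Let q1 : forall x, 1 <= q x <= cexp pm := cexp_bounds pm1 ppP.

(* The dual norm of the indicator is nearly attained by [s `^ q]. *)
Lemma I_dual_indic_ge (Q : set T) (N : R) : measurable Q -> 0 < N ->
  vnorm (conj_exponent p) (EFin \o \1_Q) = N%:E ->
  (((4 `^ cexp pm)^-1)%:E <= I Q (fun x => (2 * N)^-1 `^ q x))%E.
Proof.
move=> mQ N0 eN; have N20 : 0 < N / 2 by lra.
have i0 : 0 <= (2 * N)^-1 by rewrite invr_ge0 mulr_ge0// ltW.
have k0 : 0 < 4 `^ cexp pm :> R by exact: powR_gt0.
(* [N / 2] is below the norm, so the modular there exceeds one; passing from [N / 2] to [2 * N]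
   costs at most 4 to the power [cexp pm]. *)
have : ~ (modular (fun x => q x) (EFin \o \1_Q) (N / 2) <= 1)%E.
  move=> /(vnorm_le N20); rewrite (_ : vnorm _ _ = N%:E); last exact: eN.
  by rewrite lee_fin; lra.
move=> /negP; rewrite -ltNge (modular_indic1E q1 _ N20) => h.
have : (1 <= (4 `^ cexp pm)%:E * I Q (fun x => (2 * N)^-1 `^ q x))%E.
  apply: (le_trans (ltW h)).
  rewrite -I_scale; [|exact: mQ|exact: measurable_cst_powR|exact: ltW|by move=> x _; exact: powR_ge0].
  apply: I_le; [exact: mQ|exact: measurable_cst_powR| |] => [|x _].
    by apply: measurable_funM; [exact: measurable_cst|exact: measurable_cst_powR].
  rewrite powR_ge0/= (_ : (N / 2)^-1 = 4 * (2 * N)^-1); last by field; rewrite gt_eqF.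
  rewrite powRM//; apply: ler_wpM2r; first exact: powR_ge0.
  by apply: ler_powR; [lra|have /andP[] := q1 x].
have i2 : (0%:E <= (4 `^ cexp pm)^-1%:E :> \bar R)%E by rewrite lee_fin invr_ge0 ltW.
move=> /(lee_wpmul2l i2); rewrite mule1 muleA -EFinM mulVf ?mul1e// gt_eqF.
Qed.

(** Because (q - 1) p = q, the test function has norm at most one, whereas its average over [Q] is
    at least A = k / (s m). The maximal function is thus at least [A] on [Q], and boundedness limits
    [A] times the norm of the indicator. *)
Lemma maximal_bounded_muckenhoupt : maximal_bounded B p -> muckenhoupt B p.
Proof.
move=> [C [C0 hC]]; set k : R := (4 `^ cexp pm)^-1.
have k0 : 0 < k by rewrite invr_gt0 powR_gt0.
exists (C / (2 * k)); split; first by rewrite divr_gt0// mulr_gt0.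
move=> Q BQ; have [mQ [m m0 Qm]] := BS BQ.
have [N1 N10 [e1 _]] := vnorm_indic mp p1' mQ Qm m0.
have [N2 N20 [e2 h2]] := vnorm_indic mq q1 mQ Qm m0.
have kI := I_dual_indic_ge mQ N20 e2.
rewrite e1 Qm (_ : vnorm (conj_exponent p) _ = N2%:E); last exact: e2.
have -> : (N1%:E * N2%:E / m%:E)%E = (N1 * N2 / m)%:E.
  by rewrite inver gt_eqF// -!EFinM.
set s := (2 * N2)^-1 in h2 kI.
have s0 : 0 < s by rewrite invr_gt0 mulr_gt0.
pose g x := s `^ (q x - 1).
have mg : measurable_fun setT g.
  by apply: measurable_cst_powR; apply: measurable_funB; [exact: mq|exact: measurable_cst].
have g0 x : 0 <= g x by exact: powR_ge0.
pose f x := g x * \1_Q x.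
have mf : measurable_fun setT f.
  by apply: measurable_funM; [exact: mg|exact: measurable_indic].
have f1 : (modular p (EFin \o f) 1 <= 1)%E.
  rewrite (modular_indicE p1' Q g ltr01); apply: le_trans h2.
  rewrite le_eqVlt; apply/orP; left; apply/eqP; apply: I_eq => x _.
  by rewrite divr1 (ger0_norm (g0 x)) /g -powRrM cexp_sub1.
have Lf : in_Lp p f.
  split; first exact: mf.
  by exists 1; split; [exact: ltr01|apply: le_lt_trans f1 _; exact: ltry].
have hM : (vnorm p (maximal B f) <= C%:E)%E.
  apply: le_trans (hC f Lf) _; rewrite -[leRHS]mule1.
  by apply: lee_wpmul2l; [rewrite lee_fin ltW|exact: (vnorm_le ltr01)].
pose A := k / (s * m).
have A0 : 0 < A by rewrite divr_gt0// mulr_gt0.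
have If : (\int[mu]_(y in Q) `|f y|%:E = s^-1%:E * I Q (fun x => s `^ q x))%E.
  rewrite -I_scale; [|exact: mQ|exact: measurable_cst_powR|by rewrite invr_ge0 ltW|
    by move=> x _; exact: powR_ge0].
  apply: I_eq => x Qx; rewrite /f indicE mem_set// mulr1 (ger0_norm (g0 x)) /g.
  by rewrite powRB// ?powRr1 ?(ltW s0)//; [rewrite mulrC|rewrite (gt_eqF s0) implybT].
have MA x : Q x -> (A%:E <= maximal B f x)%E.
  move=> Qx; apply: (@le_trans _ _ ((\int[mu]_(y in Q) `|f y|%:E) / mu Q)%E); last first.
    by apply: ereal_sup_ubound; exists Q.
  rewrite If Qm inver (gt_eqF m0).
  have -> : A%:E = (s^-1%:E * k%:E * m^-1%:E)%E.
    by rewrite -!EFinM /A; congr EFin; field; rewrite !gt_eqF.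
  apply: lee_wpmul2r; first by rewrite lee_fin invr_ge0 ltW.
  by apply: lee_wpmul2l; [rewrite lee_fin invr_ge0 ltW|exact: kI].
have : ((A * N1)%:E <= vnorm p (maximal B f))%E.
  apply: le_ereal_inf_tmp => _ [l [l0 hl] <-]; rewrite lee_fin mulrC -ler_pdivlMr// -lee_fin -e1.
  have lA : 0 < l / A by exact: divr_gt0.
  apply: (vnorm_le lA); apply: le_trans hl.
  apply: integral_le_nonmeasurable => x; first exact: poweR_ge0.
  rewrite /= indicE; have [/set_mem Qx|_] := boolP (x \in Q); last first.
    rewrite normr0 mul0e poweR0r; first exact: poweR_ge0.
    by apply/eqP; have := p1 x; lra.
  have px0 : 0 <= p x by have := p1 x; lra.
  apply: (poweR_mono px0).
    rewrite inver (gt_eqF lA) normr1 -EFinM lee_fin mul1r invr_ge0; exact: ltW.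
  rewrite normr1 !inver (gt_eqF lA) (gt_eqF l0) -EFinM mul1r invf_div EFinM.
  apply: lee_wpmul2r; first by rewrite lee_fin invr_ge0 ltW.
  have M0 := le_trans (ltW A0 : (0%:E <= A%:E)%E) (MA x Qx).
  by rewrite (gee0_abs M0); exact: MA.
move=> /le_trans/(_ hM); rewrite !lee_fin => hA.
rewrite ler_pdivlMr ?mulr_gt0//.
apply: le_trans hA; rewrite le_eqVlt; apply/orP; left; apply/eqP.
by rewrite /A /s; field; rewrite !gt_eqF.
Qed.

End Necessity.

(** * The equivalence *)

Section Cubes.
Context {R : realType} (n : nat).
Local Notation T := (Rn R n).
Local Notation mu := (lebesgue_Rn R n).

Lemma measurable_cube (Q : set T) : cubes R n Q ->
  measurable Q /\ exists2 m : R, 0 < m & mu Q = m%:E.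
Proof.
move=> [a [s [s0 [->|->]]]]; split.
- exact: measurable_open_cube.
- by exists (s ^+ n); [exact: exprn_gt0|exact: mu_open_cube].
- exact: measurable_closed_cube.
- by exists (s ^+ n); [exact: exprn_gt0|exact: mu_closed_cube].
Qed.

Lemma unit_cube_mem (x : T) : local_cubes R n (closed_cube x 1) /\ closed_cube x 1 x.
Proof.
split; last by move=> i; rewrite lexx lerDl ler01.
split; first by exists x, 1; split; [exact: ltr01|right].
by rewrite (mu_closed_cube _ ltr01) expr1n.
Qed.

(** Positive dimension is what turns measure at most one into side at most one: for n = 0 every cube
    has measure one. *)
Lemma local_cube_side (Q : set T) : (0 < n)%N -> local_cubes R n Q -> exists a s,
  [/\ 0 < s, s <= 1 & Q = open_cube a s \/ Q = closed_cube a s].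
Proof.
move=> n0 [[a [s [s0 hQ]]] Q1]; exists a, s; split => //.
have : s ^+ n <= 1 by case: hQ Q1 => ->; rewrite ?(mu_open_cube _ s0) ?(mu_closed_cube _ s0) lee_fin.
by apply: contraTT; rewrite -!ltNge => s1; rewrite exprn_egt1// -lt0n.
Qed.

Lemma pow2_large (a b : R) : exists N, forall m, (N <= m)%N -> a < 2 ^+ m /\ b < 2 ^+ m.
Proof.
exists (Num.Def.archi_bound `|a| + Num.Def.archi_bound `|b|)%N => m Nm.
have h (c : R) : (Num.Def.archi_bound `|c| <= m)%N -> c < 2 ^+ m.
  move=> cm; apply: le_lt_trans (ler_norm c) _.
  apply: lt_le_trans (archi_boundP (normr_ge0 c)) _; rewrite -natrX ler_nat.
  by apply: (leq_trans cm); apply: ltnW; exact: ltn_expl.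
by split; apply: h; apply: leq_trans Nm; [exact: leq_addr|exact: leq_addl].
Qed.

End Cubes.

Section Sufficiency.
Context {R : realType} (n : nat).
Local Notation T := (Rn R n).
Local Notation mu := (lebesgue_Rn R n).
Variables (p : T -> R) (pm pP : R).
Hypothesis mp : measurable_fun setT p.
Hypothesis pm1 : 1 < pm.
Hypothesis ppP : forall x, pm <= p x <= pP.

Lemma muckenhoupt_maximal_bounded
    (l : forall Qs : cube_partitions R n, sequential_space R (val Qs)) :
  lower_estimate p l -> upper_estimate p l ->
  muckenhoupt (cubes R n) p -> maximal_bounded (cubes R n) p.
Proof.
move=> [C1 [C10 hlo]] [C2 [C20 hup]] [C [C0 hC]].
have Ls0 m : 0 < 2 ^+ m :> R by exact: exprn_gt0.
have c0 : 0 < C2 * C1 by exact: mulr_gt0.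
(* Grid [m] starts at mesh 2^m and is followed through 2 m generations, down to 2^-m; three times
   any given side lies between these bounds for all large [m]. *)
have [s s0|||m e|m e|D D0 HS] := @strong_type_grids R n p pm pP mp pm1 ppP [set s | 0 < s] _ Ls0
    (fun m => (m + m)%N) _ (4 * C + 1) (C2 * C1 + 1).
- split => //; have [N hN] := pow2_large (3 * s) (3 * s)^-1.
  exists N => m /hN[h1 h2]; split => //.
  have s3 : 0 < 3 * s by rewrite mulr_gt0.
  rewrite /mesh exprD -{1}(mul1r (2 ^+ m)) -mulf_div divff ?gt_eqF// mulr1.
  by rewrite div1r invf_ple ?posrE// ltW.
- by lra.
- by lra.
- apply: (muckenhoupt_Ap_cells _ mp pm1 ppP _ C0 hC) => k x.
  by exists (corner (origin (2 ^+ m) e) (2 ^+ m) k x), (mesh (2 ^+ m) k); split; [exact: mesh_gt0|left].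
- refine (estimates_stopped mp pm1 ppP _ C10 C20 hlo hup); move=> K P.
  exact: stop_cubes_partition.
apply: (strong_type_maximal_bounded mp pm1 ppP D0 _ _ HS).
- by move=> Q [a [s [s0 hQ]]]; exists a, s.
- by move=> x; have [[hQ _] xQ] := unit_cube_mem x; exists (closed_cube x 1).
Qed.

Lemma local_muckenhoupt_maximal_bounded (n_gt0 : (0 < n)%N)
    (l : forall Qs : local_cube_partitions R n, sequential_space R (val Qs)) :
  lower_estimate p l -> upper_estimate p l ->
  muckenhoupt (local_cubes R n) p -> maximal_bounded (local_cubes R n) p.
Proof.
move=> [C1 [C10 hlo]] [C2 [C20 hup]] [C [C0 hC]].
(* Mesh 1/2 at the top keeps the measure of every cell strictly below one, as local partitions
   require. Since the mesh has to exceed three times the side, the grids reach sides below 1/6. *)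
have L0 : 0 < 1 / 2 :> R by lra.
have c0 : 0 < C2 * C1 by exact: mulr_gt0.
have ca1 : 1 <= 4 * C + 1 by lra.
have C01 : 1 <= C2 * C1 + 1 by lra.
have meshn k : mesh (1 / 2 : R) k ^+ n < 1.
  have m0 := mesh_gt0 L0 k.
  rewrite exprn_ilt1 ?(ltW m0)//; first by rewrite -lt0n.
  rewrite /mesh ltr_pdivrMr ?exprn_gt0// mul1r.
  have : 1 <= 2 ^+ k :> R by rewrite exprn_ege1//; lra.
  by lra.
have HA (e : {ffun 'I_n -> bool}) :
    Ap_cells p (4 * C + 1) (grid_filtration (origin (1 / 2) e) L0).
  apply: (muckenhoupt_Ap_cells _ mp pm1 ppP _ C0 hC) => k x; split.
    by exists (corner (origin (1 / 2) e) (1 / 2) k x), (mesh (1 / 2) k); split; [exact: mesh_gt0|left].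
  by rewrite (mu_grid_cube _ L0) lee_fin ltW.
have Hst (e : {ffun 'I_n -> bool}) :
    stopped_estimate p (C2 * C1 + 1) (grid_filtration (origin (1 / 2) e) L0).
  refine (estimates_stopped mp pm1 ppP _ C10 C20 hlo hup); move=> K P Pinv; split.
    exact: stop_cubes_partition.
  by move=> _ [x ->]; rewrite (mu_grid_cube _ L0) lte_fin.
have [s [s0 s6]|D1 D10 HS1] := @strong_type_grids R n p pm pP mp pm1 ppP
    [set s | 0 < s /\ s < 1 / 6] _ (fun=> L0) id _ _ _ ca1 C01 (fun=> HA) (fun=> Hst).
  split => //; have [N hN] := pow2_large 0 (3 * s)^-1.
  exists N => m /hN[_ h2]; split; first by lra.
  have s3 : 0 < 3 * s by rewrite mulr_gt0.
  have h : (2 ^+ m)^-1 <= 3 * s by rewrite invf_ple ?posrE ?exprn_gt0// ltW.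
  have i0 : 0 < (2 ^+ m)^-1 :> R by rewrite invr_gt0 exprn_gt0.
  by rewrite /mesh; lra.
(* For sides from 1/6 to 1, start from 1/7, which the grid still reaches; five enlargements by 3/2
   pass 1, as (3/2)^5 > 7. *)
have [||D2 D20 H2] := scale_bounded_grid mp pm1 ppP (s := 1 / 7) ca1 C01 HA Hst; [lra|lra|].
have s7 : 0 < 1 / 7 :> R by lra.
have [D3 D30 H3] := scale_bounded_iter 5 s7 D20 H2.
have s5 : 1 <= (3 / 2) ^+ 5 * (1 / 7) :> R by rewrite !exprS expr0; lra.
have HS2 := strong_type_large mp s5 D30 H3.
have D40 : 0 < 6 ^+ n * D3 by rewrite mulr_gt0// exprn_gt0.
have HS := strong_typeU pm1 ppP D10 D40 HS1 HS2.
apply: (strong_type_maximal_bounded mp pm1 ppP _ _ _ HS).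
- by rewrite mulr_gt0// addr_gt0.
- move=> Q /(local_cube_side n_gt0)[a [s [s0 s1 hQ]]]; exists a, s; split => //.
  have [lt|ge] := ltP s (1 / 6); first by left.
  by right; rewrite /= ge.
- by move=> x; have [hQ xQ] := unit_cube_mem x; exists (closed_cube x 1).
Qed.

End Sufficiency.

Theorem theorem2p3 (R : realType) (n : nat) (n_gt0 : (0 < n)%N)
    (p : Rn R n -> R) (p_ge1 : forall x, 1 <= p x)
    (p_meas : measurable_fun setT p)
    (p_lower : (1 < p_minus p)%E) (p_upper : (p_minus p <= p_plus p < +oo)%E) :
  ((exists l : forall Qs : cube_partitions R n, sequential_space R (val Qs),
      lower_estimate p l /\ upper_estimate p l) ->
   (maximal_bounded (cubes R n) p <-> muckenhoupt (cubes R n) p)) /\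
  ((exists l : forall Qs : local_cube_partitions R n,
                 sequential_space R (val Qs),
      lower_estimate p l /\ upper_estimate p l) ->
   (maximal_bounded (local_cubes R n) p <-> muckenhoupt (local_cubes R n) p)).
Proof.
have lo x : (p_minus p <= (p x)%:E)%E by apply: ereal_inf_lbound; exists x.
have up x : ((p x)%:E <= p_plus p)%E by apply: ereal_sup_ubound; exists x.
have flo : p_minus p \is a fin_num.
  rewrite fin_numElt (lt_trans _ p_lower) ?ltNyr//=.
  by apply: le_lt_trans (lo point) _; exact: ltry.
have fup : p_plus p \is a fin_num.
  rewrite fin_numElt (lt_le_trans _ (up point)) ?ltNyr//=.
  by have /andP[] := p_upper.
have pm1 : 1 < fine (p_minus p) by rewrite -lte_fin fineK.
have ppP x : fine (p_minus p) <= p x <= fine (p_plus p).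
  by rewrite -!lee_fin !fineK// lo up.
split=> -[l [hlo hup]]; split.
- by apply: (maximal_bounded_muckenhoupt p_meas pm1 ppP); exact: measurable_cube.
- exact: (muckenhoupt_maximal_bounded p_meas pm1 ppP hlo hup).
- apply: (maximal_bounded_muckenhoupt p_meas pm1 ppP) => Q [hQ _].
  exact: measurable_cube.
- exact: (local_muckenhoupt_maximal_bounded p_meas pm1 ppP n_gt0 hlo hup).
Qed.
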